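(* Let $S\in\mathrm{Sing}^{\mathrm{tr}}(\Delta,\overline x)$, let the circuit $C_S$ in the subdivision dual to $S$ be of type A or B, and let $\overline p\in((\mathbb K^* )^3)^N$ be a generic configuration with $\mathrm{Val}(\overline p)=\overline x$. Then: (i) if $C_S$ is not $\mathbb Z$-affine equivalent to $\{(0,0,0),(1,0,0),(0,1,0),(1,2,5),(3,7,20)\}$, then for any point $\overline\alpha\in A(S,\overline p)$ there exists a unique algebraic surface $\mathcal S\in\mathrm{Sing}(\Delta,\overline p,S)$ matching the enhancement $\overline\alpha$; (ii) if $C_S$ is $\mathbb Z$-affine equivalent to $\{(0,0,0),(1,0,0),(0,1,0),(1,2,5),(3,7,20)\}$, then for any point $\overline\alpha\in A(S,\overline p)$ there exist $5$ algebraic surfaces $\mathcal S\in\mathrm{Sing}(\Delta,\overline p,S)$ matching the enhancement $\overline\alpha$.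
   Context: General setting. $\mathbb K=\bigcup_{m\ge1}\mathbb C\{t^{1/m}\}$ is the field of locally convergent Puiseux series with $\mathrm{Val}(\sum_r a_rt^r)=-\min\{r:a_r\ne0\}$ (applied coordinatewise to points); $O(t^{>0})$ denotes terms with positive powers of $t$. $\Delta\subset\mathbb R^3$ is a convex lattice polytope such that the differences of points of $\Delta\cap\mathbb Z^3$ generate $\mathbb Z^3$; $N=|\Delta\cap\mathbb Z^3|-2>0$. $\mathrm{Sing}(\Delta)$ is the family of surfaces defined by Laurent polynomials over $\mathbb K$ with support in $\Delta$ having a singular point in $(\mathbb K^* )^3$; $\Delta$ is assumed non-defective, i.e. $\mathrm{Sing}(\Delta)$ is a hypersurface. A tropical surface $S$ with Newton polytope $\Delta$ is the corner locus of $F_S(X)=\max_{\omega\in\Delta\cap\mathbb Z^3}(c_\omega+\langle\omega,X\rangle)$; $\nu_S:\Delta\to\mathbb R$ is the Legendre dual convex piecewise linear function (its graph is the lower part of the convex hull of the points $(\omega,-c_\omega)$) and $\Sigma_S$ is the dual subdivision of $\Delta$ into linearity domains of $\nu_S$. $\mathrm{Sing}^{\mathrm{tr}}(\Delta)$ is the set of tropicalizations of surfaces in $\mathrm{Sing}(\Delta)$. Point configuration. $v\in\mathbb Q^3$ is not parallel or orthogonal to any proper affine subspace of $\mathbb R^3$ spanned by a subset of $\Delta\cap\mathbb Z^3$; $\overline x=(x_1,\dots,x_N)$ with $x_i=M_iv$, $M_i$ rational, $0\ll M_1\ll\dots\ll M_N$ ($M_1$ and the ratios $M_{i+1}/M_i$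 exceed a sufficiently large constant depending only on $\Delta$ and $v$). $\mathrm{Sing}^{\mathrm{tr}}(\Delta,\overline x)=\{S\in\mathrm{Sing}^{\mathrm{tr}}(\Delta): S\supset\overline x\}$; all its elements are of maximal-dimensional geometric type (deformation space of dimension $N$). $\mathrm{Sing}(\Delta,\overline p,S)$ is the set of surfaces in $\mathrm{Sing}(\Delta)$ that tropicalize to $S$ and pass through $\overline p$. Circuits. A circuit is an affinely dependent set of lattice points all of whose proper subsets are affinely independent. It is known that $\Sigma_S$ has a unique circuit $C_S$. It is of type A if it is the vertex set of a pentatope (three-dimensional polytope with five vertices) whose vertices are its only lattice points, equivalent under affine automorphisms of $\mathbb Z^3$ to $\{(0,0,0),(1,0,0),(0,1,0),(0,0,1),(1,p,q)\}$ with $p,q>0$ coprime; it is of type B if it consists of the vertices and the unique interior lattice point of a tetrahedron with no other lattice points, equivalent to $\{(0,0,0),(1,0,0),(0,1,0),a,b\}$ with $(a,b)$ (a interior) one of $((1,1,1),(3,3,4))$, $((1,1,2),(2,2,5))$, $((1,2,3),(2,4,7))$, $((1,3,5),(2,6,11))$, $((1,3,5),(2,7,13))$, $((1,4,7),(2,9,17))$, $((1,5,7),(2,13,19))$, $((1,2,5),(3,7,20))$. Enhancements. $A(S,\overline p)\subset\mathbb CP^{N+1}$ is the (finite) set of points $\overline\alpha=(\alpha_\omega)_{\omega\in\Delta\cap\mathbb Z^3}$, $\alpha_\omega\in\mathbb C^*$, for which there is a polynomial $\varphi(\mathbf z)=\sum_{\omega}(\alpha_\omega+O(t^{>0}))t^{\nu_S(\omega)}\mathbf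 z^\omega\in\mathbb K[\mathbf z]$ defining a surface through $\overline p$ and such that $\sum_{\omega\in C_S}\alpha_\omega Z^\omega$ has a singularity in $(\mathbb C^* )^3$. A surface matches the enhancement $\overline\alpha$ if it is defined by a polynomial $\sum_{\omega}(\alpha_\omega+O(t^{>0}))t^{\nu_S(\omega)}\mathbf z^\omega$. *)

(* Defs.v *)
From HB Require Import structures.
From mathcomp Require Import all_boot all_order all_algebra finmap.
From mathcomp Require Import all_classical all_reals all_analysis.
From mathcomp Require Import complex ring.
From mathcomp Require Import (canonicals, coercions) mpoly.

Set Implicit Arguments.
Unset Strict Implicit.
Unset Printing Implicit Defensive.
Import Order.TTheory GRing.Theory Num.Theory.
Import numFieldNormedType.Exports.
Import ComplexField.Normc.
Local Open Scope classical_set_scope.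
Local Open Scope ring_scope.

Definition exponent (m k n : nat) : rat := (n%:R - k%:R) / m%:R.

Section PowerSeries.
Variable R : realType.
Local Notation C := R[i].
Implicit Types u v w : nat -> C.

(* sum_n u_n s^n converges in a neighbourhood of 0, stated as absolute
   convergence at some positive radius *)
Definition positive_radius u :=
  exists2 rho : R, 0 < rho & cvgn (series (fun n => normc (u n) * rho ^+ n)).

Definition geo u := exists2 B : R, 1 <= B & forall n, normc (u n) <= B ^+ n.+1.

Lemma normc_ge0 (x : C) : 0 <= normc x.
Proof. by case: x => a b; rewrite /normc sqrtr_ge0. Qed.

Lemma positive_radiusP u : positive_radius u <-> geo u.
Proof.
split=> [[rho rho0 cu]|[B B1 uB]].
- have [A A0 bA] : exists2 A : R, 0 <= A & forall n, normc (u n) * rho ^+ n <= A.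
    have /cvg_series_cvg_0/cvgP/cvg_seq_bounded[M [_ /(_ (M + 1))]] := cu.
    rewrite ltrDl ltr01 => /(_ isT) bM; exists `|M + 1| => // n.
    exact: le_trans (ler_norm _) (le_trans (bM n I) (ler_norm _)).
  have r0 : 0 <= rho^-1 by rewrite invr_ge0 ltW.
  exists (1 + A + rho^-1) => [|n]; first by rewrite -addrA lerDl addr_ge0.
  have := bA n; rewrite -ler_pdivlMr ?exprn_gt0// => /le_trans; apply.
  rewrite exprS -exprVn; apply: ler_pM; rewrite ?exprn_ge0//.
    by rewrite addrAC lerDr addr_ge0.
  by apply: lerXn2r; rewrite ?nnegrE ?lerDr ?addr_ge0.
- have B0 : 0 < B by rewrite (lt_le_trans _ B1).
  exists (2 * B)^-1; first by rewrite invr_gt0 mulr_gt0.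
  apply: (@series_le_cvg _ _ (geometric B 2^-1)).
  + by move=> n; rewrite mulr_ge0 ?normc_ge0 ?exprn_ge0// invr_ge0 mulr_ge0// ltW.
  + by move=> n /=; rewrite mulr_ge0 ?exprn_ge0// ltW.
  + move=> n /=; rewrite invfM exprMn mulrCA [leRHS]mulrC ler_wpM2l//.
    by rewrite exprVn ler_pdivrMr ?exprn_gt0// -exprS.
  + by apply: is_cvg_geometric_series; rewrite ger0_norm// invf_lt1// ltr1n.
Qed.

Lemma normc_triangle (x y : C) : normc (x + y) <= normc x + normc y.
Proof. exact: (@le_normcD R). Qed.

Lemma normc_opp (x : C) : normc (- x) = normc x.
Proof. exact: (@normcN R). Qed.

Definition cauchy_prod u v n := \sum_(i < n.+1) u i * v (n - i)%N.

Lemma cauchy_prodE N u v n : (n < N)%N ->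
  cauchy_prod u v n = (\poly_(i < N) u i * \poly_(i < N) v i)`_n.
Proof.
move=> nN; rewrite coefM; apply: eq_bigr => i _; rewrite !coef_poly.
by rewrite (leq_ltn_trans (leq_ord i) nN) (leq_ltn_trans (leq_subr _ _) nN).
Qed.

Lemma cauchy_prodC u v : cauchy_prod u v =1 cauchy_prod v u.
Proof. by move=> n; rewrite !(@cauchy_prodE n.+1)// mulrC. Qed.

Lemma cauchy_prodA u v w : cauchy_prod u (cauchy_prod v w) =1 cauchy_prod (cauchy_prod u v) w.
Proof.
move=> n; have pE x y : \poly_(i < n.+1) cauchy_prod x y i =
    \poly_(i < n.+1) (\poly_(i < n.+1) x i * \poly_(i < n.+1) y i)`_i.
  by apply/polyP => j; rewrite !coef_poly; case: ifP => // /cauchy_prodE ->.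
have trunc (p q r : {poly C}) : (p * q * r)`_n = (\poly_(i < n.+1) (p * q)`_i * r)`_n.
  by rewrite !coefM; apply: eq_bigr => i _; rewrite coef_poly ltn_ord.
by rewrite !(@cauchy_prodE n.+1)// !pE -trunc -mulrA mulrC -trunc mulrC.
Qed.

Lemma geoS u B : 1 <= B -> (forall n, normc (u n) <= B ^+ n.+1) ->
  forall D, B <= D -> forall n, normc (u n) <= D ^+ n.+1.
Proof.
move=> B1 uB D BD n; apply: le_trans (uB n) _.
have B0 : 0 <= B by exact: le_trans B1.
by apply: lerXn2r; rewrite ?nnegrE//; exact: le_trans BD.
Qed.

Lemma geoD u v : geo u -> geo v -> geo (fun n => u n + v n).
Proof.
move=> [B B1 uB] [D D1 vD]; have B0 := le_trans ler01 B1.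
have D0 := le_trans ler01 D1.
exists (B + D) => [|n]; first by rewrite (le_trans B1)// lerDl.
apply: le_trans (normc_triangle _ _) _.
apply: le_trans (lerD (uB n) (vD n)) _.
elim: n => [|n ih]; first by rewrite !expr1.
rewrite [leRHS]exprS mulrDl exprS [D ^+ _]exprS.
by apply: lerD; apply: ler_wpM2l => //; apply: lerXn2r;
  rewrite ?nnegrE ?addr_ge0// ?lerDl ?lerDr.
Qed.

Lemma geoN u : geo u -> geo (fun n => - u n).
Proof. by move=> [B B1 uB]; exists B => // n; rewrite normc_opp. Qed.

Lemma normc_sum n (F : 'I_n -> C) :
  normc (\sum_(i < n) F i) <= \sum_(i < n) normc (F i).
Proof.
elim: n F => [|n ih] F; first by rewrite !big_ord0 normc0.
rewrite !big_ord_recr/=; apply: le_trans (normc_triangle _ _) _.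
by rewrite lerD2r.
Qed.

Lemma geoM u v : geo u -> geo v -> geo (cauchy_prod u v).
Proof.
move=> [B B1 uB] [D D1 vD].
have [E E1 [uE vE]] : exists2 E, 1 <= E & (forall n, normc (u n) <= E ^+ n.+1) /\
    (forall n, normc (v n) <= E ^+ n.+1).
  exists (Num.max B D); first by rewrite le_max B1.
  by split; [apply: (geoS B1 uB)|apply: (geoS D1 vD)]; rewrite le_max lexx ?orbT.
have E0 := le_trans ler01 E1.
have E2 : 1 <= E ^+ 2 by exact: exprn_ege1.
exists (2 * E ^+ 2) => [|n]; first by rewrite (le_trans E2)// ler_peMl ?ler1n// exprn_ge0.
rewrite /cauchy_prod; apply: le_trans (normc_sum _) _.
apply: (@le_trans _ _ (\sum_(i < n.+1) E ^+ n.+2)).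
  apply: ler_sum => i _; rewrite normcM.
  have -> : n.+2 = (i.+1 + (n - i).+1)%N by rewrite addSn addnS subnKC// -ltnS.
  by rewrite exprD ler_pM ?normc_ge0.
rewrite sumr_const card_ord -[leLHS]mulr_natl exprMn; apply: ler_pM; rewrite ?exprn_ge0//.
- by rewrite -natrX ler_nat ltnW// ltn_expl.
- by rewrite -exprM; apply: ler_weXn2l => //; rewrite mul2n -addnn addSn addnS !ltnS leq_addr.
Qed.

Fixpoint psinv_seq u n : seq C := if n isn't n'.+1 then [::] else
  let s := psinv_seq u n' in
  rcons s (if n' is 0 then (u 0%N)^-1 else
           - (u 0%N)^-1 * \sum_(i < n') u i.+1 * s`_(n' - i.+1)).
Definition psinv u n := (psinv_seq u n.+1)`_n.

Lemma size_psinv u n : size (psinv_seq u n) = n.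
Proof. by elim: n => //= n ih; rewrite size_rcons ih. Qed.

Lemma nth_psinv u n i : (i < n)%N -> (psinv_seq u n)`_i = psinv u i.
Proof.
elim: n => // n ih; rewrite ltnS leq_eqVlt => /predU1P[->//|lin].
by rewrite -ih//= nth_rcons size_psinv lin.
Qed.

Lemma psinv0 u : psinv u 0 = (u 0%N)^-1. Proof. by []. Qed.

Lemma psinvS u n :
  psinv u n.+1 = - (u 0%N)^-1 * \sum_(i < n.+1) u i.+1 * psinv u (n - i)%N.
Proof.
rewrite {1}/psinv [psinv_seq u n.+2]/= -/(psinv_seq u n.+1) nth_rcons size_psinv ltnn eqxx.
congr (_ * _); apply: eq_bigr => i _; congr (_ * _).
by rewrite subSS nth_psinv// ltnS leq_subr.
Qed.

Lemma cauchy_prodV u : u 0%N != 0 -> cauchy_prod u (psinv u) =1 (fun n => (n == 0%N)%:R).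
Proof.
move=> u0 [|n]; first by rewrite /cauchy_prod big_ord_recl big_ord0 addr0 psinv0 mulfV.
rewrite /cauchy_prod big_ord_recl subn0 psinvS mulrA mulrN mulfV// mulN1r.
by under [X in _ + X]eq_bigr do rewrite lift0 subSS; rewrite addNr.
Qed.

Lemma geoV u : geo u -> geo (psinv u).
Proof.
move=> [B0 B01 uB0].
have [B B1 [uB iB]] : exists2 B, 1 <= B & (forall n, normc (u n) <= B ^+ n.+1) /\
    normc (u 0%N)^-1 <= B.
  exists (Num.max B0 (normc (u 0%N)^-1)); first by rewrite le_max B01.
  by split; [apply: (geoS B01 uB0)|]; rewrite le_max lexx ?orbT.
have B0' := le_trans ler01 B1.
pose T n := \sum_(i < n.+1) B ^+ (i.+2) * normc (psinv u (n - i)%N).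
have T0 n : 0 <= T n.
  by rewrite sumr_ge0// => i _; rewrite mulr_ge0 ?normc_ge0 ?exprn_ge0.
have vT n : normc (psinv u n.+1) <= B * T n.
  rewrite psinvS normcM normc_opp ler_pM ?normc_ge0//.
  apply: le_trans (normc_sum _) _; apply: ler_sum => i _.
  by rewrite normcM ler_wpM2r ?normc_ge0.
pose E := B ^+ 2 * B + B.
have E1 : 1 <= E by rewrite (le_trans B1)// lerDr mulr_ge0// exprn_ge0.
have E0 := le_trans ler01 E1.
have TE n : T n <= E ^+ n.+1.
  elim: n => [|n ih].
    rewrite /T big_ord_recl big_ord0 addr0 psinv0 expr1 /E -[leLHS]addr0.
    by rewrite lerD// ler_wpM2l// exprn_ge0.
  rewrite /T big_ord_recl subn0.
  under eq_bigr do rewrite lift0 subSS exprS -mulrA.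
  rewrite -mulr_sumr -/(T n) [leRHS]exprS /E mulrDl; apply: lerD.
    by rewrite -mulrA ler_wpM2l ?exprn_ge0// (le_trans (vT n))// ler_wpM2l.
  by rewrite ler_wpM2l.
exists (B * E) => [|[|n]].
- by rewrite (le_trans E1)// ler_peMl.
- by rewrite psinv0 expr1 (le_trans iB)// ler_peMr.
- rewrite (le_trans (vT n))// exprMn ler_pM//.
    by rewrite -[leLHS]expr1 ler_weXn2l.
  by rewrite (le_trans (TE n))// ler_weXn2l.
Qed.

End PowerSeries.

Section Puiseux.
Variable R : realType.
Local Notation C := R[i].
Implicit Types (a b c : rat -> C) (m k n : nat).

(* a r is the coefficient of t^r; the series is
   t^(-k/m) * \sum_n a ((n - k) / m) * (t^(1/m))^n *)
Definition convergent_puiseux a := exists m k,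
  [/\ (0 < m)%N,
      forall r, a r != 0 -> exists n, r = exponent m k n &
      positive_radius (fun n => a (exponent m k n))].

Definition puiseux_shape m k a := [/\ (0 < m)%N,
  forall r, a r != 0 -> exists n, r = exponent m k n &
  geo (fun n => a (exponent m k n))].

Lemma convergent_puiseuxP a : convergent_puiseux a <-> exists m k, puiseux_shape m k a.
Proof.
by split=> -[m [k [m0 sa /positive_radiusP ga]]]; exists m, k; split.
Qed.

Lemma exponent_inj m k : (0 < m)%N -> injective (exponent m k).
Proof.
move=> m0 i j eij; have mn0 : m%:R != 0 :> rat by rewrite pnatr_eq0 -lt0n.
by have /addIr/eqP := divIf mn0 eij; rewrite eqr_nat => /eqP.
Qed.

Lemma good_widen m k l j a : (0 < l)%N -> puiseux_shape m k a -> puiseux_shape (m * l) (k * l + j) a.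
Proof.
move=> l0 [m0 sa [B B1 aB]].
have mn0 : m%:R != 0 :> rat by rewrite pnatr_eq0 -lt0n.
have ln0 : l%:R != 0 :> rat by rewrite pnatr_eq0 -lt0n.
have eE i : exponent m k i = exponent (m * l) (k * l + j) (i * l + j).
  rewrite /exponent !natrD !natrM opprD addrACA subrr addr0 -mulrBl.
  by rewrite -mulf_div mulfV// mulr1.
split; first by rewrite muln_gt0 m0.
  by move=> r /sa[n ->]; exists (n * l + j)%N.
exists B => // n; have [->|anz] := eqVneq (a (exponent (m * l) (k * l + j) n)) 0.
  by rewrite normc0 exprn_ge0// (le_trans ler01).
have [i ei] := sa _ anz; rewrite ei (le_trans (aB i))// ler_weXn2l// ltnS.
move: ei; rewrite eE => /exponent_inj -> //; last by rewrite muln_gt0 m0.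
by rewrite (leq_trans _ (leq_addr _ _))// leq_pmulr.
Qed.

Lemma common2 a b : convergent_puiseux a -> convergent_puiseux b ->
  exists m k, puiseux_shape m k a /\ puiseux_shape m k b.
Proof.
move=> /convergent_puiseuxP[m [k ga]] /convergent_puiseuxP[m' [k' gb]].
have [[m0 _ _] [m0' _ _]] := (ga, gb).
exists (m * m')%N, (k * m' + k' * m)%N; split; first exact: good_widen.
by rewrite mulnC addnC; exact: good_widen.
Qed.

Lemma common3 a b c : convergent_puiseux a -> convergent_puiseux b ->
  convergent_puiseux c -> exists m k, [/\ puiseux_shape m k a, puiseux_shape m k b & puiseux_shape m k c].
Proof.
move=> pa pb /convergent_puiseuxP[m' [k' gc]].
have [m [k [ga gb]]] := common2 pa pb.
have [[m0 _ _] [m0' _ _]] := (ga, gc).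
exists (m * m')%N, (k * m' + k' * m)%N; split; try exact: good_widen.
by rewrite mulnC addnC; exact: good_widen.
Qed.

Lemma good_eq m k a b : puiseux_shape m k a -> puiseux_shape m k b ->
  (forall n, a (exponent m k n) = b (exponent m k n)) -> a = b.
Proof.
move=> [_ sa _] [_ sb _] ab; apply/funext => r.
have [ar0|/sa[n ->]//] := eqVneq (a r) 0.
by have [br0|/sb[n ->]//] := eqVneq (b r) 0; rewrite ar0.
Qed.

Definition puiseux_conv a b r := \sum_(s \in [set: rat]) a s * b (r - s).

Lemma exponent_split m k k' i n : (i <= n)%N ->
  exponent m (k + k') n - exponent m k i = exponent m k' (n - i).
Proof.
move=> lin; rewrite /exponent -mulrBl natrD natrB//; congr (_ / _).
by ring.
Qed.

Lemma exponentD m k k' i j : exponent m k i + exponent m k' j = exponent m (k + k') (i + j).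
Proof. by rewrite /exponent -mulrDl !natrD opprD addrACA. Qed.

Lemma exponent_shift m k j n : exponent m (k + j) (n + j) = exponent m k n.
Proof. by rewrite /exponent !natrD; congr (_ / _); ring. Qed.

Lemma convE m k k' a b n : puiseux_shape m k a -> puiseux_shape m k' b ->
  puiseux_conv a b (exponent m (k + k') n) =
  cauchy_prod (fun i => a (exponent m k i)) (fun i => b (exponent m k' i)) n.
Proof.
move=> [m0 sa _] [_ sb _]; rewrite /puiseux_conv.
rewrite (@fsbigE _ _ _ _ _ [seq exponent m k i | i <- iota 0 n.+1]).
- rewrite (eq_bigl xpredT) => [|i]; last by rewrite in_setT.
  rewrite big_map -[iota 0 n.+1]/(index_iota 0 n.+1) big_mkord.
  by apply: eq_bigr => i _; rewrite exponent_split// -ltnS.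
- by rewrite map_inj_uniq ?iota_uniq//; exact: exponent_inj.
- by [].
- move=> s _ /negP sn.
  have [->|/sa[i si]] := eqVneq (a s) 0; first by rewrite mul0r.
  have [->|/sb[j sj]] := eqVneq (b (exponent m (k + k') n - s)) 0; first by rewrite mulr0.
  exfalso; apply: sn; apply/mapP; exists i => //; rewrite mem_iota/= add0n ltnS.
  have /exponent_inj -> // : exponent m (k + k') n = exponent m (k + k') (i + j).
    by rewrite -exponentD -si -sj addrC subrK.
  by rewrite leq_addr.
Qed.

Lemma good_conv m k k' a b : puiseux_shape m k a -> puiseux_shape m k' b -> puiseux_shape m (k + k') (puiseux_conv a b).
Proof.
move=> ga gb; have [[m0 sa ua] [_ sb ub]] := (ga, gb); split=> // [r|].
  move=> /eqP ab0; apply: contrapT => nr; apply: ab0; apply: fsbig1 => s _.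
  have [->|/sa[i si]] := eqVneq (a s) 0; first by rewrite mul0r.
  have [->|/sb[j sj]] := eqVneq (b (r - s)) 0; first by rewrite mulr0.
  exfalso; apply: nr; exists (i + j)%N.
  by rewrite -exponentD -si -sj addrC subrK.
have [B B1 uB] := geoM ua ub; exists B => // n.
by rewrite (convE _ ga gb).
Qed.

Record puiseux := Puiseux {
  coef :> rat -> C ;
  coefP : convergent_puiseux coef }.

Lemma puiseux_eq (x y : puiseux) : coef x = coef y -> x = y.
Proof. by case: x y => [a pa] [b pb] /= ab; subst b; congr Puiseux; exact: Prop_irrelevance. Qed.

HB.instance Definition _ := gen_eqMixin puiseux.
HB.instance Definition _ := gen_choiceMixin puiseux.

Lemma good_const (z : C) : puiseux_shape 1 0 (fun r => if r == 0 then z else 0).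
Proof.
split=> // [r|].
  by case: (r =P 0) => [-> _|_ /eqP//]; exists 0%N; rewrite /exponent subrr mul0r.
exists (1 + normc z) => [|n]; first by rewrite lerDl normc_ge0.
have z1 : 1 <= 1 + normc z by rewrite lerDl normc_ge0.
case: ifP => _; last by rewrite normc0 exprn_ge0// (le_trans ler01).
by rewrite exprS (@le_trans _ _ (1 + normc z))// ?lerDr// ler_peMr ?(le_trans ler01)// exprn_ege1.
Qed.

Lemma const_subproof (z : C) : convergent_puiseux (fun r => if r == 0 then z else 0).
Proof. by apply/convergent_puiseuxP; exists 1%N, 0%N; exact: good_const. Qed.

Lemma add_subproof (x y : puiseux) : convergent_puiseux (fun r => x r + y r).
Proof.
have [m [k [[m0 sx gx] [_ sy gy]]]] := common2 (coefP x) (coefP y).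
apply/convergent_puiseuxP; exists m, k; split => // [r|]; last exact: geoD.
by have [->|/sx//] := eqVneq (x r) 0; rewrite add0r => /sy.
Qed.

Lemma opp_subproof (x : puiseux) : convergent_puiseux (fun r => - x r).
Proof.
have /convergent_puiseuxP[m [k [m0 sx gx]]] := coefP x.
apply/convergent_puiseuxP; exists m, k; split => // [r|]; last exact: geoN.
by rewrite oppr_eq0 => /sx.
Qed.

Lemma mul_subproof (x y : puiseux) : convergent_puiseux (puiseux_conv x y).
Proof.
have [m [k [gx gy]]] := common2 (coefP x) (coefP y).
by apply/convergent_puiseuxP; exists m, (k + k)%N; exact: good_conv.
Qed.

Definition puiseux_const z := Puiseux (const_subproof z).
Definition puiseux_add x y := Puiseux (add_subproof x y).
Definition puiseux_opp x := Puiseux (opp_subproof x).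
Definition puiseux_mul x y := Puiseux (mul_subproof x y).

Lemma puiseux_addA : associative puiseux_add.
Proof. by move=> x y z; apply/puiseux_eq/funext => r /=; rewrite addrA. Qed.

Lemma puiseux_addC : commutative puiseux_add.
Proof. by move=> x y; apply/puiseux_eq/funext => r /=; rewrite addrC. Qed.

Lemma puiseux_add0 : left_id (puiseux_const 0) puiseux_add.
Proof. by move=> x; apply/puiseux_eq/funext => r /=; rewrite if_same add0r. Qed.

Lemma puiseux_addN : left_inverse (puiseux_const 0) puiseux_opp puiseux_add.
Proof. by move=> x; apply/puiseux_eq/funext => r /=; rewrite if_same addNr. Qed.

HB.instance Definition _ := GRing.isZmodule.Build puiseux
  puiseux_addA puiseux_addC puiseux_add0 puiseux_addN.

Lemma puiseux_mulC : commutative puiseux_mul.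
Proof.
move=> x y; apply/puiseux_eq.
have [m [k [gx gy]]] := common2 (coefP x) (coefP y).
apply: (@good_eq m (k + k)); try exact: good_conv.
by move=> n /=; rewrite (convE _ gx gy) (convE _ gy gx) cauchy_prodC.
Qed.

Lemma puiseux_mulA : associative puiseux_mul.
Proof.
move=> x y z; apply/puiseux_eq.
have [m [k [gx gy gz]]] := common3 (coefP x) (coefP y) (coefP z).
have gyz := good_conv gy gz; have gxy := good_conv gx gy.
apply: (@good_eq m (k + (k + k))) => [||n /=].
- exact: good_conv gx gyz.
- by rewrite addnA; exact: good_conv gxy gz.
rewrite (convE _ gx gyz) addnA (convE _ gxy gz).
rewrite (funext (fun i => convE i gy gz)) (funext (fun i => convE i gx gy)).
exact: cauchy_prodA.
Qed.

Lemma puiseux_mul1 : left_id (puiseux_const 1) puiseux_mul.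
Proof.
move=> x; apply/puiseux_eq/funext => r /=; rewrite /puiseux_conv.
rewrite (@fsbigE _ _ _ _ _ [:: 0])//= => [|s _].
  by rewrite big_cons big_nil in_setT eqxx mul1r subr0 addr0.
by rewrite inE => /negbTE ->; rewrite mul0r.
Qed.

Lemma puiseux_mulD : left_distributive puiseux_mul puiseux_add.
Proof.
move=> x y z; apply/puiseux_eq.
have [m [k [gx gy gz]]] := common3 (coefP x) (coefP y) (coefP z).
have gxy : puiseux_shape m k (puiseux_add x y).
  have [[m0 sx ux] [_ sy uy]] := (gx, gy); split=> //; last exact: geoD.
  by move=> r /=; have [->|/sx//] := eqVneq (x r) 0; rewrite add0r => /sy.
have gxz := good_conv gx gz; have gyz := good_conv gy gz.
apply: (@good_eq m (k + k)) => [||n]; first exact: good_conv.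
  have [[m0 sx ux] [_ sy uy]] := (gxz, gyz); split=> //; last exact: geoD.
  by move=> r /=; have [->|/sx//] := eqVneq (puiseux_conv x z r) 0; rewrite add0r => /sy.
rewrite /= (convE _ gxy gz) (convE _ gx gz) (convE _ gy gz) /cauchy_prod -big_split/=.
by apply: eq_bigr => i _; rewrite mulrDl.
Qed.

Lemma puiseux_1neq0 : puiseux_const 1 != 0.
Proof.
by apply/eqP => /(congr1 (fun x : puiseux => x 0)) /= /eqP; rewrite ?eqxx oner_eq0.
Qed.

HB.instance Definition _ := GRing.Zmodule_isComNzRing.Build puiseux
  puiseux_mulA puiseux_mulC puiseux_mul1 puiseux_mulD puiseux_1neq0.

Lemma puiseux_inverse_exists (x : puiseux) : x != 0 -> exists y : puiseux, y * x = 1.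
Proof.
move=> x0; have /convergent_puiseuxP[m [k [m0 sx [B B1 xB]]]] := coefP x.
have [n0 xn0 xlt] : exists2 n, x (exponent m k n) != 0 &
    forall i, (i < n)%N -> x (exponent m k i) = 0.
  have ex : exists n, x (exponent m k n) != 0.
    apply: contrapT => nx; move/eqP: x0; apply; apply/puiseux_eq/funext => r.
    rewrite [RHS]/= if_same; have [//|xr] := eqVneq (x r) 0.
    by have [n rn] := sx _ xr; exfalso; apply: nx; exists n; rewrite -rn.
  exists (ex_minn ex); first by case: ex_minnP.
  by case: ex_minnP => n _ nmin i ltin; apply/eqP; apply: contraTT ltin; rewrite -leqNgt => /nmin.
pose c := exponent m k n0; pose a r := x (r + c).
have ac n : exponent m 0 n + c = exponent m k (n + n0) by rewrite exponentD.
have ga : puiseux_shape m 0 a.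
  split=> // [r|].
    move=> ar; have [n rn] := sx _ ar.
    have n0n : (n0 <= n)%N by rewrite leqNgt; apply: contra ar => /xlt; rewrite /a rn => ->.
    by exists (n - n0)%N; apply: (addIr c); rewrite ac subnK.
  exists (B ^+ n0.+1) => [|n]; first exact: exprn_ege1.
  rewrite /a ac (le_trans (xB _))// -exprM ler_weXn2l//.
  by rewrite mulSn addSn ltnS leq_add2l leq_pmulr.
have u0 : a (exponent m 0 0) != 0 by rewrite /a ac.
pose v := psinv (fun n => a (exponent m 0 n)).
have gv : geo v by apply: geoV; case: ga.
pose b r := if pselect (exists n, r = exponent m 0 n) is left e then v (projT1 (cid e)) else 0.
have bE n : b (exponent m 0 n) = v n.
  rewrite /b; case: pselect => [e|[]]; last by exists n.
  by case: cid => /= j /exponent_inj ->.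
have gb : puiseux_shape m 0 b.
  split=> // [r|]; first by rewrite /b; case: pselect => // _ /eqP.
  by have [D D1 vD] := gv; exists D => // n; rewrite bE.
have b'P : convergent_puiseux (fun r => b (r + c)).
  have [_ sb _] := gb; have [D D1 vD] := gv.
  apply/convergent_puiseuxP; exists m, n0; split=> // [r /sb[n rn]|].
    exists (n + k)%N; apply: (addIr c).
    by rewrite rn exponentD -addnA [(n0 + k)%N]addnC -[(k + n0)%N]add0n exponent_shift.
  exists D => // j; rewrite exponentD.
  have [->|bnz] := eqVneq (b (exponent m (n0 + k) (j + n0))) 0.
    by rewrite normc0 exprn_ge0// (le_trans ler01).
  have [i bi] := sb _ bnz; rewrite bi bE (le_trans (vD i))// ler_weXn2l// ltnS.
  have : exponent m (n0 + k) (j + n0) = exponent m (n0 + k) (i + (n0 + k)).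
    by rewrite bi -[in RHS](add0n (n0 + k)%N) exponent_shift.
  by rewrite [(j + n0)%N]addnC [(i + _)%N]addnCA => /(exponent_inj m0)/eqP; rewrite eqn_add2l => /eqP ->; rewrite leq_addr.
exists (Puiseux b'P); rewrite mulrC; apply/puiseux_eq.
have -> : coef (x * Puiseux b'P) = puiseux_conv a b.
  apply/funext => r; rewrite /= /puiseux_conv (reindex_fsbigT (fun s => s + c))/=; last first.
    by exists (fun s => s - c) => s; rewrite ?addrK ?subrK.
  by apply: eq_fsbigr => s _; rewrite /a opprD addrA subrK.
apply: (@good_eq m 0) => [||n].
- exact: good_conv ga gb.
- by have := @good_widen 1 0 m 0 _ m0 (good_const 1); rewrite mul1n mul0n.
rewrite -[0%N]/(0 + 0)%N (convE _ ga gb).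
rewrite (_ : (fun i => b (exponent m 0 i)) = v); last exact/funext.
rewrite cauchy_prodV//= /exponent subr0 mulf_eq0 invr_eq0 !pnatr_eq0 (gtn_eqF m0) orbF.
by case: eqP.
Qed.

Definition puiseux_inv (x : puiseux) : puiseux := xget 0 [set y | y * x = 1].

Lemma puiseux_mulV (x : puiseux) : x != 0 -> puiseux_inv x * x = 1.
Proof. by move=> /puiseux_inverse_exists ex; rewrite /puiseux_inv; exact: (xgetPex 0 ex). Qed.

Lemma puiseux_inv0 : puiseux_inv 0 = 0.
Proof.
rewrite /puiseux_inv xgetPN// => y /=; rewrite mulr0 => /esym/eqP.
by rewrite oner_eq0.
Qed.

HB.instance Definition _ := GRing.ComNzRing_isField.Build puiseux
  puiseux_mulV puiseux_inv0.

End Puiseux.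

Section Valuation.
Variable R : realType.

(* A nonzero Puiseux series has a least exponent, so the supremum is attained;
   the value of 0 is -oo. *)
Definition puiseux_val (a : puiseux R) : \bar R :=
  ereal_sup [set (- ratr r)%:E | r in [set r | a r != 0]].

(* a = (alpha + O(t^{>0})) t^e *)
Definition leading_term (a : puiseux R) (alpha : R[i]) (e : \bar R) :=
  exists r : rat, [/\ e = (ratr r)%:E, a r = alpha & forall s, s < r -> a s = 0].

End Valuation.

Section Laurent.
Variable F : fieldType.
Implicit Types (A : {fset 'rV[int]_3}) (f : 'rV[int]_3 -> F) (z : 'rV[F]_3).

Definition monomial z (w : 'rV[int]_3) : F := \prod_(j < 3) z 0 j ^ w 0 j.

Definition laurent_eval A f z : F := \sum_(w <- A) f w * monomial z w.

(* value at z of the partial derivative with respect to the j-th variable *)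
Definition laurent_deriv A f (j : 'I_3) z : F :=
  \sum_(w <- A) f w * (w 0 j)%:~R * monomial z (w - delta_mx 0 j).

Definition singular_at A f z :=
  [/\ forall j, z 0 j != 0, laurent_eval A f z = 0 &
      forall j, laurent_deriv A f j z = 0].

End Laurent.

Section Hypersurface.
Variables (F : fieldType) (m : nat).
Implicit Types X : set ('I_m -> F).

Definition zariski_closure X : set ('I_m -> F) :=
  [set c | forall G : mpoly.mpoly m F,
    (forall x, X x -> mpoly.meval x G = 0) -> mpoly.meval c G = 0].

Definition zero_locus (G : mpoly.mpoly m F) : set ('I_m -> F) :=
  [set c | mpoly.meval c G = 0].

(* msize is the total degree plus one: D is not constant *)
Definition closure_is_hypersurface X :=
  exists2 D : mpoly.mpoly m F, (1 < mpoly.msize D)%N &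
    zariski_closure X = zero_locus D.

End Hypersurface.

(* P holds on a nonempty Zariski open set of configurations of N points. For
   F = K the configurations with a prescribed rational valuation are Zariski
   dense, hence meet this open set. *)
Definition generically (F : fieldType) (N : nat) (P : 'M[F]_(N, 3) -> Prop) :=
  exists2 G : mpoly.mpoly (N * 3) F, G != 0 &
    forall p, mpoly.meval (fun k => mxvec p 0 k) G != 0 -> P p.

Section Polytopes.
Variable R : realType.
Implicit Types (B C V : {fset 'rV[int]_3}) (w : 'rV[int]_3) (X y : 'rV[R]_3).

Definition real_point w : 'rV[R]_3 := map_mx intr w.

Definition dot X y : R := \sum_(j < 3) X 0 j * y 0 j.

Definition conv_hull V : set 'rV[R]_3 :=
  [set y | exists l : 'rV[int]_3 -> R,
    [/\ forall w, 0 <= l w, \sum_(w <- V) l w = 1 &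
        y = \sum_(w <- V) l w *: real_point w]].

Definition lattice_polytope (Delta : set 'rV[R]_3) :=
  exists V, Delta = conv_hull V.

Definition lattice_points (Delta : set 'rV[R]_3) : {fset 'rV[int]_3} :=
  fset_set [set w | Delta (real_point w)].

Definition differences_generate B := forall H : set 'rV[int]_3,
  H 0 -> (forall a b, H a -> H b -> H (a - b)) ->
  (forall a b, a \in B -> b \in B -> H (a - b)) -> H = setT.

Definition affinely_dependent B := exists l : 'rV[int]_3 -> R,
  [/\ exists2 w, w \in B & l w != 0, \sum_(w <- B) l w = 0 &
      \sum_(w <- B) l w *: real_point w = 0].

Definition circuit C := affinely_dependent C /\
  forall B, (B `<` C)%fset -> ~ affinely_dependent B.

Definition Zaffine_equivalent B C := exists (U : 'M[int]_3) (b : 'rV[int]_3),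
  U \in unitmx /\ C = [fset (w *m U + b)%R | w in B]%fset.

Definition point3 (x y z : int) : 'rV[int]_3 := \row_(j < 3) nth 0 [:: x; y; z] j.

Definition circuit_typeA C :=
  [/\ forall w, w \in C -> ~ conv_hull (C `\ w)%fset (real_point w),
      lattice_points (conv_hull C) = C &
      exists p q : nat, [/\ (0 < p)%N, (0 < q)%N, coprime p q &
        Zaffine_equivalent C
          [fset point3 0 0 0; point3 1 0 0; point3 0 1 0; point3 0 0 1;
                point3 1 p%:Z q%:Z]%fset]].

Definition typeB_model (a b : 'rV[int]_3) : {fset 'rV[int]_3} :=
  [fset point3 0 0 0; point3 1 0 0; point3 0 1 0; a; b]%fset.

Definition typeB_models : seq {fset 'rV[int]_3} :=
  [:: typeB_model (point3 1 1 1) (point3 3 3 4);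
      typeB_model (point3 1 1 2) (point3 2 2 5);
      typeB_model (point3 1 2 3) (point3 2 4 7);
      typeB_model (point3 1 3 5) (point3 2 6 11);
      typeB_model (point3 1 3 5) (point3 2 7 13);
      typeB_model (point3 1 4 7) (point3 2 9 17);
      typeB_model (point3 1 5 7) (point3 2 13 19);
      typeB_model (point3 1 2 5) (point3 3 7 20)].

Definition circuit_typeB C :=
  [/\ exists a, [/\ a \in C, #|` (C `\ a)%fset| = 4,
        ~ affinely_dependent (C `\ a)%fset &
        interior (conv_hull (C `\ a)%fset) (real_point a)],
      lattice_points (conv_hull C) = C &
      exists2 D, D \in typeB_models & Zaffine_equivalent C D].

(* v is neither parallel nor orthogonal to a proper affine subspace spanned by
   lattice points of Delta; L is the direction of that subspace, which is at
   least a line: every v is orthogonal to a point. *)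
Definition general_direction (Delta : set 'rV[R]_3) (v : 'rV[rat]_3) :=
  forall B : seq 'rV[int]_3, {subset B <= lattice_points Delta} ->
  let L := <<[seq real_point (a - b) | a <- B, b <- B]>>%VS in
  let vR : 'rV[R]_3 := map_mx ratr v in
  (0 < \dim L < 3)%N -> vR \notin L /\ exists2 l, l \in L & dot vR l != 0.

End Polytopes.

Section Surfaces.
Variables (R : realType) (Delta : set 'rV[R]_3).
Local Notation K := (puiseux R).
Local Notation A := (lattice_points Delta).
Local Notation poly3 := ('rV[int]_3 -> K).
Implicit Types (f g : poly3) (s : set poly3) (S : 'rV[int]_3 -> R)
  (X y : 'rV[R]_3) (C : {fset 'rV[int]_3}) (alpha : 'rV[int]_3 -> R[i]).

(* N = |Delta cap Z^3| - 2; under the hypothesis 0 < N the subtraction is exact *)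
Definition num_points : nat := (#|` A| - 2)%N.

Definition supported f := forall w, w \notin A -> f w = 0.

(* A surface is an element of the linear system P(K^(Delta cap Z^3)), that is,
   the class of its defining polynomials up to nonzero scalars. *)
Definition surface f : set poly3 :=
  [set g | exists2 l : K, l != 0 & g = (fun w => l * f w)].

(* Nonzero scalars in K act on these polynomials; the zero polynomial, which
   defines no surface, is excluded. *)
Definition singular_polynomial f :=
  [/\ supported f, exists w, f w != 0 & exists z, singular_at A f z].

Definition Sing : set (set poly3) := [set surface f | f in singular_polynomial].

Definition coordinates f : 'I_#|` A| -> K := fun i => f (nth 0 A i).

Definition nondefective :=
  closure_is_hypersurface [set coordinates f | f in singular_polynomial].

Definition trop_poly (c : 'rV[int]_3 -> \bar R) X : \bar R :=
  \big[maxe/-oo%E]_(w <- A) (c w + (dot (real_point R w) X)%:E)%E.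

(* A tropical surface with Newton polytope Delta is given by the coefficients
   c_w of the convex function F_S of which it is the corner locus. *)
Definition tropF S X : \bar R := trop_poly (fun w => (S w)%:E) X.

Definition corner_locus S : set 'rV[R]_3 :=
  [set X | exists w w', [/\ w \in A, w' \in A, w != w',
    tropF S X = (S w + dot (real_point R w) X)%:E &
    tropF S X = (S w' + dot (real_point R w') X)%:E]].

(* The equality of the functions, and not only of their corner loci, records
   the weights of the tropical surface. The additive constant in F_S is
   absorbed by the choice of the defining polynomial f, so that the values of
   the Legendre dual nu S at lattice points are exponents of K. *)
Definition tropicalizes_to s S := exists2 f, s f &
  forall X, trop_poly (fun w => puiseux_val (f w)) X = tropF S X.

Definition Sing_trop : set ('rV[int]_3 -> R) :=
  [set S | exists2 s, Sing s & tropicalizes_to s S].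

Definition nu S y : \bar R :=
  ereal_sup [set ((dot y X)%:E - tropF S X)%E | X in [set: 'rV[R]_3]].

(* the cells, of all dimensions, of the dual subdivision of Delta *)
Definition dual_cell S (D : set 'rV[R]_3) := exists X (b : R),
  (forall y, Delta y -> (dot X y + b)%:E <= nu S y)%E /\
  D = [set y | Delta y /\ nu S y = (dot X y + b)%:E].

(* C consists of lattice points of a single cell. For S in Sing^tr(Delta, x)
   there is exactly one such C; this uniqueness is not made part of the
   definition. *)
Definition dual_circuit S C := circuit R C /\
  exists2 D, dual_cell S D & forall w, w \in C -> D (real_point R w).

Definition passes_through s (z : 'rV[K]_3) :=
  forall f, s f -> laurent_eval A f z = 0.

Definition Sing_through N (p : 'M[K]_(N, 3)) S : set (set poly3) :=
  [set s | [/\ Sing s, tropicalizes_to s S & forall i, passes_through s (row i p)]].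

Definition matches_poly S alpha f :=
  forall w, w \in A -> leading_term (f w) (alpha w) (nu S (real_point R w)).

Definition matches S alpha s := exists2 f, s f & matches_poly S alpha f.

(* alpha is a vector of homogeneous coordinates of a point of CP^(N+1); the
   condition, like [matches], is invariant under scaling alpha by C^*. *)
Definition enhancement N (p : 'M[K]_(N, 3)) S C alpha :=
  [/\ forall w, w \in A -> alpha w != 0,
      exists f, matches_poly S alpha f /\
        forall i, laurent_eval A f (row i p) = 0 &
      exists Z : 'rV[R[i]]_3, singular_at C alpha Z].

End Surfaces.

(* 0 << M_1 << ... << M_N *)
Definition growth (kappa : rat) (N : nat) (M : 'I_N -> rat) :=
  (forall i : 'I_N, i = 0%N :> nat -> kappa < M i) /\
  (forall i j : 'I_N, j = i.+1 :> nat -> kappa < M j / M i).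

(* Main.v *)
(** For marked points [x_i = M_i v] with rapidly growing [M_i], the restriction of
    the tropical polynomial to the line [R v] has a break at every [x_i]; with
    [|A| = N + 2] monomials and [N] breaks, the pairs of monomials tied at the
    [x_i] are the edges of a forest with two components on the lattice points [A].
    The polynomials through [p] with leading coefficients [alpha] therefore form a
    pencil [f0 + theta f1] with [theta = O(t^{>0})], where the leading coefficients
    of [f1] are [alpha * chi] for a function [chi] constant on the components and
    not globally. A linear relation among the lattice points of a cell gives a
    linear relation between the [M_i], which rapid growth forbids unless it is
    proportional to that of the circuit [C]. Hence a singular point [z] of a
    surface of the pencil has the valuation dual to the cell of [C], and its
    leading coefficient [Z] is a singular point of the circuit polynomial
    [sum_(w in C) alpha_w Z^w].

    Conversely, the four equations of a singular point have, at [theta = 0] and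
    [Z], an invertible Jacobian in [theta] and [log z], so every [Z] lifts to a
    unique surface. Convergence is obtained from the norms [sum_n |a_n| rho^n]: the
    fixed point iteration stays in a small ball, while its coefficients stabilise
    one by one. Distinct [Z] give distinct surfaces, because the leading difference
    of the two values of [theta] comes from the monomial nearest to the circuit on
    which the character [Z' / Z] is not trivial; there is one because [A]
    generates [Z^3]. Finally the points [Z] form a torsor under the characters of
    [Z^3] that are constant on [C]: these are trivial when [C] generates [Z^3],
    and are the fifth roots of unity in the exceptional case of index [5]. *)

Require Import Defs.
From HB Require Import structures.
From mathcomp Require Import all_boot all_order all_algebra finmap.
From mathcomp Require Import all_classical all_reals all_analysis.
From mathcomp Require Import complex.
From mathcomp Require Import separable cyclotomic ring lra zify.
Set Implicit Arguments.
Unset Strict Implicit.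
Unset Printing Implicit Defensive.
Import Order.TTheory GRing.Theory Num.Theory.
Import ComplexField.Normc.
Local Open Scope classical_set_scope.
Local Open Scope ring_scope.

(** * Orders and leading coefficients of Puiseux series *)

(** Functions on [A] constant along the edges form a plane spanned by [1] and [chi]. A vector
    annihilating both is a combination of edge vectors, so its pairing with the exponents is a
    linear form in the [M i], which rapid growth keeps from vanishing unless the vector is zero on
    [A]. Relations supported in cells annihilate the exponents, and two of them can be combined so
    as to annihilate [chi]; the combination is then zero. This argument shows that relations in a
    cell are multiples of [lambda], that the cell of [C] has no further lattice point and, in a
    variant, that monomials off [C] lie at distinct distances from its linear function. One [kappa]
    serves for all because only finitely many graphs and supports occur. The obstacle in the lifting
    is that the field of convergent series is not complete for the order in [t]: Newton iteration
    alone yields a formal solution. So each estimate is carried out both for orders of contact and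
    for norms, and the equations are reduced to linear maps plus remainders that are stable under
    the operations building them. *)

Section Order.
Variable R : realType.
Local Notation K := (puiseux R).
Implicit Types (a b : K) (p q r s : rat) (c z : R[i]).

Definition vge q a := forall s, s < q -> a s = 0.

Lemma pcoef0 r : (0 : K) r = 0.
Proof. by rewrite /= if_same. Qed.

Lemma pcoefD a b r : (a + b) r = a r + b r. Proof. by []. Qed.
Lemma pcoefN a r : (- a) r = - a r. Proof. by []. Qed.
Lemma pcoefB a b r : (a - b) r = a r - b r. Proof. by []. Qed.

Lemma pcoef_sum (I : Type) (l : seq I) (P : pred I) (F : I -> K) r :
  (\sum_(i <- l | P i) F i) r = \sum_(i <- l | P i) F i r.
Proof. by rewrite (big_morph (fun a : K => a r) (fun a b => pcoefD a b r) (pcoef0 r)). Qed.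

Lemma puiseux_eqP a b : (forall r, a r = b r) -> a = b.
Proof. by move=> ab; apply: puiseux_eq; apply/funext. Qed.

Lemma pcoefM a b r : (a * b) r = puiseux_conv a b r. Proof. by []. Qed.

Lemma vgeW p q a : p <= q -> vge q a -> vge p a.
Proof. by move=> pq va s /lt_le_trans sp; apply/va/sp. Qed.

Lemma vge_0 q : vge q 0. Proof. by move=> s _; rewrite pcoef0. Qed.

Lemma vgeD q a b : vge q a -> vge q b -> vge q (a + b).
Proof. by move=> va vb s sq; rewrite pcoefD va// vb// addr0. Qed.

Lemma vgeN q a : vge q a -> vge q (- a).
Proof. by move=> va s sq; rewrite pcoefN va// oppr0. Qed.

Lemma vgeB q a b : vge q a -> vge q b -> vge q (a - b).
Proof. by move=> va vb; apply: vgeD => //; exact: vgeN. Qed.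

Lemma vge_sum q (I : eqType) (l : seq I) (F : I -> K) :
  (forall i, i \in l -> vge q (F i)) -> vge q (\sum_(i <- l) F i).
Proof.
by move=> vF s sq; rewrite pcoef_sum big_seq big1// => i il; exact: vF.
Qed.

Lemma vgeM p q a b : vge p a -> vge q b -> vge (p + q) (a * b).
Proof.
move=> va vb r rpq; rewrite pcoefM; apply: fsbig1 => s _.
have [sp|ps] := ltP s p; first by rewrite va// mul0r.
by rewrite vb ?mulr0// ltrBlDr (lt_le_trans rpq)// addrC lerD2l.
Qed.

Lemma pcoefM_lead p q a b : vge p a -> vge q b -> (a * b) (p + q) = a p * b q.
Proof.
move=> va vb; rewrite pcoefM /puiseux_conv.
rewrite (@fsbigE _ _ _ _ _ [:: p])//= => [|s _].
  by rewrite big_cons big_nil in_setT addr0 addrAC subrr add0r.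
rewrite inE => sp; have [lsp|psl] := ltP s p; first by rewrite va// mul0r.
have ps : p < s by rewrite lt_neqAle eq_sym sp.
by rewrite vb ?mulr0//; lra.
Qed.

(** The exponents of a series lie in one progression [(n - k) / m] with [n] natural, so there is a
    least one. *)
Lemma exists_order a : a != 0 -> exists q, a q != 0 /\ vge q a.
Proof.
move=> a0; have /convergent_puiseuxP[m [k [m0 sa _]]] := coefP a.
have m0r : (0 : rat) < m%:R by rewrite ltr0n.
have ex : exists n, a (exponent m k n) != 0.
  apply: contrapT => na; move/eqP: a0; apply; apply: puiseux_eqP => r.
  rewrite pcoef0; have [//|ar] := eqVneq (a r) 0.
  by have [n rn] := sa _ ar; case: na; exists n; rewrite -rn.
case: (ex_minnP ex) => n an nmin; exists (exponent m k n); split=> // s sn.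
have [//|/[dup] as0 /sa[j sj]] := eqVneq (a s) 0.
rewrite sj in as0; have /= nj := nmin _ as0; move: sn.
by rewrite sj ltNge /exponent ler_pM2r ?invr_gt0// lerD2r ler_nat nj.
Qed.

Lemma vge_min (I : eqType) (l : seq I) (F : I -> K) :
  (exists2 i, i \in l & F i != 0) ->
  exists q, (forall i, i \in l -> vge q (F i)) /\ exists2 i, i \in l & F i q != 0.
Proof.
have cons_zero i l' q : F i = 0 -> (forall i, i \in l' -> vge q (F i)) /\
    (exists2 i, i \in l' & F i q != 0) -> (forall j, j \in i :: l' -> vge q (F j)) /\
    exists2 j, j \in i :: l' & F j q != 0.
  move=> Fi0 [vq [k kl Fk]]; split; last by exists k => //; rewrite inE kl orbT.
  by move=> j; rewrite inE => /predU1P[->|/vq//]; rewrite Fi0; exact: vge_0.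
elim: l => [|i l ih]; first by case.
case=> j; rewrite inE => jl Fj.
have [Fi0|/exists_order[q [Fq vq]]] := eqVneq (F i) 0.
  have [|q hq] := ih; last by exists q; exact: cons_zero.
  exists j => //; by case/predU1P: jl Fj => [->|//]; rewrite Fi0 eqxx.
have [lz|nlz] := pselect (forall k, k \in l -> F k = 0).
  exists q; split; last by exists i; rewrite ?mem_head.
  by move=> k; rewrite inE => /predU1P[->//|/lz ->]; exact: vge_0.
have [|q' [vq' [k kl Fk]]] := ih.
  apply: contrapT => nex; apply: nlz => k kl; apply: contrapT => Fk; apply: nex.
  by exists k => //; exact/eqP.
have [qq'|q'q] := leP q q'.
  exists q; split; last by exists i; rewrite ?mem_head.
  by move=> k'; rewrite inE => /predU1P[->//|/vq']; exact: vgeW.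
exists q'; split; last by exists k; rewrite // inE kl orbT.
by move=> k'; rewrite inE => /predU1P[->|/vq'//]; exact: vgeW (ltW q'q) vq.
Qed.

(* [lead a c q]: [a = (c + O(t^{>0})) t^q], where [c] may vanish. *)
Definition lead a c q := a q = c /\ vge q a.

Lemma lead_at a c q : lead a c q -> a q = c. Proof. by case. Qed.
Lemma lead_vge a c q : lead a c q -> vge q a. Proof. by case. Qed.

Lemma leadM a b c z p q : lead a c p -> lead b z q -> lead (a * b) (c * z) (p + q).
Proof. by move=> [ac va] [bz vb]; split; [rewrite pcoefM_lead// ac bz|exact: vgeM]. Qed.

Lemma leadD a b c z q : lead a c q -> lead b z q -> lead (a + b) (c + z) q.
Proof. by move=> [ac va] [bz vb]; split; [rewrite pcoefD ac bz|exact: vgeD]. Qed.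

Lemma leadB a b c z q : lead a c q -> lead b z q -> lead (a - b) (c - z) q.
Proof. by move=> [ac va] [bz vb]; split; [rewrite pcoefB ac bz|exact: vgeB]. Qed.

Lemma lead_gt a q r : vge r a -> q < r -> lead a 0 q.
Proof. by move=> va qr; split; [exact: va|exact: vgeW (ltW qr) va]. Qed.

Lemma lead_sum (I : eqType) (l : seq I) (F : I -> K) (c : I -> R[i]) q :
  (forall i, i \in l -> lead (F i) (c i) q) ->
  lead (\sum_(i <- l) F i) (\sum_(i <- l) c i) q.
Proof.
move=> lF; split; last by apply: vge_sum => i /lF[].
by rewrite pcoef_sum; apply: eq_big_seq => i /lF[].
Qed.

Lemma lead_eq0 a c q : lead a c q -> a = 0 -> c = 0.
Proof. by move=> [<- _] ->; rewrite pcoef0. Qed.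

Lemma lead_neq0 a c q : lead a c q -> c != 0 -> a != 0.
Proof. by move=> la; apply: contra_neq; exact: lead_eq0 la. Qed.

Lemma lead_unique a c c' q q' : lead a c q -> lead a c' q' -> c != 0 -> c' != 0 ->
  q = q' /\ c = c'.
Proof.
move=> [ac va] [ac' va'] c0 c'0; suff qq' : q = q' by split=> //; rewrite -ac -ac' qq'.
have [qq'|q'q|//] := ltgtP q q'.
- by move: c0; rewrite -ac va'// eqxx.
- by move: c'0; rewrite -ac' va// eqxx.
Qed.

Local Notation cst := (@puiseux_const R).

Lemma coef_cst z r : cst z r = if r == 0 then z else 0. Proof. by []. Qed.

Lemma lead_cst z : lead (cst z) z 0.
Proof. by split; rewrite ?coef_cst ?eqxx// => s s0; rewrite coef_cst lt_eqF. Qed.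

Lemma cst0 : cst 0 = 0. Proof. by []. Qed.
Lemma cst1 : cst 1 = 1. Proof. by []. Qed.

Lemma cstD z c : cst (z + c) = cst z + cst c.
Proof.
by apply: puiseux_eqP => r; rewrite pcoefD !coef_cst; case: ifP => // _; rewrite addr0.
Qed.

Lemma cstN z : cst (- z) = - cst z.
Proof. by apply: puiseux_eqP => r; rewrite pcoefN !coef_cst; case: ifP => // _; rewrite oppr0. Qed.

Lemma cstM_coef z a r : (cst z * a) r = z * a r.
Proof.
rewrite pcoefM /puiseux_conv (@fsbigE _ _ _ _ _ [:: 0])//= => [|s _].
  by rewrite big_cons big_nil in_setT eqxx subr0 addr0.
by rewrite inE => /negbTE ->; rewrite mul0r.
Qed.

Lemma cstM z c : cst (z * c) = cst z * cst c.
Proof.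
by apply: puiseux_eqP => r; rewrite cstM_coef !coef_cst; case: ifP => // _; rewrite mulr0.
Qed.

Lemma cst_sum (I : Type) (l : seq I) (F : I -> R[i]) :
  cst (\sum_(i <- l) F i) = \sum_(i <- l) cst (F i).
Proof. exact: (big_morph cst cstD cst0). Qed.

Lemma cst_eq0 z : (cst z == 0) = (z == 0).
Proof.
apply/eqP/eqP => [/(congr1 (fun a : K => a 0))|->]; last exact: cst0.
by rewrite pcoef0 coef_cst eqxx.
Qed.

Lemma cst_nat n : cst n%:R = n%:R.
Proof. by elim: n => [|n ih]; rewrite ?cst0// -!natr1 cstD ih. Qed.

Lemma cst_int (n : int) : cst n%:~R = n%:~R.
Proof. by case: n => n; rewrite ?NegzE ?mulrNz ?cstN; congr (- _) || idtac; exact: cst_nat. Qed.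

Lemma coef_intM (n : int) a r : (n%:~R * a) r = n%:~R * a r.
Proof. by rewrite -cst_int cstM_coef. Qed.

Lemma vge_cstM z a q : vge q a -> vge q (cst z * a).
Proof. by move=> va; rewrite -[q]add0r; apply: vgeM => //; case: (lead_cst z). Qed.

Lemma vge_natM n a q : vge q a -> vge q (n%:R * a).
Proof. by move=> va; rewrite -cst_nat; exact: vge_cstM. Qed.

Lemma vge_intM (n : int) a q : vge q a -> vge q (n%:~R * a).
Proof. by rewrite -cst_int; exact: vge_cstM. Qed.

Lemma lead_intM (n : int) a c q : lead a c q -> lead (n%:~R * a) (n%:~R * c) q.
Proof. by move=> [ac va]; split; [rewrite coef_intM ac|exact: vge_intM]. Qed.

Lemma tpow_subproof q : convergent_puiseux (fun r => if r == q then 1 else 0 : R[i]).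
Proof.
have d0 : (denq q)%:~R != 0 :> rat by rewrite intr_eq0 denq_eq0.
have dE : (`|denq q|%N)%:R = (denq q)%:~R :> rat by rewrite -[LHS]/((`|denq q|%N : int)%:~R) gtz0_abs ?denq_gt0.
(* Adding [|numq q|] writes the possibly negative numerator as a difference of naturals, the form
   that [exponent] requires. *)
pose n := absz (numq q + (absz (numq q))%:Z)%R.
have qE : q = exponent `|denq q|%N `|numq q|%N n.
  apply: (mulIf d0); rewrite /exponent dE mulfVK// -numqE.
  have {1}-> : numq q = n%:Z - `|numq q|%N%:Z by rewrite /n; lia.
  by rewrite intrB.
have m0 : (0 < `|denq q|)%N by rewrite absz_gt0 denq_eq0.
apply/convergent_puiseuxP; exists `|denq q|%N, `|numq q|%N; split=> // [r|].
  by case: (r =P q) => [-> _|_ /eqP//]; exists n.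
exists 1 => // k; rewrite expr1n; case: ifP => _; last by rewrite normc0.
by rewrite /normc /= expr1n expr0n addr0 sqrtr1.
Qed.

Definition tpow q : K := Puiseux (tpow_subproof q).

Lemma coef_tpow q r : tpow q r = if r == q then 1 else 0. Proof. by []. Qed.

Lemma lead_tpow q : lead (tpow q) 1 q.
Proof. by split; rewrite ?coef_tpow ?eqxx// => s sq; rewrite coef_tpow lt_eqF. Qed.

Lemma tpowM_coef q a r : (tpow q * a) r = a (r - q).
Proof.
rewrite pcoefM /puiseux_conv (@fsbigE _ _ _ _ _ [:: q])//= => [|s _].
  by rewrite big_cons big_nil in_setT eqxx mul1r addr0.
by rewrite inE => /negbTE ->; rewrite mul0r.
Qed.

Lemma tpowD q r : tpow (q + r) = tpow q * tpow r.
Proof.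
apply: puiseux_eqP => s; rewrite tpowM_coef !coef_tpow.
by rewrite subr_eq addrC.
Qed.

Lemma tpow0 : tpow 0 = 1.
Proof. by apply: puiseux_eqP => s; rewrite coef_tpow /= . Qed.

Lemma tpow_neq0 q : tpow q != 0.
Proof. exact: lead_neq0 (lead_tpow q) (oner_neq0 _). Qed.

Lemma leadV a c q : lead a c q -> c != 0 -> lead a^-1 c^-1 (- q).
Proof.
move=> la c0; have a0 := lead_neq0 la c0.
have /exists_order[p [ap vp]] : a^-1 != 0 by rewrite invr_eq0.
have lp : lead a^-1 (a^-1 p) p by [].
have := leadM la lp; rewrite divff// -cst1 => l1.
have cp0 : c * a^-1 p != 0 by rewrite mulf_neq0.
have [qp cp] := lead_unique (lead_cst 1) l1 (oner_neq0 _) cp0.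
have -> : - q = p by lra.
by have -> : c^-1 = a^-1 p by rewrite -[LHS]mul1r cp mulrC mulKf.
Qed.

Lemma leadX a c q n : lead a c q -> lead (a ^+ n) (c ^+ n) (n%:R * q).
Proof.
move=> la; elim: n => [|n ih]; first by rewrite !expr0 mul0r -cst1; exact: lead_cst.
by rewrite !exprS -[n.+1]add1n natrD mulrDl mul1r; exact: leadM.
Qed.

Lemma lead_exprz a c q (n : int) : lead a c q -> c != 0 ->
  lead (a ^ n) (c ^ n) (n%:~R * q).
Proof.
move=> la c0; case: n => n; first exact: leadX.
by rewrite NegzE mulrNz mulNr -!exprnN; apply: leadV; rewrite ?expf_neq0//; exact: leadX.
Qed.

Lemma lead_prod (I : eqType) (l : seq I) (F : I -> K) (c : I -> R[i]) (q : I -> rat) :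
  (forall i, lead (F i) (c i) (q i)) ->
  lead (\prod_(i <- l) F i) (\prod_(i <- l) c i) (\sum_(i <- l) q i).
Proof.
move=> lF; elim: l => [|i l ih]; first by rewrite !big_nil -cst1; exact: lead_cst.
by rewrite !big_cons; exact: leadM.
Qed.

Lemma lead_monomial (z : 'rV[K]_3) (Z : 'rV[R[i]]_3) (y : 'rV[rat]_3) (w : 'rV[int]_3) :
  (forall j, lead (z 0 j) (Z 0 j) (y 0 j)) -> (forall j, Z 0 j != 0) ->
  lead (monomial z w) (monomial Z w) (\sum_(j < 3) (w 0 j)%:~R * y 0 j).
Proof. by move=> lz Z0; apply: lead_prod => j; exact: lead_exprz. Qed.

Lemma puiseux_val_lead a c q : lead a c q -> c != 0 -> puiseux_val a = (- ratr q)%:E.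
Proof.
move=> [ac va] c0; rewrite /puiseux_val; apply/eqP; rewrite eq_le; apply/andP; split.
- apply: ge_ereal_sup => _ [r /= ar <-].
  rewrite lee_fin lerN2 ler_rat leNgt; apply/negP => /va; exact/eqP.
- by apply: ereal_sup_ubound; exists q => //=; rewrite ac.
Qed.

Lemma puiseux_val_fin a q : puiseux_val a = (ratr q)%:E ->
  lead a (a (- q)) (- q) /\ a (- q) != 0.
Proof.
move=> aq; have a0 : a != 0.
  apply/eqP => a0; move: aq; rewrite a0 /puiseux_val.
  rewrite (_ : [set _ | _ in _] = set0) ?ereal_sup0//.
  rewrite -subset0 => x [r /=]; by rewrite if_same eqxx.
have [p [ap vp]] := exists_order a0.
have lp : lead a (a p) p by [].
move: (puiseux_val_lead lp ap); rewrite aq -rmorphN/= => -[/fmorph_inj ->].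
by rewrite opprK.
Qed.

End Order.

(** * Fixed points and Hensel's lemma for convergent series *)

Section TruncatedNorm.
Variables (R : realType) (m : nat).
Hypothesis m_gt0 : (0 < m)%N.
Local Notation K := (puiseux R).
Local Notation cst := (@puiseux_const R).
Local Notation ex := (exponent m 0).
Implicit Types (a b : K) (rho r tau : R).

(** Convergent power series in [t^(1/m)]: a ring with coefficients indexed by naturals, in which the
    fixed point argument takes place. *)
Definition integral_shape a := puiseux_shape m 0 a.

Lemma exponent00 : ex 0 = 0.
Proof. by rewrite /exponent subrr mul0r. Qed.

Lemma exponent_lt i j : (ex i < ex j) = (i < j)%N.
Proof.
by rewrite /exponent ltr_pM2r ?invr_gt0 ?ltr0n// ltrD2r ltr_nat.
Qed.

Lemma shape_cst z : integral_shape (cst z).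
Proof. by have := @good_widen R 1 0 m 0 _ m_gt0 (good_const z); rewrite mul1n mul0n. Qed.

Lemma shapeD a b : integral_shape a -> integral_shape b -> integral_shape (a + b).
Proof.
move=> [_ sa ga] [_ sb gb]; split=> //; last exact: geoD.
by move=> r; rewrite pcoefD; have [->|/sa//] := eqVneq (a r) 0; rewrite add0r => /sb.
Qed.

Lemma shapeM a b : integral_shape a -> integral_shape b -> integral_shape (a * b).
Proof. by move=> sa sb; exact: (good_conv sa sb). Qed.

Lemma shape_vge0 a : integral_shape a -> vge 0 a.
Proof.
move=> [_ sa _] s s0; have [//|/sa[n sn]] := eqVneq (a s) 0.
by move: s0; rewrite sn -exponent00 exponent_lt.
Qed.

Lemma shape_vgeP a l : integral_shape a ->
  (forall i, (i < l)%N -> a (ex i) = 0) -> vge (ex l) a.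
Proof.
move=> [_ sa _] al s sl; have [//|/sa[n sn]] := eqVneq (a s) 0.
by rewrite sn al// -exponent_lt -sn.
Qed.

Lemma shapeN a : integral_shape a -> integral_shape (- a).
Proof.
move=> [_ sa ga]; split=> //; last exact: geoN.
by move=> r; rewrite pcoefN oppr_eq0 => /sa.
Qed.

Lemma shapeB a b : integral_shape a -> integral_shape b -> integral_shape (a - b).
Proof. by move=> sa sb; apply: shapeD => //; exact: shapeN. Qed.

(** Truncations of the norm. A bound valid for all [k] replaces the convergence of the sum, which
    would have to be known beforehand. *)
Definition partial_norm rho k a := \sum_(i < k) normc (a (ex i)) * rho ^+ i.

Lemma partial_normD rho k a b : 0 <= rho ->
  partial_norm rho k (a + b) <= partial_norm rho k a + partial_norm rho k b.
Proof.
move=> rho0; rewrite /partial_norm -big_split/=; apply: ler_sum => i _.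
by rewrite -mulrDl ler_wpM2r ?exprn_ge0// normc_triangle.
Qed.

Lemma partial_norm0 rho k : partial_norm rho k 0 = 0.
Proof. by rewrite /partial_norm big1// => i _; rewrite pcoef0 normc0 mul0r. Qed.

Lemma partial_normZ rho k z a :
  partial_norm rho k (cst z * a) = normc z * partial_norm rho k a.
Proof.
rewrite /partial_norm mulr_sumr; apply: eq_bigr => i _.
by rewrite cstM_coef normcM mulrA.
Qed.

Lemma partial_norm_ge0 rho k a : 0 <= rho -> 0 <= partial_norm rho k a.
Proof. by move=> r0; rewrite sumr_ge0// => i _; rewrite mulr_ge0 ?normc_ge0 ?exprn_ge0. Qed.

Lemma sum_triangle (A B : nat -> R) k :
  \sum_(n < k) \sum_(i < n.+1) A i * B (n - i)%N =
  \sum_(i < k) A i * \sum_(j < k - i) B j.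
Proof.
elim: k => [|k ih]; first by rewrite !big_ord0.
rewrite big_ord_recr/= ih [in RHS]big_ord_recr/= [X in _ + X]big_ord_recr/=.
rewrite addrA -big_split/= subSnn big_ord1 subnn; congr (_ + _).
apply: eq_bigr => i _; rewrite -mulrDr subSn; last exact: ltnW.
by rewrite big_ord_recr.
Qed.

Lemma sum_ord_le (B : nat -> R) k l : (forall i, 0 <= B i) -> (k <= l)%N ->
  \sum_(j < k) B j <= \sum_(j < l) B j.
Proof.
move=> B0 kl; rewrite -!(big_mkord xpredT B).
by rewrite [leRHS](@big_cat_nat _ _ _ k)//= lerDl sumr_ge0.
Qed.

(** The truncated product involves only pairs of indices with sum below [k], a triangle inside the
    square covered by the product of the truncations. *)
Lemma partial_normM rho k a b : 0 <= rho -> integral_shape a -> integral_shape b ->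
  partial_norm rho k (a * b) <= partial_norm rho k a * partial_norm rho k b.
Proof.
move=> rho0 sa sb; pose A i := normc (a (ex i)) * rho ^+ i.
pose B i := normc (b (ex i)) * rho ^+ i.
have A0 i : 0 <= A i by rewrite mulr_ge0 ?normc_ge0 ?exprn_ge0.
have B0 i : 0 <= B i by rewrite mulr_ge0 ?normc_ge0 ?exprn_ge0.
apply: (@le_trans _ _ (\sum_(n < k) \sum_(i < n.+1) A i * B (n - i)%N)).
  apply: ler_sum => n _; rewrite pcoefM (@convE R m 0 0 a b n sa sb) /cauchy_prod.
  apply: (@le_trans _ _ ((\sum_(i < n.+1) normc (a (ex i) * b (ex (n - i)))) * rho ^+ n)).
    by rewrite ler_wpM2r ?exprn_ge0// normc_sum.
  rewrite mulr_suml; apply: ler_sum => i _; rewrite normcM.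
  have -> : rho ^+ n = rho ^+ i * rho ^+ (n - i) by rewrite -exprD subnKC// -ltnS.
  by rewrite mulrACA.
rewrite sum_triangle mulr_suml; apply: ler_sum => i _.
apply: ler_wpM2l => //; by apply: sum_ord_le => //; exact: leq_subr.
Qed.

Lemma geometric_half_sum k : \sum_(i < k) (2^-1 : R) ^+ i <= 2.
Proof.
have : \sum_(i < k) (2^-1 : R) ^+ i = 2 - 2 * 2^-1 ^+ k.
  elim: k => [|k ih]; first by rewrite big_ord0 expr0; lra.
  by rewrite big_ord_recr/= ih exprS; lra.
by have : 0 <= (2^-1 : R) ^+ k; [rewrite exprn_ge0//; lra|lra].
Qed.

Definition infinitesimal a := integral_shape a /\ a 0 = 0.

Lemma infinitesimal_small a tau : infinitesimal a -> 0 < tau ->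
  exists2 rho0, 0 < rho0 & forall rho, 0 < rho <= rho0 ->
    forall k, partial_norm rho k a <= tau.
Proof.
move=> [[_ _ [B B1 aB]] a0] tau0; have B0 : 0 < B by rewrite (lt_le_trans ltr01).
have BB0 : 0 < 2 * B ^+ 2 by rewrite mulr_gt0// exprn_gt0.
(* The first bound gives [B * rho <= 1/2], so that a geometric series bounds the norm by
   [2 * B ^+ 2 * rho]; the second makes this at most [tau]. *)
exists (Num.min (2 * B)^-1 (tau / (2 * B ^+ 2))).
  by rewrite lt_min invr_gt0 !divr_gt0// mulr_gt0.
move=> rho /andP[rho0]; rewrite le_min => /andP[rB rt] k.
case: k => [|k]; first by rewrite /partial_norm big_ord0 ltW.
rewrite /partial_norm big_ord_recl exponent00 a0 normc0 mul0r add0r.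
have Br : B * rho <= 2^-1.
  apply: le_trans (ler_wpM2l (ltW B0) rB) _.
  by rewrite invfM mulrCA divff ?mulr1// gt_eqF.
apply: (@le_trans _ _ (\sum_(i < k) B ^+ 2 * rho * 2^-1 ^+ i)).
  apply: ler_sum => i _; rewrite lift0.
  apply: (@le_trans _ _ (B ^+ i.+2 * rho ^+ i.+1)).
    by rewrite ler_wpM2r// exprn_ge0// ltW.
  have -> : B ^+ i.+2 * rho ^+ i.+1 = B ^+ 2 * rho * (B * rho) ^+ i.
    by rewrite exprMn !exprS expr0; ring.
  apply: ler_wpM2l; first by rewrite mulr_ge0 ?exprn_ge0// ltW.
  by apply: lerXn2r => //; rewrite nnegrE ?mulr_ge0 ?ltW// invr_ge0.
rewrite -mulr_sumr.
apply: (@le_trans _ _ (B ^+ 2 * rho * 2)).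
  by rewrite ler_wpM2l ?geometric_half_sum// mulr_ge0 ?exprn_ge0// ltW.
by move: rt; rewrite ler_pdivlMr//; lra.
Qed.

Lemma infinitesimalD a b : infinitesimal a -> infinitesimal b -> infinitesimal (a + b).
Proof. by move=> [sa a0] [sb b0]; split; [exact: shapeD|rewrite pcoefD a0 b0 addr0]. Qed.

Lemma infinitesimal0 : infinitesimal 0.
Proof. by split; [exact: shape_cst|rewrite pcoef0]. Qed.

Lemma infinitesimalMl a b : integral_shape a -> infinitesimal b -> infinitesimal (a * b).
Proof.
move=> sa [sb b0]; split; first exact: shapeM.
by rewrite -[0]addr0 (pcoefM_lead (shape_vge0 sa) (shape_vge0 sb)) b0 mulr0.
Qed.

Lemma infinitesimal_vge1 a : infinitesimal a -> vge (ex 1) a.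
Proof.
move=> [sa a0]; apply: (shape_vgeP sa) => i; rewrite ltnS leqn0 => /eqP ->.
by rewrite exponent00.
Qed.

Lemma puiseux_of_seq (u : nat -> R[i]) : geo u ->
  exists2 a, integral_shape a & forall i, a (ex i) = u i.
Proof.
move=> gu.
pose b (s : rat) := if pselect (exists i, s = ex i) is left e then u (projT1 (cid e)) else 0.
have bE i : b (ex i) = u i.
  rewrite /b; case: pselect => [e|[]]; last by exists i.
  by case: cid => /= j /(exponent_inj m_gt0) ->.
have sb : puiseux_shape m 0 b.
  split=> // [r|]; first by rewrite /b; case: pselect => // _ /eqP.
  by have [B B1 uB] := gu; exists B => // i; rewrite bE.
have bP : convergent_puiseux b by apply/convergent_puiseuxP; exists m, 0%N.
by exists (Puiseux bP).
Qed.

Lemma geo_of_bound (u : nat -> R[i]) rho r : 0 < rho -> 0 <= r ->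
  (forall i, normc (u i) * rho ^+ i <= r) -> geo u.
Proof.
move=> rho0 r0 ur; have i0 : 0 <= rho^-1 by rewrite invr_ge0 ltW.
exists (1 + r + rho^-1) => [|i]; first by rewrite -addrA lerDl addr_ge0.
have := ur i; rewrite -ler_pdivlMr ?exprn_gt0// => /le_trans; apply.
rewrite exprS -exprVn; apply: ler_pM; rewrite ?exprn_ge0//.
  by rewrite addrAC lerDr addr_ge0.
by apply: lerXn2r; rewrite ?nnegrE ?lerDr ?addr_ge0.
Qed.

End TruncatedNorm.

(** * Fixed points of contracting systems *)

Section FixedPoint.
Variables (R : realType) (m n : nat).
Hypothesis m_gt0 : (0 < m)%N.
Local Notation K := (puiseux R).
Local Notation cst := (@puiseux_const R).
Local Notation ex := (exponent m 0).
Local Notation X := ('I_n -> K).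
Implicit Types (u v : X -> K) (x y : X) (rho r tau : R).

Definition dom x := forall j, infinitesimal m (x j).
Definition agree l x y := forall j, vge (ex l) (x j - y j).
Definition norm_ball rho r x := forall j k, partial_norm m rho k (x j) <= r.

(* [raising d u]: [u] raises the order of contact of two points by [d].
   [bounded tau u]: [u] maps the ball of radius [r] into that of radius [tau * r],
   for [r] small and [rho] small with respect to [r]. *)
Definition raising (d : nat) u :=
  (forall x, dom x -> infinitesimal m (u x)) /\
  (forall l x y, dom x -> dom y -> agree l x y -> vge (ex (l + d)) (u x - u y)).

Definition bounded tau u := exists2 r0, 0 < r0 & forall r, 0 < r <= r0 ->
  exists2 rho0, 0 < rho0 & forall rho, 0 < rho <= rho0 -> forall x, dom x ->
    norm_ball rho r x -> forall k, partial_norm m rho k (u x) <= tau * r.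

Definition nonexpanding u := raising 0 u /\ exists2 tau, 0 < tau & bounded tau u.
(** The first part makes the coefficients of the iterates stabilise and so produces a formal
    solution; the second keeps the iterates in a ball and gives its convergence. *)
Definition contracting u := raising 1 u /\ forall tau, 0 < tau -> bounded tau u.

Lemma boundedD s t u v : bounded s u -> bounded t v -> bounded (s + t) (fun x => u x + v x).
Proof.
move=> [r1 r10 h1] [r2 r20 h2]; exists (Num.min r1 r2); first by rewrite lt_min r10.
move=> r /andP[r0]; rewrite le_min => /andP[rr1 rr2].
have [|p1 p10 k1] := h1 r; first by rewrite r0.
have [|p2 p20 k2] := h2 r; first by rewrite r0.
exists (Num.min p1 p2); first by rewrite lt_min p10.
move=> p /andP[p0]; rewrite le_min => /andP[pp1 pp2] x dx bx k.
apply: le_trans (partial_normD _ _ _ _ (ltW p0)) _.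
by rewrite mulrDl lerD// ?k1 ?k2 ?p0.
Qed.

Lemma raisingD d u v : raising d u -> raising d v -> raising d (fun x => u x + v x).
Proof.
move=> [u1 u2] [v1 v2]; split=> [x dx|l x y dx dy xy].
  by apply: (infinitesimalD m_gt0); [exact: u1|exact: v1].
by rewrite opprD addrACA; apply: vgeD; [exact: u2|exact: v2].
Qed.

Lemma nonexpandingD u v : nonexpanding u -> nonexpanding v -> nonexpanding (fun x => u x + v x).
Proof.
move=> [u1 [s s0 u2]] [v1 [t t0 v2]]; split; first exact: raisingD.
by exists (s + t); [rewrite addr_gt0|exact: boundedD].
Qed.

Lemma contractingD u v : contracting u -> contracting v -> contracting (fun x => u x + v x).
Proof.
move=> [u1 u2] [v1 v2]; split=> [|t t0]; first exact: raisingD.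
by rewrite [t]splitr; apply: boundedD; [apply: u2|apply: v2]; rewrite divr_gt0.
Qed.

Lemma raisingZ d z u : raising d u -> raising d (fun x => cst z * u x).
Proof.
move=> [u1 u2]; split=> [x dx|l x y dx dy xy].
  by apply: infinitesimalMl => //; [exact: shape_cst|exact: u1].
by rewrite -mulrBr; apply: vge_cstM; exact: u2.
Qed.

Lemma boundedZ t z u : 0 < t -> bounded t u -> bounded ((1 + normc z) * t) (fun x => cst z * u x).
Proof.
move=> t0 [r1 r10 h1]; exists r1 => // r /[dup] /andP[r0 _] /h1[p1 p10 k1].
exists p1 => // p pp x dx bx k; rewrite partial_normZ -mulrA.
have := k1 _ pp _ dx bx k; have := normc_ge0 z => z0 uk.
apply: (@le_trans _ _ (normc z * (t * r))); first by rewrite ler_wpM2l.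
by rewrite ler_wpM2r ?lerDr// mulr_ge0// ltW.
Qed.

Lemma nonexpandingZ z u : nonexpanding u -> nonexpanding (fun x => cst z * u x).
Proof.
move=> [u1 [t t0 u2]]; split; first exact: raisingZ.
exists ((1 + normc z) * t); last exact: boundedZ.
by rewrite mulr_gt0// ltr_pwDl// normc_ge0.
Qed.

Lemma contractingZ z u : contracting u -> contracting (fun x => cst z * u x).
Proof.
move=> [u1 u2]; split=> [|t t0]; first exact: raisingZ.
have z0 : 0 < 1 + normc z by rewrite ltr_pwDl// normc_ge0.
have t'0 : 0 < t / (1 + normc z) by rewrite divr_gt0.
have := boundedZ z t'0 (u2 _ t'0).
by rewrite mulrC divfK// gt_eqF.
Qed.

Lemma contracting_nonexpanding u : contracting u -> nonexpanding u.
Proof.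
move=> [[u1 u2] u3]; split; last by exists 1; rewrite ?ltr01//; exact: u3.
split=> // l x y dx dy xy; apply: vgeW (u2 _ _ _ dx dy xy).
by rewrite ltW// exponent_lt// addn0 addn1.
Qed.

Lemma nonexpanding_coord j : nonexpanding (fun x => x j).
Proof.
split; first by split=> [x dx|l x y dx dy xy]; [exact: dx|rewrite addn0; exact: xy].
exists 1 => //; exists 1 => // r _; exists 1 => // p _ x dx bx k.
by rewrite mul1r; exact: bx.
Qed.

Lemma contracting_const c : infinitesimal m c -> contracting (fun=> c).
Proof.
move=> ic; split; first by split=> // l x y _ _ _; rewrite subrr; exact: vge_0.
move=> t t0; exists 1 => // r /andP[r0 _].
have [|p p0 h] := @infinitesimal_small R m _ (t * r) ic; first by rewrite mulr_gt0.
by exists p => // q qp x _ _ k; exact: h.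
Qed.

(** Both values are infinitesimal, so each factor raises the contact of the other by one; in norm, a
    product of two terms of size [r] has size [r ^+ 2], which is small relative to [r]. *)
Lemma contractingM u v : nonexpanding u -> nonexpanding v -> contracting (fun x => u x * v x).
Proof.
move=> [[u1 u2] [s s0 u3]] [[v1 v2] [t t0 v3]]; split; first split=> [x dx|l x y dx dy xy].
- by apply: infinitesimalMl => //; [case: (u1 _ dx)|exact: v1].
- have -> : u x * v x - u y * v y = (u x - u y) * v x + u y * (v x - v y) by ring.
  have := u2 _ _ _ dx dy xy; have := v2 _ _ _ dx dy xy; rewrite addn0 => vv uu.
  have vx := infinitesimal_vge1 m_gt0 (v1 _ dx); have uy := infinitesimal_vge1 m_gt0 (u1 _ dy).
  have -> : ex (l + 1) = ex l + ex 1 by rewrite exponentD.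
  by apply: vgeD; [exact: vgeM|rewrite addrC; exact: vgeM].
move=> tau tau0; have [r1 r10 h1] := u3; have [r2 r20 h2] := v3.
exists (Num.min (Num.min r1 r2) (tau / (s * t))).
  by rewrite !lt_min r10 r20 divr_gt0// mulr_gt0.
move=> r /andP[r0]; rewrite !le_min => /andP[/andP[rr1 rr2] rst].
have [|p1 p10 k1] := h1 r; first by rewrite r0.
have [|p2 p20 k2] := h2 r; first by rewrite r0.
exists (Num.min p1 p2); first by rewrite lt_min p10.
move=> p /andP[p0]; rewrite le_min => /andP[pp1 pp2] x dx bx k.
have [sx _] := u1 _ dx; have [sy _] := v1 _ dx.
apply: (le_trans (partial_normM _ (ltW p0) sx sy)).
apply: (@le_trans _ _ ((s * r) * (t * r))).
  by apply: ler_pM; rewrite ?partial_norm_ge0 ?k1 ?k2 ?p0// ltW.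
move: rst; rewrite ler_pdivlMr ?mulr_gt0// => rst.
have -> : s * r * (t * r) = r * (s * t) * r by ring.
by rewrite ler_wpM2r// ltW.
Qed.

Lemma agree_trans l x y z : agree l x y -> agree l y z -> agree l x z.
Proof.
move=> xy yz j; have -> : x j - z j = (x j - y j) + (y j - z j) by ring.
exact: vgeD.
Qed.

Lemma agreeW l l' x y : (l <= l')%N -> agree l' x y -> agree l x y.
Proof. by move=> ll' xy j; apply: vgeW (xy j); rewrite leNgt exponent_lt// -leqNgt. Qed.

Lemma finite_rho (P : 'I_n -> R -> Prop) :
  (forall j, exists2 rho0, 0 < rho0 & forall rho, 0 < rho <= rho0 -> P j rho) ->
  exists2 rho, 0 < rho & forall j, P j rho.
Proof.
move=> h; pose f j := sval (cid2 (h j)).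
have f0 j : 0 < f j by rewrite /f; case: cid2.
have fP j rho : 0 < rho <= f j -> P j rho by rewrite /f; case: cid2 => /= ? _; exact.
have F0 : 0 < \big[Num.min/1]_(j < n) f j.
  by elim/big_ind: _ => // a b a0 b0; rewrite lt_min a0.
exists (\big[Num.min/1]_(j < n) f j) => // j; apply: fP; rewrite F0/=.
exact: bigmin_le.
Qed.

(** The radius [r] is fixed before [rho]: infinitesimal constants are small compared with [r] only
    once [rho] is small. *)
Theorem contracting_fixed_point (psi : 'I_n -> X -> K) :
  (forall j, contracting (psi j)) -> exists2 x, dom x & forall j, x j = psi j x.
Proof.
move=> cpsi.
have dpsi x : dom x -> dom (fun j => psi j x) by move=> dx j; case: (cpsi j) => -[h _ _]; exact: h.
have apsi l x y : dom x -> dom y -> agree l x y ->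
    agree l.+1 (fun j => psi j x) (fun j => psi j y).
  by move=> dx dy xy j; rewrite -addn1; case: (cpsi j) => -[_ h] _; exact: h.
have [r r0 hr] : exists2 r, 0 < r & forall j, exists2 rho0, 0 < rho0 &
    forall rho, 0 < rho <= rho0 -> forall x, dom x -> norm_ball rho r x ->
    forall k, partial_norm m rho k (psi j x) <= r.
  have [|r r0 hr] := @finite_rho (fun j r => exists2 rho0, 0 < rho0 &
      forall rho, 0 < rho <= rho0 -> forall x, dom x -> norm_ball rho r x ->
      forall k, partial_norm m rho k (psi j x) <= r); last by exists r.
  move=> j; case: (cpsi j) => _ /(_ 1 ltr01)[r0 r00 h]; exists r0 => // r /h.
  by rewrite mul1r.
have [rho rho0 hrho] := finite_rho hr.
pose it l := iter l (fun x j => psi j x) (fun=> 0).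
have dit l : dom (it l).
  by elim: l => [|l ih]; [move=> j; exact: infinitesimal0|exact: dpsi].
have bit l : norm_ball rho r (it l).
  elim: l => [j k|l ih j k]; first by rewrite partial_norm0 ltW.
  exact: hrho.
have ait l : agree l (it l) (it l.+1).
  elim: l => [j|l ih]; last exact: (apsi _ _ _ (dit _) (dit _) ih).
  rewrite exponent00; have [s0 _] := dit 0%N j; have [s1 _] := dit 1%N j.
  by apply: vgeB; exact: (shape_vge0 m_gt0).
have ait' l l' : (l <= l')%N -> agree l (it l) (it l').
  elim: l' => [|l' ih]; first by rewrite leqn0 => /eqP -> j; rewrite subrr; exact: vge_0.
  rewrite leq_eqVlt => /predU1P[-> j|ll']; first by rewrite subrr; exact: vge_0.
  by apply: agree_trans (ih _) _ => //; exact: agreeW (ait l').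
(* From the iterate [i.+1] on, the coefficients of index at most [i] no longer change. *)
pose L j i := it i.+1 j (ex i).
have gL j : geo (L j).
  apply: (geo_of_bound rho0 (ltW r0)) => i; apply: le_trans (bit i.+1 j i.+1).
  rewrite /partial_norm big_ord_recr/= lerDr.
  exact: (@partial_norm_ge0 R m rho i (it i.+1 j) (ltW rho0)).
pose a j : K := sval (cid2 (puiseux_of_seq m_gt0 (gL j))).
have sa j : integral_shape m (a j) by rewrite /a; case: cid2.
have aE j i : a j (ex i) = L j i by rewrite /a; case: cid2.
have da : dom a.
  by move=> j; split=> //; have [_ <-] := dit 1%N j; rewrite -(exponent00 m) aE.
have aait l : agree l a (it l).
  move=> j; apply: shape_vgeP => [//||i il]; first by apply: shapeB; case: (dit l j).
  rewrite pcoefB aE /L; apply/eqP; rewrite subr_eq0 -subr_eq0 -pcoefB.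
  by apply/eqP; apply: (ait' i.+1 l il j); rewrite exponent_lt.
exists a => // j; apply: puiseux_eq; apply: (good_eq (sa j) (proj1 (dpsi _ da j))) => i.
apply/eqP; rewrite -subr_eq0 -pcoefB; apply/eqP.
have -> : a j - psi j a = (a j - it i.+1 j) + (it i.+1 j - psi j a) by ring.
suff : vge (ex i.+1) (a j - it i.+1 j + (it i.+1 j - psi j a)).
  by apply; rewrite exponent_lt.
apply: vgeD; first exact: aait.
by rewrite -opprB; apply: vgeN; exact: apsi (aait i) j.
Qed.

End FixedPoint.

Section CommonDenominator.
Variable R : realType.
Local Notation K := (puiseux R).
Implicit Types a : K.

Lemma integral_shape_widen m l a : (0 < l)%N -> integral_shape m a -> integral_shape (m * l) a.
Proof. by move=> l0 sa; have := good_widen 0 l0 sa; rewrite mul0n. Qed.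

Lemma integral_shape_exists a : vge 0 a -> exists2 m, (0 < m)%N & integral_shape m a.
Proof.
move=> va; have /convergent_puiseuxP[m [k [m0 sa [B B1 aB]]]] := coefP a.
have kE i : exponent m 0 i = exponent m k (i + k) by rewrite -(exponent_shift m 0 k i).
have m0r : (0 : rat) < m%:R by rewrite ltr0n.
exists m => //; split=> // [r ar|].
  have [i ri] := sa _ ar; exists (i - k)%N; rewrite kE subnK// leqNgt.
  apply/negP => ik; move: ar; rewrite va ?eqxx// ri /exponent.
  by rewrite pmulr_llt0 ?invr_gt0// subr_lt0 ltr_nat.
exists (B ^+ k.+1) => [|i]; first exact: exprn_ege1.
rewrite kE (le_trans (aB _))// -exprM ler_weXn2l//.
by nia.
Qed.

Lemma common_denominator (I : eqType) (l : seq I) (F : I -> K) :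
  (forall i, i \in l -> vge 0 (F i)) ->
  exists2 m, (0 < m)%N & forall i, i \in l -> integral_shape m (F i).
Proof.
elim: l => [|i l ih] h; first by exists 1%N.
have [|m m0 hm] := ih; first by move=> j jl; apply: h; rewrite inE jl orbT.
have [|m' m'0 hm'] := integral_shape_exists (h i _); first exact: mem_head.
exists (m * m')%N => [|j]; first by rewrite muln_gt0 m0.
rewrite inE => /predU1P[->|/hm]; last exact: integral_shape_widen.
by rewrite mulnC; exact: integral_shape_widen.
Qed.

End CommonDenominator.

Section Hensel.
Variables (R : realType) (m n : nat).
Hypothesis m_gt0 : (0 < m)%N.
Local Notation K := (puiseux R).
Local Notation cst := (@puiseux_const R).
Local Notation X := ('I_n -> K).
Implicit Types (u v : X -> K) (x y : X) (c d : 'I_n -> R[i]) (h : R[i]).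

Lemma contracting_ext u v : u =1 v -> contracting m u -> contracting m v.
Proof. by move=> /funext ->. Qed.

Lemma nonexpanding_ext u v : u =1 v -> nonexpanding m u -> nonexpanding m v.
Proof. by move=> /funext ->. Qed.

Lemma contracting0 : contracting m (fun _ : X => 0 : K).
Proof. by apply: contracting_const => //; exact: infinitesimal0. Qed.

Lemma contracting_sum (I : eqType) (l : seq I) (F : I -> X -> K) :
  (forall i, i \in l -> contracting m (F i)) -> contracting m (fun x => \sum_(i <- l) F i x).
Proof.
elim: l => [_|i l ih h].
  by apply: contracting_ext contracting0 => x; rewrite big_nil.
apply: (@contracting_ext (fun x => F i x + \sum_(j <- l) F j x)) => [x|].
  by rewrite big_cons.
apply: contractingD => //; first by apply: h; rewrite mem_head.
by apply: ih => j jl; apply: h; rewrite inE jl orbT.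
Qed.

Definition linear c x : K := \sum_(j < n) cst (c j) * x j.

Lemma nonexpanding_linear c : nonexpanding m (linear c).
Proof.
rewrite /linear; elim: (index_enum _) => [|i l ih].
  by apply: nonexpanding_ext (contracting_nonexpanding m_gt0 contracting0) => x; rewrite big_nil.
apply: (@nonexpanding_ext (fun x => cst (c i) * x i + \sum_(j <- l) cst (c j) * x j)) => [x|].
  by rewrite big_cons.
by apply: nonexpandingD => //; apply: nonexpandingZ => //; exact: nonexpanding_coord.
Qed.

(** A first order expansion: [h] is the value and [c] the gradient at the origin and [t = 0], and
    the remainder is contracting. *)
Definition near_linear h c u := contracting m (fun x => u x - (cst h + linear c x)).

Lemma approx_ext h c u v : u =1 v -> near_linear h c u -> near_linear h c v.
Proof. by move=> /funext ->. Qed.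

Lemma approx_const (a : K) : integral_shape m a -> near_linear (a 0) (fun=> 0) (fun=> a).
Proof.
move=> sa; apply: (@contracting_ext (fun=> a - cst (a 0))) => [x|].
  by rewrite /linear big1 ?addr0// => j _; rewrite cst0 mul0r.
apply: contracting_const => //; split; first by apply: shapeB => //; exact: shape_cst.
by rewrite pcoefB coef_cst eqxx subrr.
Qed.

Lemma approx_coord k : near_linear 0 (fun j => (j == k)%:R) (fun x => x k).
Proof.
apply: contracting_ext contracting0 => x.
rewrite /linear (bigD1 k)//= eqxx cst1 mul1r big1 ?addr0; last first.
  by move=> j /negbTE ->; rewrite cst0 mul0r.
by rewrite cst0 add0r subrr.
Qed.

Lemma linearD c d x : linear (fun j => c j + d j) x = linear c x + linear d x.
Proof. by rewrite /linear -big_split; apply: eq_bigr => j _; rewrite cstD mulrDl. Qed.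

Lemma linearZ h c x : linear (fun j => h * c j) x = cst h * linear c x.
Proof. by rewrite /linear mulr_sumr; apply: eq_bigr => j _; rewrite cstM mulrA. Qed.

Lemma approxD h c u h' c' v : near_linear h c u -> near_linear h' c' v ->
  near_linear (h + h') (fun j => c j + c' j) (fun x => u x + v x).
Proof.
move=> au av; apply: contracting_ext (contractingD m_gt0 au av) => x.
by rewrite linearD cstD; ring.
Qed.

Lemma approxM h c u h' c' v : near_linear h c u -> near_linear h' c' v ->
  near_linear (h * h') (fun j => h * c' j + h' * c j) (fun x => u x * v x).
Proof.
move=> au av; pose ru x := u x - (cst h + linear c x); pose rv x := v x - (cst h' + linear c' x).
have lu := nonexpandingD m_gt0 (nonexpanding_linear c) (contracting_nonexpanding m_gt0 au).
have lv := nonexpandingD m_gt0 (nonexpanding_linear c') (contracting_nonexpanding m_gt0 av).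
(* With [u = h + U] and [v = h' + V], the remainder is [U * V + h * rv + h' * ru], and [U], [V] are
   nonexpanding. *)
have := contractingD m_gt0 (contractingM m_gt0 lu lv)
  (contractingD m_gt0 (contractingZ m_gt0 h av) (contractingZ m_gt0 h' au)).
apply: contracting_ext => x; rewrite linearD !linearZ cstM; ring.
Qed.

Lemma approx_sum (I : eqType) (l : seq I) (h : I -> R[i]) (c : I -> 'I_n -> R[i]) (F : I -> X -> K) :
  (forall i, i \in l -> near_linear (h i) (c i) (F i)) ->
  near_linear (\sum_(i <- l) h i) (fun j => \sum_(i <- l) c i j) (fun x => \sum_(i <- l) F i x).
Proof.
move=> aF; apply: contracting_ext (contracting_sum aF) => x.
rewrite sumrB big_split/= cst_sum; congr (_ - (_ + _)).
rewrite /linear exchange_big; apply: eq_bigr => j _.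
by rewrite cst_sum mulr_suml.
Qed.

Lemma approx1 : near_linear 1 (fun=> 0) (fun=> 1).
Proof.
apply: contracting_ext contracting0 => x.
by rewrite /linear big1 ?addr0 ?cst1 ?subrr// => j _; rewrite cst0 mul0r.
Qed.

Lemma approx_eq h c h' c' u : h = h' -> c =1 c' -> near_linear h c u -> near_linear h' c' u.
Proof. by move=> -> /funext ->. Qed.

Lemma approxX c u k : near_linear 1 c u -> near_linear 1 (fun j => k%:R * c j) (fun x => u x ^+ k).
Proof.
move=> au; elim: k => [|k ih].
  by apply: approx_eq (approx1) => // j; rewrite mul0r.
apply: (@approx_ext _ _ (fun x => u x * u x ^+ k)) => [x|]; first by rewrite exprS.
apply: approx_eq (approxM au ih) => [|j]; first by rewrite mulr1.
by rewrite !mul1r -natr1 mulrDl mul1r.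
Qed.

Lemma approx_prod (I : eqType) (l : seq I) (c : I -> 'I_n -> R[i]) (F : I -> X -> K) :
  (forall i, near_linear 1 (c i) (F i)) ->
  near_linear 1 (fun j => \sum_(i <- l) c i j) (fun x => \prod_(i <- l) F i x).
Proof.
move=> aF; elim: l => [|i l ih].
  by apply: approx_ext (approx_eq _ _ approx1) => // x; rewrite big_nil.
apply: (@approx_ext _ _ (fun x => F i x * \prod_(j <- l) F j x)) => [x|]; first by rewrite big_cons.
apply: approx_eq (approxM (aF i) ih) => [|j]; first by rewrite mulr1.
by rewrite !mul1r big_cons addrC.
Qed.

(** Newton iteration with the Jacobian frozen at [J]: the fixed points of [x - J^-1 * G x] are the
    zeros of [G]. Written with the remainders of [G], as [psi] is, the map is contracting. *)
Theorem hensel (J : 'M[R[i]]_n) (G : 'I_n -> X -> K) : J \in unitmx ->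
  (forall k, near_linear 0 (J k) (G k)) -> exists2 x, dom m x & forall k, G k x = 0.
Proof.
move=> Ju aG; pose psi k x := \sum_(j < n) cst (- invmx J k j) * (G j x - (cst 0 + linear (J j) x)).
have cpsi k : contracting m (psi k).
  by apply: contracting_sum => j _; apply: contractingZ => //; exact: aG.
have [x dx xpsi] := contracting_fixed_point m_gt0 cpsi; exists x => //.
have xE k : \sum_(j < n) cst (invmx J k j) * G j x = 0.
  have : x k = x k - \sum_(j < n) cst (invmx J k j) * G j x.
    rewrite {1}xpsi /psi.
    under eq_bigr do rewrite cst0 add0r mulrBr cstN !mulNr opprK.
    rewrite big_split/= sumrN addrC; congr (_ - _).
    rewrite /linear; under eq_bigr do rewrite mulr_sumr.
    rewrite exchange_big/=; under eq_bigr do under eq_bigr do rewrite mulrA -cstM.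
    under eq_bigr do rewrite -mulr_suml -cst_sum.
    have iE i : \sum_(j < n) invmx J k j * J j i = (k == i)%:R.
      by have := congr1 (fun A : 'M[R[i]]_n => A k i) (mulVmx Ju); rewrite !mxE.
    under eq_bigr do rewrite iE.
    rewrite (bigD1 k)//= eqxx cst1 mul1r big1 ?addr0// => j jk.
    by rewrite eq_sym (negbTE jk) cst0 mul0r.
  by move/eqP; rewrite -subr_eq0 opprB addrC subrK => /eqP.
move=> k; have : \sum_(i < n) cst (J k i) * (\sum_(j < n) cst (invmx J i j) * G j x) = 0.
  by rewrite big1// => i _; rewrite xE mulr0.
under eq_bigr do rewrite mulr_sumr.
rewrite exchange_big/=; under eq_bigr do under eq_bigr do rewrite mulrA -cstM.
under eq_bigr do rewrite -mulr_suml -cst_sum.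
have iE i : \sum_(j < n) J k j * invmx J j i = (k == i)%:R.
  by have := congr1 (fun A : 'M[R[i]]_n => A k i) (mulmxV Ju); rewrite !mxE.
under eq_bigr do rewrite iE.
rewrite (bigD1 k)//= eqxx cst1 mul1r big1 ?addr0// => j jk.
by rewrite eq_sym (negbTE jk) cst0 mul0r.
Qed.

End Hensel.

(** * Genericity of rapidly growing sequences *)

Section LinearSystems.
Variables (F : fieldType) (T : eqType) (s : seq T) (k : nat).
Hypothesis s_uniq : uniq s.
Implicit Types (c : 'I_k -> T -> F).

Let extend (v : 'rV[F]_(size s)) (w : T) : F :=
  if insub (index w s) is Some i then v 0 i else 0.

Let extendE v w0 (i : 'I_(size s)) : extend v (nth w0 s i) = v 0 i.
Proof. by rewrite /extend index_uniq// valK. Qed.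

Let extend_out v w : w \notin s -> extend v w = 0.
Proof. by rewrite /extend -index_mem => ws; rewrite insubN. Qed.

Let sum_nth w0 (f : T -> F) : \sum_(w <- s) f w = \sum_(i < size s) f (nth w0 s i).
Proof. by rewrite (big_nth w0) big_mkord. Qed.

Lemma underdetermined c : (k < size s)%N -> exists x : T -> F,
  [/\ exists2 w, w \in s & x w != 0, forall w, w \notin s -> x w = 0 &
      forall j, \sum_(w <- s) c j w * x w = 0].
Proof.
move=> ks; have [w0 w0s] : exists w0, w0 \in s.
  by case: (s) ks => // w0 s' _; exists w0; rewrite mem_head.
pose A := \matrix_(i < size s, j < k) c j (nth w0 s i).
have : kermx A != 0.
  rewrite kermx_eq0 /row_free; apply/eqP => rA.
  by have := rank_leq_col A; rewrite rA leqNgt ks.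
case/rowV0Pn => v /sub_kermxP vA v0; exists (extend v); split=> [|w|j].
- have [i vi] : exists i, v 0 i != 0.
    apply: contrapT => nv; move/eqP: v0; apply; apply/rowP => i; rewrite mxE.
    by apply: contrapT => vi; apply: nv; exists i; exact/eqP.
  by exists (nth w0 s i); rewrite ?mem_nth ?extendE.
- exact: extend_out.
- have := congr1 (fun B : 'rV[F]_k => B 0 j) vA; rewrite !mxE => vAj.
  rewrite (sum_nth w0) -[RHS]vAj; apply: eq_bigr => i _.
  by rewrite extendE mxE mulrC.
Qed.

Lemma orthogonal_span c (mu : T -> F) :
  (forall psi, (forall j, \sum_(w <- s) c j w * psi w = 0) ->
     \sum_(w <- s) mu w * psi w = 0) ->
  exists phi, forall w, w \in s -> mu w = \sum_(j < k) phi j * c j w.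
Proof.
move=> h; have [s0|[w0 w0s]] : (forall w, w \notin s) \/ exists w0, w0 \in s.
- by case: (s) => [|w0 s']; [left|right; exists w0; rewrite mem_head].
- by exists (fun=> 0) => w; rewrite (negbTE (s0 w)).
pose A := \matrix_(j < k, i < size s) c j (nth w0 s i).
pose m := \row_(i < size s) mu (nth w0 s i).
have : (m <= A)%MS.
  rewrite submxE; apply/eqP/rowP => l; rewrite !mxE.
  have := h (extend (col l (cokermx A))^T); rewrite (sum_nth w0) => hl.
  rewrite -[RHS]hl; first by apply: eq_bigr => i _; rewrite extendE !mxE.
  move=> j; have := congr1 (fun B : 'M[F]_(k, size s) => B j l) (mulmx_coker A).
  rewrite !mxE => Aj; rewrite (sum_nth w0) -[RHS]Aj.
  by apply: eq_bigr => i _; rewrite extendE !mxE.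
case/submxP => D mD; exists (D 0) => w ws.
have ws' : (index w s < size s)%N by rewrite index_mem.
have := congr1 (fun B : 'rV[F]_(size s) => B 0 (Ordinal ws')) mD.
rewrite !mxE nth_index// => ->; apply: eq_bigr => j _.
by rewrite !mxE /= nth_index.
Qed.

End LinearSystems.

Lemma injective_unitmx (F : fieldType) n (J : 'M[F]_n) :
  (forall u : 'cV[F]_n, J *m u = 0 -> u = 0) -> J \in unitmx.
Proof.
move=> Jinj; rewrite -unitmx_tr -row_free_unit -kermx_eq0.
apply/rowV0P => v /sub_kermxP vJ; apply: trmx_inj; rewrite trmx0; apply: Jinj.
by rewrite -[J]trmxK -trmx_mul vJ trmx0.
Qed.

Section Growth.
Variable N : nat.
Implicit Types (M : 'I_N -> rat) (kappa : rat).

Lemma growthW kappa kappa' M : kappa <= kappa' -> growth kappa' M -> growth kappa M.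
Proof. by move=> kk [M0 M1]; split=> [i /M0|i j /M1]; exact: le_lt_trans. Qed.

Lemma growth_lt kappa M : 1 <= kappa -> growth kappa M ->
  (forall i, 0 < M i) /\ forall i j : 'I_N, (j < i)%N -> kappa * M j < M i.
Proof.
move=> k1 [M0 M1]; have k0 : 0 < kappa by lra.
have key l : forall i : 'I_N, i = l :> nat ->
    0 < M i /\ forall j : 'I_N, (j < i)%N -> kappa * M j < M i.
  elim: l => [i i0|l ih i il]; first by split=> [|j]; [rewrite (lt_trans k0)// M0|rewrite i0].
  have lN : (l < N)%N by rewrite (leq_trans _ (ltn_ord i))// il.
  have [Ml0 Ml] := ih (Ordinal lN) erefl.
  have := M1 (Ordinal lN) i il; rewrite ltr_pdivlMr// => kMl.
  split=> [|j]; first by rewrite (lt_trans _ kMl)// mulr_gt0.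
  rewrite il ltnS leq_eqVlt => /predU1P[jl|jl].
    by have -> : j = Ordinal lN by exact: val_inj.
  by apply: (lt_trans (Ml j jl)); apply: le_lt_trans kMl; rewrite ler_peMl// ltW.
by split=> i; have [] := key i i erefl.
Qed.

(** The term of the last nonzero coefficient dominates all earlier ones once the ratios of the [M i]
    exceed the sum of the absolute coefficients divided by its own. *)
Lemma growth_combination_neq0 (R : realType) (phi : 'I_N -> R) : (exists i, phi i != 0) ->
  exists2 kappa, 1 <= kappa & forall M, growth kappa M -> \sum_(i < N) phi i * ratr (M i) != 0.
Proof.
move=> [i0 phi0]; case: (@arg_maxnP _ i0 (fun i => phi i != 0) val phi0) => i phii imax.
pose S := \sum_(j < N) `|phi j|; have S0 : 0 <= S by exact: sumr_ge0.
pose x := 1 + S / `|phi i|; have phii0 : 0 < `|phi i| by rewrite normr_gt0.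
have x0 : 0 <= x by rewrite addr_ge0// divr_ge0// ltW.
have x1 : 1 <= x by rewrite lerDl divr_ge0// ltW.
have xb := archi_boundP x0; set k := Num.bound x in xb.
have k1 : (1 : rat) <= k%:R by rewrite ler1n -(ltr0n R) (lt_trans _ xb)// (lt_le_trans ltr01).
exists k%:R => // M gM; have [M0 Mlt] := growth_lt k1 gM; apply/eqP => s0.
have Mi0 : 0 < ratr (M i) :> R by rewrite ltr0q.
have : k%:R * `|phi i| * ratr (M i) <= S * ratr (M i).
  rewrite -mulrA -{1}(gtr0_norm Mi0) -normrM.
  have -> : phi i * ratr (M i) = - \sum_(j < N | j != i) phi j * ratr (M j).
    by move: s0; rewrite (bigD1 i)//= => /eqP; rewrite addr_eq0 => /eqP.
  rewrite normrN; apply: (@le_trans _ _ (k%:R * \sum_(j < N | j != i) `|phi j * ratr (M j)|)).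
    by rewrite ler_wpM2l ?ler0n// ler_norm_sum.
  apply: (@le_trans _ _ (\sum_(j < N | j != i) `|phi j| * ratr (M i))).
    rewrite mulr_sumr; apply: ler_sum => j ji.
    have [->|phij] := eqVneq (phi j) 0; first by rewrite mul0r normr0 mul0r mulr0.
    have lji : (j < i)%N.
      by rewrite ltn_neqAle; apply/andP; split; [exact: ji|exact: imax].
    rewrite normrM mulrCA ler_wpM2l// gtr0_norm ?ltr0q//.
    have -> : (k%:R : R) = ratr k%:R by rewrite ratr_nat.
    by rewrite -rmorphM/= ler_rat ltW// Mlt.
  rewrite -mulr_suml ler_wpM2r ?(ltW Mi0)//.
  by rewrite /S [leRHS](bigD1 i)//= lerDr.
rewrite ler_pM2r//; apply/negP; rewrite -ltNge -ltr_pdivrMr//.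
by apply: lt_trans xb; rewrite /x ltrDr.
Qed.

Lemma common_kappa (Q : eqType) (l : seq Q) (P : Q -> rat -> Prop) :
  (forall q kappa kappa', kappa <= kappa' -> P q kappa -> P q kappa') ->
  (forall q, q \in l -> exists2 kappa, 1 <= kappa & P q kappa) ->
  exists2 kappa, 1 <= kappa & forall q, q \in l -> P q kappa.
Proof.
move=> Pm; elim: l => [|q l ih] h; first by exists 1.
have [|k k1 kP] := ih; first by move=> q' ql; apply: h; rewrite inE ql orbT.
have [|k' k'1 k'P] := h q; first exact: mem_head.
exists (Num.max k k'); first by rewrite le_max k1.
move=> q'; rewrite inE => /predU1P[->|/kP].
  by apply: (Pm _ k') => //; rewrite le_max lexx orbT.
by apply: (Pm _ k); rewrite le_max lexx.
Qed.

Variables (R : realType) (T : choiceType) (A : {fset T}) (h : T -> rat).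
Implicit Types (u : 'I_N -> T) (e mu : T -> R).

(* [u i] and [u' i] are the ends of the [i]-th edge of a graph on [A]; [e] plays
   the role of the exponents [nu_S], whose slope along that edge is [M i]. *)
Definition edge_compatible M u (u' : 'I_N -> T) e :=
  forall i, e (u' i) - e (u i) = ratr (M i) * ratr (h (u' i) - h (u i)).

Definition edge_constant (V : Type) u (u' : 'I_N -> T) (psi : T -> V) := forall i, psi (u i) = psi (u' i).

Definition edge_orthogonal u (u' : 'I_N -> T) mu :=
  forall psi : T -> R, edge_constant u u' psi -> \sum_(w <- A) mu w * psi w = 0.

(** By double orthogonality [mu] is a combination, with coefficients [phi i], of differences of
    indicators at the ends of edges; its pairing with [e] is a linear form in the [M i] with
    coefficients [phi i * (h (u' i) - h (u i))]. *)
Lemma edge_orthogonal_neq0 u u' mu : (forall i, u i \in A) -> (forall i, u' i \in A) ->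
  (forall i, h (u i) != h (u' i)) ->
  edge_orthogonal u u' mu -> (exists2 w, w \in A & mu w != 0) ->
  exists2 kappa, 1 <= kappa & forall M e, growth kappa M ->
    edge_compatible M u u' e -> \sum_(w <- A) mu w * e w != 0.
Proof.
move=> uA u'A hu omu [w wA muw].
have sum1 (f : T -> R) x : x \in A -> \sum_(w <- A) (w == x)%:R * f w = f x.
  move=> xA; rewrite (big_fsetD1 x)//= eqxx mul1r big1_seq ?addr0// => y /=.
  by rewrite !inE => /andP[/negbTE -> _]; rewrite mul0r.
have sumE i (f : T -> R) : \sum_(w <- A) ((w == u' i)%:R - (w == u i)%:R) * f w = f (u' i) - f (u i).
  by under eq_bigr do rewrite mulrBl; rewrite sumrB !sum1.
have [|phi phiE] := @orthogonal_span R T A N (fset_uniq A)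
    (fun i w => (w == u' i)%:R - (w == u i)%:R) mu.
  by move=> psi hpsi; apply: omu => i; apply/esym/eqP; rewrite -subr_eq0 -sumE hpsi.
have [|k k1 kM] := @growth_combination_neq0 R (fun i => phi i * ratr (h (u' i) - h (u i))).
  apply: contrapT => nphi; move/eqP: muw; apply; rewrite phiE// big1// => i _.
  have [->|phii] := eqVneq (phi i) 0; first by rewrite mul0r.
  by case: nphi; exists i; rewrite mulf_neq0// fmorph_eq0 subr_eq0 eq_sym.
exists k => // M e gM ce.
have -> : \sum_(w <- A) mu w * e w =
    \sum_(i < N) phi i * ratr (h (u' i) - h (u i)) * ratr (M i); last exact: kM.
have -> : \sum_(w <- A) mu w * e w =
    \sum_(w <- A) \sum_(i < N) phi i * (((w == u' i)%:R - (w == u i)%:R) * e w).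
  apply: eq_big_seq => x xA; rewrite phiE// mulr_suml.
  by apply: eq_bigr => i _; rewrite mulrA.
rewrite exchange_big/=; apply: eq_bigr => i _.
by rewrite -mulr_sumr sumE ce [ratr (M i) * _]mulrC mulrA.
Qed.

(** For each [q] and each graph, either [W q] has no edge-orthogonal vector that is nonzero on [A],
    or one such vector is fixed and a large [kappa] prevents [e] from annihilating it, so that the
    hypothesis on [W q] fails. The cases are finite in number although [W q] may be infinite. *)
Theorem generic_growth (Q : eqType) (l : seq Q) (W : Q -> set (T -> R)) :
  exists2 kappa, 1 <= kappa & forall M, growth kappa M -> forall u u' e,
    (forall i, u i \in A) -> (forall i, u' i \in A) -> (forall i, h (u i) != h (u' i)) ->
    edge_compatible M u u' e -> forall q, q \in l ->
    (forall mu, W q mu -> \sum_(w <- A) mu w * e w = 0) ->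
    forall mu, W q mu -> edge_orthogonal u u' mu -> forall w, w \in A -> mu w = 0.
Proof.
pose E := {ffun 'I_N -> A}; pose l' := [seq (q, E1) | q <- l, E1 <- enum {: E * E}].
pose v (f : E) i : T := val (f i).
pose P (q : Q * (E * E)) kappa := forall M, growth kappa M -> forall e,
  (forall i, h (v q.2.1 i) != h (v q.2.2 i)) -> edge_compatible M (v q.2.1) (v q.2.2) e ->
  (forall mu, W q.1 mu -> \sum_(w <- A) mu w * e w = 0) ->
  forall mu, W q.1 mu -> edge_orthogonal (v q.2.1) (v q.2.2) mu -> forall w, w \in A -> mu w = 0.
have [|[q [U U']] _|k k1 kP] := @common_kappa _ l' P.
- by move=> q k k' kk' Pq M /(growthW kk'); exact: Pq.
- have [hU|nhU] := pselect (forall i, h (v U i) != h (v U' i)); last by exists 1.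
  have [[mu [Wmu omu muA]]|nmu] := pselect (exists mu, [/\ W q mu,
      edge_orthogonal (v U) (v U') mu & exists2 w, w \in A & mu w != 0]); last first.
    exists 1 => // M _ e _ _ _ mu Wmu omu w wA; apply: contrapT => muw; apply: nmu.
    by exists mu; split=> //; exists w => //; exact/eqP.
  have [k k1 kM] := edge_orthogonal_neq0 (fun i => valP (U i)) (fun i => valP (U' i)) hU omu muA.
  by exists k => // M gM e _ ce We mu' _ _ w _; have := kM _ _ gM ce; rewrite We ?eqxx.
exists k => // M gM u u' e uA u'A hu ce q ql We mu Wmu omu.
pose U : E := [ffun i => [` uA i]%fset]; pose U' : E := [ffun i => [` u'A i]%fset].
have vU : v U = u by apply/funext => i; rewrite /v ffunE.
have vU' : v U' = u' by apply/funext => i; rewrite /v ffunE.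
have qU : (q, (U, U')) \in l' by apply: allpairs_f; rewrite ?mem_enum.
have := kP _ qU M gM e; rewrite /= vU vU' => /(_ hu ce We mu Wmu omu); exact.
Qed.

End Growth.

(** * The forest of tied monomials *)

Section Forest.
Variables (T : choiceType) (A : {fset T}) (h : T -> rat) (N : nat) (u u' : 'I_N -> T).
Hypothesis uA : forall i, u i \in A.
Hypothesis u'A : forall i, u' i \in A.
Hypothesis h_edge : forall i, h (u i) < h (u' i).
Hypothesis h_chain : forall i j : 'I_N, (i < j)%N -> h (u' i) <= h (u j).
Hypothesis cardA : #|` A| = N.+2.

Lemma h_source_lt (i j : 'I_N) : (i < j)%N -> h (u i) < h (u j).
Proof. by move=> ij; exact: lt_le_trans (h_edge i) (h_chain ij). Qed.

Lemma source_inj : injective u.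
Proof.
move=> i j uij; apply/val_inj; have [/h_source_lt|/h_source_lt|//] := ltngtP i j;
  by rewrite uij ltxx.
Qed.

(* The sources of the edges are distinct, so all but two vertices are sources. *)
Lemma two_roots : exists r1 r2, [/\ r1 \in A, r2 \in A, r1 != r2,
  forall i, (u i != r1) /\ (u i != r2) &
  forall x, x \in A -> (exists i, x = u i) \/ x = r1 \/ x = r2].
Proof.
pose S := [fset u i | i : 'I_N]%fset; pose B := (A `\` S)%fset.
have SA : (S `<=` A)%fset by apply/fsubsetP => x /imfsetP[i _ ->].
have cS : #|` S| = N by rewrite card_imfset ?size_enum_ord//; exact: source_inj.
have cB : #|` B| = 2%N.
  by rewrite /B cardfsD (fsetIidPr SA) cS cardA -addn2 addKn.
have Bu : uniq B by exact: fset_uniq.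
have [r1 [r2 Bs]] : exists r1 r2, (B : seq T) = [:: r1; r2].
  by move: cB; case: (B : seq T) => [|r1 [|r2 [|? ?]]]// _; exists r1, r2.
have BE x : (x \in B) = (x == r1) || (x == r2).
  by have -> : (x \in B) = (x \in (B : seq T)) by []; rewrite Bs !inE.
have r1B : r1 \in B by rewrite BE eqxx.
have r2B : r2 \in B by rewrite BE eqxx orbT.
move: (r1B) (r2B); rewrite !inE => /andP[r1S r1A] /andP[r2S r2A].
exists r1, r2; split=> //.
- by move: Bu; rewrite Bs /= inE => /andP[].
- have uS i : u i \in S by apply/imfsetP; exists i.
  by move=> i; split; [apply: contraNneq r1S => <-|apply: contraNneq r2S => <-].
- move=> x xA; have [/imfsetP[i _ ->]|xS] := boolP (x \in S); first by left; exists i.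
  right; have : x \in B by rewrite !inE xS.
  by rewrite BE => /orP[] /eqP; [left|right].
Qed.

(** Each edge leads from a source to a point of greater height, which is a root or a later source;
    following the edges carries the common value of the roots to every point. *)
Lemma edge_constantP (V : Type) (psi : T -> V) (c : V) r1 r2 :
  (forall x, x \in A -> (exists i, x = u i) \/ x = r1 \/ x = r2) ->
  edge_constant u u' psi -> psi r1 = c -> psi r2 = c -> forall x, x \in A -> psi x = c.
Proof.
move=> root cpsi psi1 psi2; clear cardA uA.
have key l (i : 'I_N) : (N - i <= l)%N -> psi (u i) = c.
  elim: l i => [i|l ih i Nil]; first by rewrite leqn0 subn_eq0 leqNgt ltn_ord.
  rewrite cpsi; have [[j uj]|[->//|->//]] := root _ (u'A i).
  rewrite uj ih//; have ij : (i < j)%N; last by have := ltn_ord j; lia.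
  have := h_edge i; rewrite uj; apply: contraTT; rewrite -leqNgt -leNgt leq_eqVlt.
  by case/predU1P => [/val_inj ->//|/h_source_lt/ltW].
by move=> x /root[[i ->]|[->|->]]//; exact: key (leqnn _).
Qed.

(** The edge conditions and vanishing at [r1] are [N + 1] equations in [N + 2] unknowns, and a
    nonzero solution cannot vanish at [r2] as well. *)
Lemma edge_function (F : fieldType) r1 r2 : r1 \in A -> r2 \in A -> r1 != r2 ->
  (forall x, x \in A -> (exists i, x = u i) \/ x = r1 \/ x = r2) ->
  exists chi : T -> F, [/\ edge_constant u u' chi, chi r1 = 0 & chi r2 = 1].
Proof.
move=> r1A r2A r12 root.
pose c (i : 'I_N.+1) w : F := if unlift ord0 i is Some j then (w == u j)%:R - (w == u' j)%:R
  else (w == r1)%:R.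
have sum1 (f : T -> F) x : x \in A -> \sum_(w <- A) (w == x)%:R * f w = f x.
  move=> xA; rewrite (big_fsetD1 x)//= eqxx mul1r big1_seq ?addr0// => y /=.
  by rewrite !inE => /andP[/negbTE -> _]; rewrite mul0r.
have [|x [[w wA xw] _ cx]] := @underdetermined F T A N.+1 (fset_uniq A) c.
  by have -> : size A = N.+2 by exact: cardA.
have x1 : x r1 = 0 by have := cx ord0; rewrite /c unlift_none sum1.
have ex : edge_constant u u' x.
  move=> i; have := cx (lift ord0 i); rewrite /c liftK.
  under eq_bigr do rewrite mulrBl.
  by rewrite sumrB !sum1// => /eqP; rewrite subr_eq0 => /eqP.
have x2 : x r2 != 0.
  by apply/eqP => x2; move/eqP: xw; apply; apply: edge_constantP root ex x1 x2 _ wA.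
exists (fun w => x w / x r2); split; first by move=> i; rewrite ex.
- by rewrite x1 mul0r.
- by rewrite divff.
Qed.

End Forest.

(** * Affine relations among lattice points *)

Section Relations.
Variables (F : fieldType) (A : {fset 'rV[int]_3}).
Implicit Types (B : {fset 'rV[int]_3}) (mu : 'rV[int]_3 -> F) (w : 'rV[int]_3).

Definition affine_form (y : 'I_3 -> F) (c : F) w := \sum_(j < 3) y j * (w 0 j)%:~R + c.

Definition spanning B := forall y c, (forall w, w \in B -> affine_form y c w = 0) ->
  (forall j, y j = 0) /\ c = 0.

(** Relations are extended by zero to [A], so that those of different cells can be added. *)
Definition relation B mu := [/\ forall w, w \notin B -> mu w = 0,
  \sum_(w <- A) mu w = 0 & forall j, \sum_(w <- A) mu w * (w 0 j)%:~R = 0].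

Lemma relation_affine B mu y c : relation B mu ->
  \sum_(w <- A) mu w * affine_form y c w = 0.
Proof.
move=> [_ mu0 muj]; under eq_bigr do rewrite mulrDr mulr_sumr.
rewrite big_split/= -mulr_suml mu0 mul0r addr0 exchange_big big1// => j _.
under eq_bigr do rewrite mulrCA.
by rewrite -mulr_sumr muj mulr0.
Qed.

Lemma relationW B B' mu : (B `<=` B')%fset -> relation B mu -> relation B' mu.
Proof.
move=> /fsubsetP BB' [s0 s1 s2]; split=> // w wB'; apply: s0.
by apply: contra wB'; exact: BB'.
Qed.

Lemma relation0 B : relation B (fun=> 0).
Proof. by split=> [//||j]; rewrite big1// => w _; rewrite mul0r. Qed.

Lemma relationD B mu mu' : relation B mu -> relation B mu' ->
  relation B (fun w => mu w + mu' w).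
Proof.
move=> [s0 s1 s2] [t0 t1 t2]; split=> [w wB||j]; first by rewrite s0// t0// addr0.
  by rewrite big_split/= s1 t1 addr0.
by under eq_bigr do rewrite mulrDl; rewrite big_split/= s2 t2 addr0.
Qed.

Lemma relationZ B mu c : relation B mu -> relation B (fun w => c * mu w).
Proof.
move=> [s0 s1 s2]; split=> [w wB||j]; first by rewrite s0// mulr0.
  by rewrite -mulr_sumr s1 mulr0.
by under eq_bigr do rewrite -mulrA; rewrite -mulr_sumr s2 mulr0.
Qed.

Lemma sum_indicator (f : 'rV[int]_3 -> F) w : w \in A ->
  \sum_(x <- A) (x == w)%:R * f x = f w.
Proof.
move=> wA; rewrite (big_fsetD1 w)//= eqxx mul1r big1_seq ?addr0// => y /=.
by rewrite !inE => /andP[/negbTE -> _]; rewrite mul0r.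
Qed.

(** No nonzero affine function vanishes on [C], so by double orthogonality the vector [(1, w)] is a
    combination of the vectors [(1, x)] with [x] in [C]. *)
Lemma spanning_combination C w : (C `<=` A)%fset -> spanning C -> w \in A -> w \notin C ->
  exists2 mu, relation (w |` C)%fset mu & mu w = 1.
Proof.
move=> CA sC wA wC.
pose cd (x : 'rV[int]_3) (l : 'I_4) : F := if unlift ord0 l is Some j then (x 0 j)%:~R else 1.
pose pt (j : 'I_#|` C|) := nth w C j.
have ptC j : pt j \in C by rewrite /pt mem_nth.
have [|phi phiE] := @orthogonal_span F _ (enum 'I_4) #|` C| (enum_uniq _) (fun j => cd (pt j)) (cd w).
  move=> psi hpsi; have [|y0 c0] := sC (fun j => psi (lift ord0 j)) (psi ord0).
    move=> x xC; have xC' : (index x C < #|` C|)%N by rewrite index_mem.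
    have := hpsi (Ordinal xC'); rewrite big_enum/= big_ord_recl /cd unlift_none mul1r.
    rewrite /pt/= nth_index// addrC => <-; congr (_ + _); apply: eq_bigr => j _.
    by rewrite liftK mulrC.
  rewrite big_enum/= big_ord_recl c0 mulr0 add0r big1// => j _.
  by rewrite y0 mulr0.
pose k x := \sum_(j < #|` C|) phi j * (x == pt j)%:R.
have kE f : \sum_(x <- A) k x * f x = \sum_(j < #|` C|) phi j * f (pt j).
  under eq_bigr do rewrite mulr_suml.
  rewrite exchange_big/=; apply: eq_bigr => j _.
  under eq_bigr do rewrite -mulrA.
  by rewrite -mulr_sumr sum_indicator// (fsubsetP CA).
have k0 x : x \notin C -> k x = 0.
  move=> xC; rewrite /k big1// => j _; rewrite (_ : x == pt j = false) ?mulr0//.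
  by apply: contraNF xC => /eqP ->.
exists (fun x => (x == w)%:R - k x); last by rewrite eqxx k0// subr0.
split=> [x||j].
- by rewrite !inE negb_or => /andP[/negbTE -> xC]; rewrite k0// subr0.
- rewrite sumrB; under eq_bigr do rewrite -[_%:R]mulr1.
  rewrite (sum_indicator (fun=> 1))//; under [X in _ - X]eq_bigr do rewrite -[k _]mulr1.
  rewrite kE; have := phiE ord0; rewrite mem_enum => /(_ isT).
  by rewrite /cd unlift_none => {1}->; rewrite subrr.
- under eq_bigr do rewrite mulrBl.
  rewrite sumrB (sum_indicator (fun x => (x 0 j)%:~R))// kE.
  have := phiE (lift ord0 j); rewrite mem_enum => /(_ isT).
  by rewrite /cd liftK => ->; rewrite subrr.
Qed.

End Relations.

Definition height (v : 'rV[rat]_3) (w : 'rV[int]_3) : rat := \sum_(j < 3) (w 0 j)%:~R * v 0 j.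

(** * The growth constant *)

Section Genericity.
Variables (R : realType) (A : {fset 'rV[int]_3}) (N : nat) (v : 'rV[rat]_3).
Local Notation h := (height v).
Implicit Types (B C : {fset 'rV[int]_3}) (u : 'I_N -> 'rV[int]_3) (e : 'rV[int]_3 -> rat)
  (mu : 'rV[int]_3 -> R) (w : 'rV[int]_3).

(** Affine relations among the heights. On monomials tied at a marked point the exponents are affine
    in the height, so such relations annihilate them. *)
Definition height_relation B mu := [/\ forall w, w \notin B -> mu w = 0,
  \sum_(w <- A) mu w = 0 & \sum_(w <- A) mu w * ratr (h w) = 0].

(* [B1] and [B2] are the lattice points of two cells, and [B3] consists of
   monomials tied at a point of the line spanned by [v]. *)
Definition no_cell_relation u (u' : 'I_N -> 'rV[int]_3) e :=
  forall B1 B2 B3, (B1 `<=` A)%fset -> (B2 `<=` A)%fset -> (B3 `<=` A)%fset ->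
  forall (y1 y2 : 'I_3 -> R) (c1 c2 : R) (m c3 : rat),
  (forall w, w \in B1 -> ratr (e w) = affine_form y1 c1 w) ->
  (forall w, w \in B2 -> ratr (e w) = affine_form y2 c2 w) ->
  (forall w, w \in B3 -> e w = m * h w + c3) ->
  forall mu1 mu2 mu3, relation A B1 mu1 -> relation A B2 mu2 -> height_relation B3 mu3 ->
  edge_orthogonal A u u' (fun w => mu1 w + mu2 w + mu3 w) ->
  forall w, w \in A -> mu1 w + mu2 w + mu3 w = 0.

(** The points [w] and [w'] lie at equal distance from the linear function of the cell. Once this
    function is subtracted from [e], only they contribute to the pairing with [mu], and the two
    contributions cancel. *)
Definition no_tie_relation u (u' : 'I_N -> 'rV[int]_3) e :=
  forall C (w w' : 'rV[int]_3), (C `<=` A)%fset -> w \in A -> w' \in A -> w \notin C -> w' \notin C -> w != w' ->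
  forall (y : 'I_3 -> R) (c : R), (forall x, x \in C -> ratr (e x) = affine_form y c x) ->
  ratr (e w) - affine_form y c w = ratr (e w') - affine_form y c w' ->
  forall mu, relation A (w |` (w' |` C))%fset mu -> mu w + mu w' = 0 ->
  edge_orthogonal A u u' mu -> forall x, x \in A -> mu x = 0.

Lemma relation_on_cell B mu e (y : 'I_3 -> R) c : relation A B mu ->
  (forall w, w \in B -> ratr (e w) = affine_form y c w) ->
  \sum_(w <- A) mu w * ratr (e w) = 0.
Proof.
move=> rmu eB; rewrite -[RHS](relation_affine y c rmu).
have [s0 _ _] := rmu; apply: eq_bigr => w _.
by have [/eB ->//|/s0 ->] := boolP (w \in B); rewrite !mul0r.
Qed.

Lemma height_relation_on_cell B mu e m c : height_relation B mu ->
  (forall w, w \in B -> e w = m * h w + c) -> \sum_(w <- A) mu w * ratr (e w) = 0.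
Proof.
move=> [s0 s1 s2] eB.
have -> : \sum_(w <- A) mu w * ratr (e w) =
    ratr m * (\sum_(w <- A) mu w * ratr (h w)) + ratr c * \sum_(w <- A) mu w.
  rewrite !mulr_sumr -big_split/=; apply: eq_bigr => w _.
  have [/eB ->|/s0 ->] := boolP (w \in B); last by rewrite !(mul0r, mulr0) addr0.
  by rewrite rmorphD rmorphM/=; ring.
by rewrite s1 s2 !mulr0 addr0.
Qed.

Lemma generic_kappa : exists2 kappa, 1 <= kappa & forall M, growth kappa M ->
  forall u u' e, (forall i, u i \in A) -> (forall i, u' i \in A) ->
  (forall i, h (u i) != h (u' i)) ->
  (forall i, e (u' i) - e (u i) = M i * (h (u' i) - h (u i))) ->
  no_cell_relation u u' e /\ no_tie_relation u u' e.
Proof.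
(* The families are indexed by supports in [A] alone; the linear functions of the cells, which vary,
   enter only through the vanishing of the pairing with [e]. *)
pose W1 (q : {fset 'rV[int]_3} * {fset 'rV[int]_3} * {fset 'rV[int]_3}) : set ('rV[int]_3 -> R) :=
  [set mu | exists mu1 mu2 mu3, [/\ relation A q.1.1 mu1, relation A q.1.2 mu2,
     height_relation q.2 mu3 & mu = (fun w => mu1 w + mu2 w + mu3 w)]].
pose W2 (q : {fset 'rV[int]_3} * ('rV[int]_3 * 'rV[int]_3)) : set ('rV[int]_3 -> R) :=
  [set mu | relation A (q.2.1 |` (q.2.2 |` q.1))%fset mu /\ mu q.2.1 + mu q.2.2 = 0].
pose P := fpowerset A : seq {fset 'rV[int]_3}; pose l1 := [seq (p, B3) | p <- [seq (B1, B2) | B1 <- P, B2 <- P], B3 <- P].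
pose l2 := [seq (C, p) | C <- P, p <- [seq (w, w') | w <- A, w' <- A]].
have [k1 k11 k1P] := generic_growth N A h l1 W1.
have [k2 k21 k2P] := generic_growth N A h l2 W2.
exists (Num.max k1 k2); first by rewrite le_max k11.
move=> M gM u u' e uA u'A hu ce.
have gM1 : growth k1 M by apply: growthW gM; rewrite le_max lexx.
have gM2 : growth k2 M by apply: growthW gM; rewrite le_max lexx orbT.
have ce' : edge_compatible h M u u' (fun w => ratr (e w) : R).
  by move=> i; rewrite -rmorphB/= ce rmorphM.
split.
- move=> B1 B2 B3 B1A B2A B3A y1 y2 c1 c2 m c3 e1 e2 e3 mu1 mu2 mu3 r1 r2 r3 omu.
  have ql : (B1, B2, B3) \in l1 by apply: allpairs_f; [apply: allpairs_f|]; rewrite fpowersetE.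
  apply: (k1P _ gM1 _ _ _ uA u'A hu ce' _ ql) omu => [mu [n1 [n2 [n3 [t1 t2 t3 ->]]]]|].
    under eq_bigr do rewrite !mulrDl; rewrite !big_split/=.
    by rewrite (relation_on_cell t1 e1) (relation_on_cell t2 e2) (height_relation_on_cell t3 e3) !addr0.
  by exists mu1, mu2, mu3.
- move=> C w w' CA wA w'A wC w'C ww' y c eC ewe mu rmu muww omu.
  have ql : (C, (w, w')) \in l2 by apply: allpairs_f; [rewrite fpowersetE|exact: allpairs_f].
  apply: (k2P _ gM2 _ _ _ uA u'A hu ce' _ ql) omu => [{muww}{}mu [/= {}rmu muww]|//].
  have -> : \sum_(x <- A) mu x * ratr (e x) = \sum_(x <- A) mu x * (ratr (e x) - affine_form y c x).
    by under [RHS]eq_bigr do rewrite mulrBr; rewrite sumrB (relation_affine y c rmu) subr0.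
  rewrite (big_fsetD1 w)//= (big_fsetD1 w')/=; last by rewrite !inE eq_sym ww'.
  rewrite big1_seq ?addr0 => [|x /=]; first by rewrite ewe -mulrDl muww mul0r.
  rewrite !inE => /and3P[xw' xw xA]; have [/eC ->|xC] := boolP (x \in C); first by rewrite subrr mulr0.
  by case: rmu => -> //; rewrite ?mul0r// !inE (negbTE xw) (negbTE xw').
Qed.

End Genericity.

(* [C] is the circuit with relation [lambda], [affine_form y b] the linear
   function of its cell, and [u i], [u' i] the extreme monomials of the tropical
   polynomial at the [i]-th marked point. *)
Record setting (R : realType) (A : {fset 'rV[int]_3}) N (v : 'rV[rat]_3) (M : 'I_N -> rat)
    (e : 'rV[int]_3 -> rat) (C : {fset 'rV[int]_3}) (lambda : 'rV[int]_3 -> R)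
    (y : 'I_3 -> rat) (b : rat) (u u' : 'I_N -> 'rV[int]_3) : Prop := {
  set_card : #|` A| = N.+2;
  set_height : {in A &, injective (height v)};
  set_edge_fst : forall i, u i \in A;
  set_edge_snd : forall i, u' i \in A;
  set_edge_lt : forall i, height v (u i) < height v (u' i);
  set_tight_fst : forall i x, x \in A ->
    M i * height v x - e x <= M i * height v (u i) - e (u i);
  set_tight_eq : forall i, M i * height v (u' i) - e (u' i) = M i * height v (u i) - e (u i);
  set_tight_between : forall i x, x \in A ->
    M i * height v x - e x = M i * height v (u i) - e (u i) ->
    height v (u i) <= height v x <= height v (u' i);
  set_incr : forall i j : 'I_N, (i < j)%N -> M i < M j;
  set_cell_generic : @no_cell_relation R A N v u u' e;
  set_tie_generic : @no_tie_relation R A N u u' e;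
  set_circuit_sub : (C `<=` A)%fset;
  set_spanning : forall F : numFieldType, spanning F C;
  set_relation : relation A C lambda;
  set_relation_neq0 : forall w, w \in C -> lambda w != 0;
  set_cell_le : forall w, w \in A -> affine_form y b w <= e w;
  set_cell_eq : forall w, w \in C -> e w = affine_form y b w }.

Arguments set_spanning [R A N v M e C lambda y b u u'] s F.

(** * Uniqueness of the circuit relation *)

Section Setting.
Variables (R : realType) (A : {fset 'rV[int]_3}) (N : nat) (v : 'rV[rat]_3) (M : 'I_N -> rat)
    (e : 'rV[int]_3 -> rat) (C : {fset 'rV[int]_3}) (lambda : 'rV[int]_3 -> R)
    (y : 'I_3 -> rat) (b : rat) (u u' : 'I_N -> 'rV[int]_3).
Hypothesis S : setting A v M e C lambda y b u u'.
Local Notation h := (height v).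

Lemma ratr_affine (F : numFieldType) (z : 'I_3 -> rat) c w :
  ratr (affine_form z c w) = affine_form (fun j => ratr (z j)) (ratr c) w :> F.
Proof.
rewrite /affine_form rmorphD rmorph_sum/=; congr (_ + _); apply: eq_bigr => j _.
by rewrite rmorphM/= ratr_int.
Qed.

(** Convexity: maximality of [u' i] at slope [M i] and of [u j] at slope [M j] add up to
    [(M j - M i) * (h (u j) - h (u' i)) >= 0]. *)
Lemma set_chain (i j : 'I_N) : (i < j)%N -> h (u' i) <= h (u j).
Proof.
move=> /(set_incr S) Mij; have := set_tight_fst S i (set_edge_fst S j).
have := set_tight_fst S j (set_edge_snd S i); have := set_tight_eq S i => e1 e2 e3.
rewrite -subr_ge0 -(pmulr_rge0 _ (_ : 0 < M j - M i)) ?subr_gt0//.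
by rewrite mulrBl !mulrBr; lra.
Qed.

Lemma circuit_neq0 : exists2 w, w \in C & lambda w != 0.
Proof.
have [w wC] : exists w, w \in C.
  apply: contrapT => nC; have [|_ /eqP] := set_spanning S R (fun=> 0) 1.
    by move=> w wC; case: nC; exists w.
  by rewrite oner_eq0.
by exists w => //; exact: (set_relation_neq0 S).
Qed.

Lemma cell_affineR w : w \in C ->
  ratr (e w) = affine_form (fun j => ratr (y j)) (ratr b) w :> R.
Proof. by move=> /(set_cell_eq S) ->; rewrite ratr_affine. Qed.

Lemma no_three_collinear B : (#|` B| <= 3)%N -> ~ (C `<=` B)%fset.
Proof.
move=> B3 /fsubsetP CB.
pose cd (x : 'rV[int]_3) (l : 'I_4) : R := if unlift ord0 l is Some j then (x 0 j)%:~R else 1.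
have [|x [[l _ xl] _ cx]] := @underdetermined R _ (enum 'I_4) #|` B| (enum_uniq _)
    (fun j => cd (nth 0 B j)); first by rewrite size_enum_ord.
have [|y0 c0] := set_spanning S R (fun j => x (lift ord0 j)) (x ord0).
  move=> w /CB wB; have wB' : (index w B < #|` B|)%N by rewrite index_mem.
  have := cx (Ordinal wB'); rewrite big_enum/= big_ord_recl /cd unlift_none mul1r nth_index//.
  rewrite addrC => <-; congr (_ + _); apply: eq_bigr => j _; by rewrite liftK mulrC.
move/eqP: xl; apply; case: (unliftP ord0 l) => [j ->|->]; [exact: y0|exact: c0].
Qed.

Let rel0 : relation A fset0 (fun=> 0 : R). Proof. exact: relation0. Qed.
Let hrel0 : height_relation A v fset0 (fun=> 0 : R).
Proof. by split=> //; rewrite big1// => w _; rewrite mul0r. Qed.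

(* A third monomial at a marked point would be an isolated vertex of the graph
   of edges, hence would yield a relation besides that of the circuit. *)
Lemma tight_pair i x : x \in A -> M i * h x - e x = M i * h (u i) - e (u i) ->
  x = u i \/ x = u' i.
Proof.
move=> xA tx; have /andP[hux hxu'] := set_tight_between S xA tx.
have [->|xu] := eqVneq x (u i); first by left.
have [->|xu'] := eqVneq x (u' i); first by right.
have hinj := set_height S; have uA := set_edge_fst S; have u'A := set_edge_snd S.
have hux' : h (u i) < h x.
  by rewrite lt_neqAle hux andbT; apply: contra_neq xu => /hinj ->.
have hxu'' : h x < h (u' i).
  by rewrite lt_neqAle hxu' andbT; apply: contra_neq xu' => /hinj ->.
have xedge j : x != u j /\ x != u' j.
  have [ji|ij|/val_inj ->//] := ltngtP j i.
  - have := set_chain ji; have := set_edge_lt S j => h1 h2.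
    by split; apply/eqP => xE; move: hux'; rewrite xE; lra.
  - have := set_chain ij; have := set_edge_lt S j => h1 h2.
    by split; apply/eqP => xE; move: hxu''; rewrite xE; lra.
exfalso; have [r1 [r2 [r1A r2A r12 _ root]]] :=
  two_roots uA (set_edge_lt S) set_chain (set_card S).
(* Being an end of no edge, [x] is one of the two roots; [r] is the other. *)
have [r rA [rx rootx]] : exists2 r, r \in A & r != x /\
    forall z, z \in A -> (exists i, z = u i) \/ z = r \/ z = x.
  have [[j xE]|[xE|xE]] := root _ xA; first by have [] := xedge j; rewrite xE eqxx.
  - exists r2 => //; rewrite xE eq_sym; split=> // z /root[zu|[->|->]];
      [by left|by right; right|by right; left].
  - by exists r1 => //; rewrite xE.
(* [om] is the affine relation among the heights of [x], [u i] and [u' i], normalised to 1 at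
   [x]. *)
pose tau : R := ratr ((h x - h (u i)) / (h (u' i) - h (u i))).
pose om w : R := (w == x)%:R - (1 - tau) * (w == u i)%:R - tau * (w == u' i)%:R.
have sumE (f : 'rV[int]_3 -> R) : \sum_(w <- A) om w * f w = f x - (1 - tau) * f (u i) - tau * f (u' i).
  rewrite -(sum_indicator f xA) -(sum_indicator f (uA i)) -(sum_indicator f (u'A i)).
  by rewrite !mulr_sumr -!sumrB; apply: eq_bigr => w _; rewrite /om; ring.
pose l := lambda x.
have om_x : om x = 1 by rewrite /om eqxx; have [/negbTE -> /negbTE ->] := xedge i; rewrite !mulr0 !subr0.
have hn0 : h (u' i) - h (u i) != 0 by rewrite subr_eq0 gt_eqF// (set_edge_lt S).
have hom : height_relation A v [fset x; u i; u' i]%fset (fun w => - l * om w).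
  split=> [w||].
  - rewrite !inE !negb_or => /andP[/andP[/negbTE wx /negbTE wu] /negbTE wu'].
    by rewrite /om wx wu wu' !mulr0 !subr0 mulr0.
  - rewrite -mulr_sumr; under eq_bigr do rewrite -[om _]mulr1.
    by rewrite sumE; ring.
  - under eq_bigr do rewrite -mulrA; rewrite -mulr_sumr sumE.
    rewrite (_ : _ - _ = 0) ?mulr0//.
    have -> : 1 - tau = ratr (1 - (h x - h (u i)) / (h (u' i) - h (u i))) by rewrite rmorphB rmorph1.
    rewrite -!rmorphM -!rmorphB/=; apply/eqP; rewrite fmorph_eq0; apply/eqP; by field.
have B3A : ([fset x; u i; u' i] `<=` A)%fset.
  by apply/fsubsetP => w; rewrite !inE => /orP[/orP[]|] /eqP ->.
have eB3 w : w \in [fset x; u i; u' i]%fset -> e w = M i * h w + (e (u i) - M i * h (u i)).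
  have := set_tight_eq S i; rewrite !inE => tu' /orP[/orP[]|] /eqP ->; lra.
have e0 w : w \in fset0 -> ratr (e w) = affine_form (fun=> 0) 0 w :> R by rewrite inE.
(* Changing [psi] at the isolated point [x] keeps it edge-constant, so [psi] is constant off [x]; it
   then suffices that the vector has sum zero and vanishes at [x]. *)
have oml : edge_orthogonal A u u' (fun w => lambda w + 0 + - l * om w).
  move=> psi cpsi; pose phi w := psi w - (psi x - psi r) * (w == x)%:R.
  have cphi : edge_constant u u' phi.
    by move=> j; rewrite /phi cpsi; have [/negbTE xu1 /negbTE xu2] := xedge j; rewrite ![_ == x]eq_sym xu1 xu2.
  have phir : phi r = psi r by rewrite /phi (negbTE rx) mulr0 subr0.
  have phix : phi x = psi r by rewrite /phi eqxx mulr1 opprB addrC subrK.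
  have psiE w : w \in A -> psi w = psi r + (psi x - psi r) * (w == x)%:R.
    move=> /(edge_constantP u'A (set_edge_lt S) set_chain rootx cphi phir phix).
    by move/eqP; rewrite /phi subr_eq => /eqP.
  have [_ l0 _] := set_relation S; have [_ om0 _] := hom.
  have -> : \sum_(w <- A) (lambda w + 0 + - l * om w) * psi w =
     psi r * (\sum_(w <- A) lambda w + \sum_(w <- A) - l * om w) +
     (psi x - psi r) * (\sum_(w <- A) (w == x)%:R * (lambda w - l * om w)).
    rewrite -big_split !mulr_sumr -big_split/=; apply: eq_big_seq => w wA.
    by rewrite (psiE w wA); ring.
  by rewrite l0 om0 sum_indicator// om_x /l; ring.
have := set_cell_generic S (set_circuit_sub S) (fsub0set A) B3A cell_affineR e0 eB3
  (set_relation S) rel0 hom oml => lom.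
have cU (B1 B2 : {fset 'rV[int]_3}) : (#|` (B1 `|` B2)%fset| <= #|` B1| + #|` B2|)%N.
  by rewrite cardfsU leq_subr.
have c3 : (#|` [fset x; u i; u' i]%fset| <= 3)%N.
  apply: leq_trans (cU _ _) _; rewrite cardfs1 addn1 ltnS.
  by apply: leq_trans (cU _ _) _; rewrite !cardfs1.
(* [lambda] is now a multiple of [om], whose three points are too few to contain the spanning set
   [C]. *)
apply: (no_three_collinear c3).
apply/fsubsetP => w wC; apply: contraT => wB; have := set_relation_neq0 S wC.
have [s0 _ _] := hom; have := lom _ (fsubsetP (set_circuit_sub S) _ wC).
by rewrite s0// !addr0 => ->; rewrite eqxx.
Qed.

(** The last clause is applied to real relations and to complex leading coefficients, hence the
    arbitrary field. *)
Lemma exists_edge_function : exists r1 r2 (chi : 'rV[int]_3 -> R), [/\ [/\ r1 \in A, r2 \in A & r1 != r2],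
  edge_constant u u' chi, chi r1 = 0, chi r2 = 1 &
  forall (F : fieldType) (psi : 'rV[int]_3 -> F), edge_constant u u' psi ->
    psi r1 = 0 -> psi r2 = 0 -> forall x, x \in A -> psi x = 0].
Proof.
have uA := set_edge_fst S; have u'A := set_edge_snd S; have ch := set_chain.
have [r1 [r2 [r1A r2A r12 _ root]]] := two_roots uA (set_edge_lt S) ch (set_card S).
have [chi [cchi chi1 chi2]] :=
  edge_function uA u'A (set_edge_lt S) ch (set_card S) R r1A r2A r12 root.
exists r1, r2, chi; split=> // F psi cpsi psi1 psi2 x xA.
exact: (edge_constantP u'A (set_edge_lt S) ch root cpsi psi1 psi2 xA).
Qed.

Variables (r1 r2 : 'rV[int]_3) (chi : 'rV[int]_3 -> R).
Hypothesis cchi : edge_constant u u' chi.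
Hypothesis chi1 : chi r1 = 0.
Hypothesis chi2 : chi r2 = 1.
Hypothesis root_zero : forall psi : 'rV[int]_3 -> R, edge_constant u u' psi ->
  psi r1 = 0 -> psi r2 = 0 -> forall x, x \in A -> psi x = 0.

(** Subtracting [psi r1 + (psi r2 - psi r1) * chi] from [psi] leaves an edge-constant function that
    is zero at both roots, hence on [A]. *)
Lemma edge_orthogonal_chi (mu : 'rV[int]_3 -> R) : \sum_(w <- A) mu w = 0 ->
  \sum_(w <- A) mu w * chi w = 0 -> edge_orthogonal A u u' mu.
Proof.
move=> mu0 muchi psi cpsi; pose phi w := psi w - (psi r1 + (psi r2 - psi r1) * chi w).
have phi0 : forall w, w \in A -> phi w = 0.
  apply: root_zero; rewrite /phi ?chi1 ?chi2; [by move=> i; rewrite cpsi cchi|ring|ring].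
have -> : \sum_(w <- A) mu w * psi w =
    psi r1 * (\sum_(w <- A) mu w) + (psi r2 - psi r1) * \sum_(w <- A) mu w * chi w.
  rewrite !mulr_sumr -big_split/=; apply: eq_big_seq => w /phi0/eqP.
  by rewrite subr_eq0 => /eqP ->; ring.
by rewrite mu0 muchi !mulr0 addr0.
Qed.

Definition chi_sum := \sum_(w <- A) lambda w * chi w.

(** Otherwise [lambda] itself would be edge-orthogonal, and genericity would make it vanish. Up to a
    nonzero scalar this sum is the coefficient of [theta] in the linearised value equation. *)
Lemma chi_sum_neq0 : chi_sum != 0.
Proof.
apply/eqP => s0; have [w wC lw] := circuit_neq0; have [_ l0 _] := set_relation S.
have e0 w' : w' \in fset0 -> ratr (e w') = affine_form (fun=> 0) 0 w' :> R by rewrite inE.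
have e3 w' : w' \in fset0 -> e w' = 0 * h w' + 0 by rewrite inE.
have oml : edge_orthogonal A u u' (fun w => lambda w + 0 + 0).
  by apply: edge_orthogonal_chi; under eq_bigr do rewrite !addr0.
have := set_cell_generic S (set_circuit_sub S) (fsub0set A) (fsub0set A) cell_affineR e0 e3
  (set_relation S) rel0 hrel0 oml (fsubsetP (set_circuit_sub S) _ wC).
by rewrite !addr0; apply/eqP.
Qed.

Lemma cell_relation_proportional B (mu : 'rV[int]_3 -> R) (z : 'I_3 -> rat) c :
  (B `<=` A)%fset -> (forall w, w \in B -> e w = affine_form z c w) -> relation A B mu ->
  exists t, forall w, w \in A -> mu w = t * lambda w.
Proof.
move=> BA eB rmu; have [_ l0 _] := set_relation S; have [_ mu0 _] := rmu.
(* This [t] makes [mu - t * lambda] annihilate [chi]. *)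
pose t := (\sum_(w <- A) mu w * chi w) / chi_sum; exists t.
have e2 w' : w' \in B -> ratr (e w') = affine_form (fun j => ratr (z j)) (ratr c) w' :> R.
  by move=> /eB ->; rewrite ratr_affine.
have e3 w' : w' \in fset0 -> e w' = 0 * h w' + 0 by rewrite inE.
have oml : edge_orthogonal A u u' (fun w => - t * lambda w + mu w + 0).
  apply: edge_orthogonal_chi.
    by under eq_bigr do rewrite addr0; rewrite big_split/= -mulr_sumr l0 mu0 mulr0 addr0.
  under eq_bigr do rewrite addr0 mulrDl -mulrA.
  by rewrite big_split/= -mulr_sumr -/chi_sum /t mulNr divfK ?chi_sum_neq0// addNr.
move=> w wA; have := set_cell_generic S (set_circuit_sub S) BA (fsub0set A) cell_affineR e2 e3
  (relationZ (- t) (set_relation S)) rmu hrel0 oml wA.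
by rewrite addr0 mulNr addrC => /eqP; rewrite subr_eq0 => /eqP.
Qed.

(** A further point of the cell would be an affine combination of [C], giving a relation with
    coefficient 1 at [w], where [lambda] vanishes. *)
Lemma cell_eq_circuit w : w \in A -> e w = affine_form y b w -> w \in C.
Proof.
move=> wA ew; apply: contraT => wC; have CA := set_circuit_sub S.
have [mu rmu mu1] := spanning_combination CA (set_spanning S R) wA wC.
have [|w' |t tE] := cell_relation_proportional (z := y) (c := b) _ _ rmu.
- by apply/fsubsetP => w'; rewrite !inE => /orP[/eqP ->//|]; exact: (fsubsetP CA).
- by rewrite !inE => /orP[/eqP ->//|]; exact: (set_cell_eq S).
have [l0 _ _] := set_relation S.
by have := tE _ wA; rewrite mu1 l0// mulr0 => /eqP; rewrite oner_eq0.
Qed.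

(** Both points are affine combinations of [C]. The difference of the two relations, corrected by a
    multiple of [lambda] so as to annihilate [chi], has coefficients 1 and -1 at [w] and [w']; a tie
    would force it to vanish. *)
Lemma cell_gap_inj w w' : w \in A -> w' \in A -> w \notin C -> w' \notin C -> w != w' ->
  e w - affine_form y b w != e w' - affine_form y b w'.
Proof.
move=> wA w'A wC w'C ww'; apply/eqP => tie; have CA := set_circuit_sub S.
have [mu rmu mu1] := spanning_combination CA (set_spanning S R) wA wC.
have [mu' rmu' mu'1] := spanning_combination CA (set_spanning S R) w'A w'C.
have [s0 l0 _] := set_relation S.
pose D := (w |` (w' |` C))%fset.
have D1 : ((w |` C) `<=` D)%fset by apply: fsetUS; exact: fsubsetU1.
have D2 : ((w' |` C) `<=` D)%fset by exact: fsubsetU1.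
have D3 : (C `<=` D)%fset by apply: fsubset_trans D2; exact: fsubsetU1.
pose nu0 x := mu x + -1 * mu' x.
have rnu0 : relation A D nu0.
  by apply: relationD (relationW D1 rmu) (relationZ _ (relationW D2 rmu')).
pose t := (\sum_(x <- A) nu0 x * chi x) / chi_sum.
pose nu x := nu0 x + - t * lambda x.
have rnu : relation A D nu by apply: relationD rnu0 (relationZ _ (relationW D3 (set_relation S))).
have muw' : mu w' = 0 by case: rmu => -> //; rewrite !inE eq_sym (negbTE ww').
have mu'w : mu' w = 0 by case: rmu' => -> //; rewrite !inE (negbTE ww').
have nuw : nu w = 1 by rewrite /nu /nu0 mu1 mu'w s0//; ring.
have nuw' : nu w' = -1 by rewrite /nu /nu0 mu'1 muw' s0//; ring.
have onu : edge_orthogonal A u u' nu.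
  apply: edge_orthogonal_chi; first by case: rnu.
  under eq_bigr do rewrite mulrDl -mulrA.
  by rewrite big_split/= -mulr_sumr -/chi_sum /t mulNr divfK ?chi_sum_neq0// subrr.
have tieR : ratr (e w) - affine_form (fun j => ratr (y j)) (ratr b) w =
   ratr (e w') - affine_form (fun j => ratr (y j)) (ratr b) w' :> R.
  by rewrite -!ratr_affine -!rmorphB/= tie.
have := set_tie_generic S CA wA w'A wC w'C ww' cell_affineR tieR rnu _ onu wA.
by rewrite nuw nuw' subrr => /(_ erefl)/eqP; rewrite oner_eq0.
Qed.

End Setting.

(** * Singular points *)

Section Monomials.
Variable F : fieldType.
Implicit Types (z : 'rV[F]_3) (w : 'rV[int]_3).

Lemma monomial_neq0 z w : (forall j, z 0 j != 0) -> monomial z w != 0.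
Proof. by move=> z0; apply/prodf_neq0 => j _; rewrite expfz_neq0. Qed.

Definition hadamard z z' : 'rV[F]_3 := \row_j (z 0 j * z' 0 j).

Lemma monomialM z z' w : monomial (hadamard z z') w = monomial z w * monomial z' w.
Proof. by rewrite /monomial -big_split/=; apply: eq_bigr => j _; rewrite mxE expfzMl. Qed.

Lemma monomialD z w w' : (forall j, z 0 j != 0) -> monomial z (w + w') = monomial z w * monomial z w'.
Proof. by move=> z0; rewrite /monomial -big_split/=; apply: eq_bigr => j _; rewrite mxE expfzDr. Qed.

Lemma monomialN z w : monomial z (- w) = (monomial z w)^-1.
Proof. by rewrite /monomial -prodfV; apply: eq_bigr => j _; rewrite mxE invr_expz. Qed.

Lemma monomial0 z : monomial z 0 = 1.
Proof. by rewrite /monomial big1// => j _; rewrite mxE expr0z. Qed.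

Lemma monomial_delta z j : monomial z (delta_mx 0 j) = z 0 j.
Proof.
rewrite /monomial (bigD1 j)//= mxE !eqxx expr1z big1 ?mulr1// => k kj.
by rewrite mxE (negbTE kj) andbF expr0z.
Qed.

(** In the torus the partial derivatives may be replaced by the logarithmic ones, which multiply
    each term by [w 0 j]; the equations become an affine relation among the exponents. *)
Lemma singular_atP (A : {fset 'rV[int]_3}) (f : 'rV[int]_3 -> F) z :
  (forall j, z 0 j != 0) -> singular_at A f z <->
  \sum_(w <- A) f w * monomial z w = 0 /\
  forall j, \sum_(w <- A) f w * monomial z w * (w 0 j)%:~R = 0.
Proof.
move=> z0; have dE j : laurent_deriv A f j z =
    (\sum_(w <- A) f w * monomial z w * (w 0 j)%:~R) * (z 0 j)^-1.
  rewrite mulr_suml; apply: eq_bigr => w _.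
  by rewrite monomialD// monomialN monomial_delta; ring.
split=> [[_ e0 ej]|[e0 ej]].
  split=> // j; apply: (mulIf (_ : (z 0 j)^-1 != 0)); first by rewrite invr_eq0.
  by rewrite -dE ej mul0r.
by split=> // j; rewrite dE ej mul0r.
Qed.

End Monomials.

(** * Perturbation of a nondegenerate singular point *)

Section Expansion.
Variable R : realType.
Local Notation K := (puiseux R).
Implicit Types (p q : rat) (x a : K).

Lemma binomial_expansion p x n : 0 <= p -> vge p x -> vge (p + p) ((1 + x) ^+ n - (1 + n%:R * x)).
Proof.
move=> p0 vx; elim: n => [|n ih].
  by rewrite expr0 (_ : _ - _ = 0); [exact: vge_0|ring].
have -> : (1 + x) ^+ n.+1 - (1 + n.+1%:R * x) =
    (1 + x) * ((1 + x) ^+ n - (1 + n%:R * x)) + n%:R * (x * x) by rewrite exprS -natr1; ring.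
apply: vgeD; last by apply: vge_natM; exact: vgeM.
rewrite -[X in vge X]add0r; apply: vgeM => //; apply: vgeD; last exact: vgeW vx.
by have [_] := lead_cst (1 : R[i]).
Qed.

Lemma prod_expansion p (I : Type) (l : seq I) (g s : I -> K) : 0 <= p ->
  (forall i, vge p (s i)) -> (forall i, vge (p + p) (g i - (1 + s i))) ->
  vge (p + p) (\prod_(i <- l) g i - (1 + \sum_(i <- l) s i)).
Proof.
move=> p0 vs vg; have pp : p <= p + p by lra.
have v1 : vge 0 (1 : K) by have [_] := lead_cst (1 : R[i]).
elim: l => [|i l ih]; first by rewrite !big_nil addr0 subrr; exact: vge_0.
rewrite !big_cons; set P := \prod_(j <- l) _; set Q := \sum_(j <- l) _.
have vQ : vge p Q by move=> r rp; rewrite /Q pcoef_sum big1// => j _; exact: vs.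
have -> : g i * P - (1 + (s i + Q)) =
    (g i - (1 + s i)) * P + (1 + s i) * (P - (1 + Q)) + s i * Q by ring.
have vP : vge 0 P.
  have -> : P = (P - (1 + Q)) + 1 + Q by ring.
  apply: vgeD; last exact: vgeW vQ.
  by apply: vgeD => //; apply: vgeW ih; lra.
apply: vgeD; last exact: vgeM.
apply: vgeD; first by rewrite -[X in vge X]addr0; exact: vgeM.
rewrite -[X in vge X]add0r; apply: vgeM => //.
by apply: vgeD => //; exact: vgeW (vs i).
Qed.

Variable d : nat.

(* The monomial of [w] at the point [1 + eta], times the power [d] of the
   product of the coordinates, which makes the exponents nonnegative. *)
Definition shifted_monomial (w : 'rV[int]_3) (eta : 'I_3 -> K) : K :=
  \prod_(j < 3) (1 + eta j) ^+ absz (w 0 j + d%:Z).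

Lemma shifted_monomial_expansion p w eta : 0 <= p -> (forall j, vge p (eta j)) ->
  vge (p + p) (shifted_monomial w eta - (1 + \sum_(j < 3) (absz (w 0 j + d%:Z))%:R * eta j)).
Proof.
move=> p0 veta; apply: prod_expansion => // j; first by apply: vge_natM.
exact: binomial_expansion.
Qed.

Lemma lead_1D x : lead x 0 0 -> lead (1 + x) 1 0.
Proof. by move=> lx; rewrite -[X in lead _ X]addr0; apply: leadD lx; exact: lead_cst. Qed.

Lemma lead_shifted_monomial w eta : (forall j, lead (eta j) 0 0) ->
  lead (shifted_monomial w eta) 1 0.
Proof.
move=> leta; rewrite -[X in lead _ X](_ : \prod_(j < 3) 1 ^+ absz (w 0 j + d%:Z) = 1); last first.
  by rewrite big1// => j _; rewrite expr1n.
rewrite -[X in lead _ _ X](_ : \sum_(j < 3) (absz (w 0 j + d%:Z))%:R * 0 = 0); last first.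
  by rewrite big1// => j _; rewrite mulr0.
by apply: lead_prod => j; apply: leadX; exact: lead_1D.
Qed.

Lemma monomial_shift (w : 'rV[int]_3) (eta : 'I_3 -> K) :
  (forall j, (0 <= w 0 j + d%:Z)%R) -> (forall j, 1 + eta j != 0) ->
  shifted_monomial w eta = monomial (\row_j (1 + eta j)) w * \prod_(j < 3) (1 + eta j) ^+ d.
Proof.
move=> wd eta1; rewrite /monomial -big_split/=; apply: eq_bigr => j _.
by rewrite mxE !exprnP -expfzDr// gez0_abs.
Qed.

End Expansion.

Section Contact.
Variables (R : realType) (A : {fset 'rV[int]_3}) (d : nat).
Local Notation K := (puiseux R).
Hypothesis shift_ge0 : forall w, w \in A -> forall j, (0 <= w 0 j + d%:Z)%R.
Implicit Types (a : 'rV[int]_3 -> K) (eta : 'I_3 -> K) (beta : 'rV[int]_3 -> R[i]).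
Local Notation sm := (shifted_monomial d).

Definition singular_system a eta :=
  \sum_(w <- A) a w * sm w eta = 0 /\
  forall k, \sum_(w <- A) a w * sm w eta * (w 0 k)%:~R = 0.

(** The matrix is, at a singular point, the Hessian at [(1, 1, 1)] of the Laurent polynomial with
    coefficients [beta], in logarithmic coordinates. *)
Definition hessian_nondegenerate beta := forall x : 'I_3 -> R[i],
  (forall k, \sum_(w <- A) beta w * (w 0 k)%:~R * (\sum_(j < 3) x j * (w 0 j)%:~R) = 0) ->
  forall j, x j = 0.

Lemma shiftE (F : nzRingType) w j : w \in A -> (absz (w 0 j + d%:Z))%:R = (w 0 j)%:~R + d%:R :> F.
Proof.
move=> /shift_ge0/(_ j) h; rewrite -[LHS]/((absz (w 0 j + d%:Z))%:Z%:~R) gez0_abs//.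
by rewrite intrD.
Qed.

(* A singularity moves by no more than the perturbation of the coefficients, so
   by Euler's relation the value of the perturbation there is of second order. *)
Lemma perturbation_value0 a a' delta beta q :
  hessian_nondegenerate beta -> 0 < q ->
  (forall w, w \in A -> lead (a w) (beta w) 0) ->
  (forall w, w \in A -> vge q (a' w - a w)) ->
  (forall j, lead (delta j) 0 0) ->
  singular_system a (fun=> 0) -> singular_system a' delta ->
  \sum_(w <- A) (a' w - a w) q = 0.
Proof.
move=> nd q0 la vq ld [a0 ak] [a'0 a'k].
have sm0 w : sm w (fun=> 0 : K) = 1.
  by rewrite /shifted_monomial big1// => j _; rewrite addr0 expr1n.
have {}a0 : \sum_(w <- A) a w = 0 by rewrite -[RHS]a0; apply: eq_bigr => w _; rewrite sm0 mulr1.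
have {}ak k : \sum_(w <- A) a w * (w 0 k)%:~R = 0.
  by rewrite -[RHS](ak k); apply: eq_bigr => w _; rewrite sm0 mulr1.
have lsm w : lead (sm w delta) 1 0 by exact: lead_shifted_monomial.
have v0 (x : K) (n : int) p : vge p x -> vge p (x * n%:~R) by rewrite mulrC; exact: vge_intM.
pose L (w : 'rV[int]_3) : K := \sum_(j < 3) (absz (w 0 j + d%:Z))%:R * delta j.
have LE w : w \in A -> L w = \sum_(j < 3) (w 0 j)%:~R * delta j + d%:R * \sum_(j < 3) delta j.
  move=> wA; rewrite /L mulr_sumr -big_split/=; apply: eq_bigr => j _.
  by rewrite shiftE// mulrDl.
(* The shift [d] adds to [L] a term independent of [w], which contributes only a multiple of an
   unperturbed equation. *)
have aL (c : 'rV[int]_3 -> K) : \sum_(w <- A) a w * c w * L w =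
    \sum_(j < 3) delta j * (\sum_(w <- A) a w * c w * (w 0 j)%:~R) +
    d%:R * (\sum_(j < 3) delta j) * \sum_(w <- A) a w * c w.
  transitivity (\sum_(w <- A) (\sum_(j < 3) a w * c w * (w 0 j)%:~R * delta j +
     d%:R * (\sum_(j < 3) delta j) * (a w * c w))).
    apply: eq_big_seq => w wA; rewrite LE// mulrDr mulr_sumr; congr (_ + _); last by ring.
    by apply: eq_bigr => j _; ring.
  rewrite big_split/= -mulr_sumr exchange_big/=; congr (_ + _); apply: eq_bigr => j _.
  by rewrite mulr_sumr; apply: eq_bigr => w _; ring.
(* The four parts are the perturbation, the unperturbed equation, its first variation and a
   remainder of second order in [delta]. *)
have split_sum (c : 'rV[int]_3 -> K) : \sum_(w <- A) a' w * sm w delta * c w =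
    \sum_(w <- A) (a' w - a w) * sm w delta * c w + \sum_(w <- A) a w * c w +
    \sum_(w <- A) a w * c w * L w +
    \sum_(w <- A) a w * (sm w delta - (1 + L w)) * c w.
  by rewrite -!big_split; apply: eq_bigr => w _ /=; ring.
(* If the order [p] of [delta] were below [q], the perturbation would not reach the coefficient of
   [t^p] in the derivative equations, and the leading coefficients of [delta] would lie in the
   kernel of the Hessian. *)
have vqd j : vge q (delta j).
  have [dz|ndz] := pselect (forall j, delta j = 0); first by rewrite dz; exact: vge_0.
  have [|p [vp [i0 _ di]]] := @vge_min R _ (enum 'I_3) delta.
    apply: contrapT => nex; apply: ndz => i; apply: contrapT => di; apply: nex.
    by exists i; [rewrite mem_enum|exact/eqP].
  have {}vp i : vge p (delta i) by apply: vp; rewrite mem_enum.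
  have [qp|pq] := leP q p; first exact: vgeW (vp j).
  have p0 : 0 < p.
    have [//|p0|p0] := ltgtP 0 p; first by move: di; rewrite (lead_vge (ld i0))// eqxx.
    by move: di; rewrite -p0 (lead_at (ld i0)) eqxx.
  exfalso; move/eqP: di; apply; apply: (nd (fun j => delta j p)) => k.
  have bk : \sum_(w <- A) beta w * (w 0 k)%:~R = 0.
    transitivity ((\sum_(w <- A) a w * (w 0 k)%:~R : K) 0); last by rewrite ak pcoef0.
    rewrite pcoef_sum; apply: eq_big_seq => w /la[aw _].
    by rewrite mulrC [in RHS]mulrC coef_intM aw.
  have := split_sum (fun w => (w 0 k)%:~R); rewrite a'k ak addr0 aL ak mulr0 addr0.
  move=> /(congr1 (fun x : K => x p)); rewrite pcoef0 !pcoefD.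
  have -> : (\sum_(w <- A) (a' w - a w) * sm w delta * (w 0 k)%:~R) p = 0.
    apply: (_ : vge q _) => //; apply: vge_sum => w wA; apply: v0.
    by rewrite -[X in vge X]addr0; apply: vgeM; [exact: vq|case: (lsm w)].
  have -> : (\sum_(w <- A) a w * (sm w delta - (1 + L w)) * (w 0 k)%:~R) p = 0.
    apply: (_ : vge (p + p) _); last by rewrite ltrDl.
    apply: vge_sum => w wA; apply: v0; rewrite -[X in vge X]add0r.
    apply: vgeM; first by case: (la w wA).
    by apply: shifted_monomial_expansion; rewrite ?ltW.
  rewrite add0r addr0 => /esym h; rewrite -[RHS]h pcoef_sum.
  transitivity (\sum_(j < 3) delta j p * \sum_(w <- A) beta w * (w 0 k)%:~R * (w 0 j)%:~R).
    under eq_bigr do rewrite mulr_sumr.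
    rewrite exchange_big/=; apply: eq_bigr => i' _; rewrite mulr_sumr.
    by apply: eq_bigr => w _; ring.
  apply: eq_bigr => i' _; rewrite -{2}[p]addr0 (pcoefM_lead (vp i')).
    congr (_ * _); rewrite pcoef_sum; apply: eq_big_seq => w /la[<- _].
    by rewrite ![_ * (w 0 _)%:~R]mulrC !coef_intM; ring.
  by apply: vge_sum => w /la[_ va]; exact: (v0 _ _ _ (v0 _ _ _ va)).
(* In the value equation the first variation vanishes, [a] being critical, and the remainder has
   order [q + q]; only the perturbation is left at order [q]. *)
have := split_sum (fun=> 1); under eq_bigr do rewrite mulr1; rewrite a'0.
have -> : \sum_(w <- A) a w * 1 * L w = 0.
  rewrite (aL (fun=> 1)) [X in _ + _ * X](_ : _ = 0) ?mulr0 ?addr0; last first.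
    by under eq_bigr do rewrite mulr1.
  rewrite big1// => j _; under eq_bigr do rewrite mulr1.
  by rewrite ak mulr0.
under [X in _ + X + _ + _]eq_bigr do rewrite mulr1.
rewrite a0 !addr0 => /(congr1 (fun x : K => x q)); rewrite pcoef0 pcoefD.
have -> : (\sum_(w <- A) a w * (sm w delta - (1 + L w)) * 1) q = 0.
  apply: (_ : vge (q + q) _); last by rewrite ltrDl.
  apply: vge_sum => w wA; rewrite mulr1 -[X in vge X]add0r.
  apply: vgeM; first by case: (la w wA).
  by apply: shifted_monomial_expansion; rewrite ?ltW.
rewrite addr0 => /esym h; rewrite -[RHS]h pcoef_sum; apply: eq_big_seq => w wA.
by rewrite mulr1 -{2}[q]addr0 (pcoefM_lead (vq _ wA)) ?(lead_at (lsm w)) ?mulr1//; case: (lsm w).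
Qed.

(** Rescaling the coordinates by [1 + eta] moves the first singular point to [(1, 1, 1)] and
    multiplies the coefficients by monomials with leading term 1. *)
Lemma perturbation_value a a' eta eta' beta q :
  hessian_nondegenerate beta -> 0 < q ->
  (forall w, w \in A -> lead (a w) (beta w) 0) ->
  (forall w, w \in A -> vge q (a' w - a w)) ->
  (forall j, lead (eta j) 0 0) -> (forall j, lead (eta' j) 0 0) ->
  singular_system a eta -> singular_system a' eta' ->
  \sum_(w <- A) (a' w - a w) q = 0.
Proof.
move=> nd q0 la vq le le' sa sa'.
have e1 j : lead (1 + eta j) 1 0 by exact: lead_1D.
have e10 j : 1 + eta j != 0 by apply: lead_neq0 (e1 j) (oner_neq0 _).
pose delta j := (1 + eta' j) / (1 + eta j) - 1.
have ld j : lead (delta j) 0 0.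
  have := leadM (lead_1D (le' j)) (leadV (e1 j) (oner_neq0 _)).
  rewrite invr1 mulr1 oppr0 addr0 => l1; have := lead_cst (- 1 : R[i]); rewrite cstN cst1 => l2.
  by have := leadD l1 l2; rewrite subrr.
have dE w : sm w eta' = sm w eta * sm w delta.
  rewrite /shifted_monomial -big_split/=; apply: eq_bigr => j _; rewrite -exprMn.
  by congr (_ ^+ _); rewrite /delta [1 + (_ - _)]addrC subrK mulrC divfK.
have sm0 w : sm w (fun=> 0 : K) = 1.
  by rewrite /shifted_monomial big1// => j _; rewrite addr0 expr1n.
have lsm w : lead (sm w eta) 1 0 by exact: lead_shifted_monomial.
pose b w := a w * sm w eta; pose b' w := a' w * sm w eta.
have bb w : b' w - b w = (a' w - a w) * sm w eta by rewrite /b /b'; ring.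
rewrite -[RHS](@perturbation_value0 b b' delta beta q nd q0) //.
- apply: eq_big_seq => w wA; rewrite bb -{2}[q]addr0 (pcoefM_lead (vq _ wA)).
    by rewrite (lead_at (lsm w)) mulr1.
  by case: (lsm w).
- by move=> w wA; rewrite -[beta w]mulr1 -[X in lead _ _ X]addr0; apply: leadM => //; exact: la.
- move=> w wA; rewrite bb -[X in vge X]addr0; apply: vgeM; first exact: vq.
  by case: (lsm w).
- case: sa => s0 sk; split=> [|k].
    by rewrite -[RHS]s0; apply: eq_bigr => w _; rewrite sm0 mulr1.
  by rewrite -[RHS](sk k); apply: eq_bigr => w _; rewrite sm0 mulr1.
- case: sa' => s0 sk; split=> [|k].
    by rewrite -[RHS]s0; apply: eq_bigr => w _; rewrite dE /b' mulrA.
  by rewrite -[RHS](sk k); apply: eq_bigr => w _; rewrite dE /b' mulrA.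
Qed.

End Contact.

Section ComplexRelations.
Variables (R : realType) (A : {fset 'rV[int]_3}).
Local Notation toC := (real_complex R).

Lemma complex_relation B (beta : 'rV[int]_3 -> R[i]) : relation A B beta ->
  relation A B (fun w => complex.Re (beta w)) /\ relation A B (fun w => complex.Im (beta w)).
Proof.
have ReD (x y : R[i]) : complex.Re (x + y) = complex.Re x + complex.Re y by case: x y => a b [].
have ImD (x y : R[i]) : complex.Im (x + y) = complex.Im x + complex.Im y by case: x y => a b [].
have rsum (f : 'rV[int]_3 -> R[i]) : complex.Re (\sum_(w <- A) f w) = \sum_(w <- A) complex.Re (f w).
  exact: (big_morph _ ReD erefl).
have isum (f : 'rV[int]_3 -> R[i]) : complex.Im (\sum_(w <- A) f w) = \sum_(w <- A) complex.Im (f w).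
  exact: (big_morph _ ImD erefl).
have rmul (x : R[i]) (n : int) : complex.Re (x * n%:~R) = complex.Re x * n%:~R.
  by rewrite -(rmorph_int toC); case: x => a b /=; rewrite mulr0 subr0.
have imul (x : R[i]) (n : int) : complex.Im (x * n%:~R) = complex.Im x * n%:~R.
  by rewrite -(rmorph_int toC); case: x => a b /=; rewrite mulr0 add0r.
move=> [b0 b1 bj]; split; split=> [w /b0 ->//||j].
- by rewrite -rsum b1.
- by under eq_bigr do rewrite -rmul; rewrite -rsum bj.
- by rewrite -isum b1.
- by under eq_bigr do rewrite -imul; rewrite -isum bj.
Qed.

End ComplexRelations.

Section ConstantMonomial.
Variable R : realType.
Local Notation cst := (@puiseux_const R).

Lemma cst_exprz (z : R[i]) (n : int) : cst (z ^ n) = cst z ^ n.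
Proof.
have cX m : cst (z ^+ m) = cst z ^+ m by elim: m => // m ih; rewrite !exprS cstM ih.
case: n => n; first exact: cX.
rewrite NegzE -!exprnN; have [->|z0] := eqVneq z 0; first by rewrite !exprS !mul0r !invr0 cst0.
have cz0 : cst z ^+ n.+1 != 0 by rewrite expf_neq0// cst_eq0.
by apply: (mulfI cz0); rewrite divff// -cX -cstM divff// expf_neq0.
Qed.

Lemma cst_monomial (z : 'rV[R[i]]_3) w : cst (monomial z w) = monomial (\row_j cst (z 0 j)) w.
Proof.
have cp (l : seq 'I_3) (g : 'I_3 -> R[i]) : cst (\prod_(j <- l) g j) = \prod_(j <- l) cst (g j).
  by elim: l => [|j l ih]; rewrite ?big_nil// !big_cons cstM ih.
by rewrite /monomial cp; apply: eq_bigr => j _; rewrite mxE cst_exprz.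
Qed.

End ConstantMonomial.

Lemma singular_systemZ (R : realType) (A : {fset 'rV[int]_3}) d (c : puiseux R) a eta :
  singular_system A d a eta -> singular_system A d (fun w => c * a w) eta.
Proof.
move=> [h0 hj]; split=> [|j].
  rewrite -[RHS](mulr0 c) -[in RHS]h0 mulr_sumr; apply: eq_bigr => w _.
  by rewrite mulrA.
rewrite -[RHS](mulr0 c) -[in RHS](hj j) mulr_sumr; apply: eq_bigr => w _.
by rewrite !mulrA.
Qed.

(** * The pencil through the marked points and its singular members *)

Section Core.
Variables (R : realType) (A : {fset 'rV[int]_3}) (N : nat) (v : 'rV[rat]_3) (M : 'I_N -> rat)
    (e : 'rV[int]_3 -> rat) (C : {fset 'rV[int]_3}) (lambda : 'rV[int]_3 -> R)
    (y : 'I_3 -> rat) (b : rat) (u u' : 'I_N -> 'rV[int]_3).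
Hypothesis S : setting A v M e C lambda y b u u'.
Local Notation h := (height v).
Local Notation K := (puiseux R).
Local Notation cst := (@puiseux_const R).
Local Notation toC := (real_complex R).
Variables (r1 r2 : 'rV[int]_3) (chi : 'rV[int]_3 -> R).
Hypothesis r1A : r1 \in A.
Hypothesis r2A : r2 \in A.
Hypothesis cchi : edge_constant u u' chi.
Hypothesis chi1 : chi r1 = 0.
Hypothesis chi2 : chi r2 = 1.
Hypothesis root_zero : forall (F : fieldType) (psi : 'rV[int]_3 -> F),
  edge_constant u u' psi -> psi r1 = 0 -> psi r2 = 0 -> forall x, x \in A -> psi x = 0.

Let CA w : w \in C -> w \in A. Proof. exact: (fsubsetP (set_circuit_sub S)). Qed.

Lemma lambda_out w : w \notin C -> lambda w = 0.
Proof. by have [l0 _ _] := set_relation S; exact: l0. Qed.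

Lemma complex_cell_relation B (beta : 'rV[int]_3 -> R[i]) (z : 'I_3 -> rat) c :
  (B `<=` A)%fset -> (forall w, w \in B -> e w = affine_form z c w) -> relation A B beta ->
  exists t, forall w, w \in A -> beta w = t * toC (lambda w).
Proof.
move=> BA eB /complex_relation[rr ri].
have rz := root_zero (F := R).
have [s sE] := cell_relation_proportional S cchi chi1 chi2 rz BA eB rr.
have [t tE] := cell_relation_proportional S cchi chi1 chi2 rz BA eB ri.
exists (Complex s t) => w wA; have := sE _ wA; have := tE _ wA.
case: (beta w) => x x' /= -> ->; apply/eqP; rewrite eq_complex /=.
by rewrite !mulr0 subr0 add0r !eqxx.
Qed.

Definition gap w := e w - affine_form y b w.

Lemma gap_ge0 w : w \in A -> 0 <= gap w.
Proof. by move=> /(set_cell_le S); rewrite subr_ge0. Qed.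

Lemma gap_eq0 w : w \in A -> (gap w == 0) = (w \in C).
Proof.
move=> wA; rewrite subr_eq0; apply/eqP/idP => [|/(set_cell_eq S)//].
exact: (cell_eq_circuit S cchi chi1 chi2 (root_zero (F := R))).
Qed.

Lemma gap_gt0 w : w \in A -> w \notin C -> 0 < gap w.
Proof. by move=> wA wC; rewrite lt_neqAle eq_sym gap_eq0// wC gap_ge0. Qed.

Variables (p : 'M[K]_(N, 3)) (xi : 'M[R[i]]_(N, 3)) (alpha : 'rV[int]_3 -> R[i]).
Hypothesis lead_p : forall i j, lead (p i j) (xi i j) (- (M i * v 0 j)).
Hypothesis xi_neq0 : forall i j, xi i j != 0.
Hypothesis alpha_neq0 : forall w, w \in A -> alpha w != 0.
Implicit Types (f g : 'rV[int]_3 -> K) (w : 'rV[int]_3) (Z : 'rV[R[i]]_3).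

Definition through f := forall i, laurent_eval A f (row i p) = 0.
Definition order_ge f := forall w, w \in A -> vge (e w) (f w).
Definition matching f := forall w, w \in A -> lead (f w) (alpha w) (e w).

Lemma matching_order f : matching f -> order_ge f.
Proof. by move=> mf w /mf[]. Qed.

Lemma throughD f g : through f -> through g -> through (fun w => f w + g w).
Proof.
move=> tf tg i; rewrite /laurent_eval; under eq_bigr do rewrite mulrDl.
by rewrite big_split/= [X in X + _]tf [X in _ + X]tg addr0.
Qed.

Lemma throughZ c f : through f -> through (fun w => c * f w).
Proof.
move=> tf i; rewrite /laurent_eval; under eq_bigr do rewrite -mulrA.
by rewrite -mulr_sumr [X in _ * X]tf mulr0.
Qed.

Lemma lead_point i w : lead (monomial (row i p) w) (monomial (row i xi) w) (- (M i * h w)).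
Proof.
have -> : - (M i * h w) = \sum_(j < 3) (w 0 j)%:~R * - (M i * v 0 j).
  rewrite /height mulr_sumr -sumrN; apply: eq_bigr => j _.
  by rewrite mulrCA mulrN.
rewrite (eq_bigr (fun j => (w 0 j)%:~R * (\row_j - (M i * v 0 j)) 0 j)) => [|j _]; last by rewrite mxE.
by apply: lead_monomial => j; rewrite !mxE.
Qed.

(* At a marked point only the two monomials of the edge contribute to the
   leading term. *)
Lemma residue_edge_constant f : through f -> order_ge f ->
  forall i, f (u i) (e (u i)) * monomial (row i xi) (u i) +
            f (u' i) (e (u' i)) * monomial (row i xi) (u' i) = 0.
Proof.
move=> tf ordf i; pose c w := f w (e w) * monomial (row i xi) w.
pose Q := e (u i) - M i * h (u i).
have lf w : w \in A -> lead (f w * monomial (row i p) w) (c w) (e w - M i * h w).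
  by move=> wA; apply: leadM (lead_point i w); split; last exact: ordf.
have uA := set_edge_fst S i; have u'A := set_edge_snd S i.
have Qle w : w \in A -> Q <= e w - M i * h w by move=> /(set_tight_fst S i); rewrite /Q; lra.
have uu' : u' i != u i.
  by apply/eqP => uE; have := set_edge_lt S i; rewrite uE ltxx.
pose c' w := if (w == u i) || (w == u' i) then c w else 0.
have lf' w : w \in A -> lead (f w * monomial (row i p) w) (c' w) Q.
  move=> wA; have := lf w wA; rewrite /c'; case: ifPn => [/orP[] /eqP -> //|].
    by have -> // : e (u' i) - M i * h (u' i) = Q by have := set_tight_eq S i; rewrite /Q; lra.
  rewrite negb_or => /andP[wu wu'] [_ vf]; apply: lead_gt vf _.
  rewrite lt_neqAle Qle// andbT; apply/eqP => tQ.
  have [|wE|wE] := tight_pair S wA (_ : M i * h w - e w = M i * h (u i) - e (u i)).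
  - by rewrite /Q in tQ; lra.
  - by rewrite wE eqxx in wu.
  - by rewrite wE eqxx in wu'.
have := lead_eq0 (lead_sum lf') (tf i).
rewrite (big_fsetD1 (u i))//= (big_fsetD1 (u' i))/=; last by rewrite !inE uu' u'A.
rewrite big1_seq ?addr0 => [|w /=]; first by rewrite /c' !eqxx orbT.
by rewrite !inE => /and3P[/negbTE wu' /negbTE wu _]; rewrite /c' wu wu'.
Qed.

Variable f0 : 'rV[int]_3 -> K.
Hypothesis through_f0 : through f0.
Hypothesis matching_f0 : matching f0.

(** At a marked point the leading coefficients of [f] and of [f0] satisfy the same two-term linear
    equation, so their quotient is the same at both ends of the edge. *)
Lemma edge_constant_quotient f : through f -> order_ge f ->
  edge_constant u u' (fun w => f w (e w) / alpha w).
Proof.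
move=> tf ordf i; have := residue_edge_constant tf ordf i.
have := residue_edge_constant through_f0 (matching_order matching_f0) i.
have uA := set_edge_fst S i; have u'A := set_edge_snd S i.
rewrite (lead_at (matching_f0 uA)) (lead_at (matching_f0 u'A)).
have a0 := alpha_neq0 uA; have a'0 := alpha_neq0 u'A.
have m0 w : monomial (row i xi) w != 0 by apply: monomial_neq0 => j; rewrite mxE.
move=> /eqP; rewrite addr_eq0 => /eqP aE /eqP; rewrite addr_eq0 => /eqP fE.
apply: (mulIf a0); rewrite divfK//; apply: (mulIf (m0 (u i))).
by rewrite fE -mulrA aE mulrN mulrA divfK.
Qed.

(** Rescaling by a power of [t] makes some coefficient nonzero exactly at its prescribed exponent,
    so that a nonzero polynomial has a nonzero residue function. *)
Lemma normalize_order f : (exists2 w, w \in A & f w != 0) ->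
  exists q, order_ge (fun w => tpow R q * f w) /\
    exists2 w, w \in A & (tpow R q * f w) (e w) != 0.
Proof.
move=> [w wA fw]; have [|q [vq [w' w'A fw']]] := @vge_min R _ A (fun w => tpow R (- e w) * f w).
  by exists w; rewrite // mulf_neq0// tpow_neq0.
exists (- q); split=> [x xA r rx|].
  by have := vq x xA (r + q - e x); rewrite !tpowM_coef !opprK subrK => ->//; lra.
by exists w'; rewrite // tpowM_coef opprK addrC; move: fw'; rewrite tpowM_coef opprK.
Qed.

(** After normalisation the residues divided by [alpha] are edge-constant and vanish at both roots,
    hence everywhere, against the normalisation. *)
Lemma pencil_eq0 f : through f -> f r1 = 0 -> f r2 = 0 -> forall w, w \in A -> f w = 0.
Proof.
move=> tf f1 f2 w wA; apply: contrapT => fw.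
have [|q [oq [x xA fx]]] := @normalize_order f; first by exists w => //; exact/eqP.
have := edge_constant_quotient (throughZ (tpow R q) tf) oq.
move=> /root_zero rz; move/eqP: fx; apply; apply: (mulIf (_ : (alpha x)^-1 != 0)).
  by rewrite invr_eq0 alpha_neq0.
by rewrite mul0r; apply: rz => //; rewrite ?f1 ?f2 mulr0 pcoef0 mul0r.
Qed.

Lemma exists_pencil_direction : exists f1, [/\ through f1, forall w, w \notin A -> f1 w = 0, f1 r1 = 0 &
  forall w, w \in A -> lead (f1 w) (alpha w * toC (chi w)) (e w)].
Proof.
pose c (i : 'I_N.+1) w : K := if unlift ord0 i is Some j then monomial (row j p) w else (w == r1)%:R.
have [|x [xA x0 cx]] := @underdetermined K _ A N.+1 (fset_uniq A) c.
  by have -> : size A = N.+2 by exact: (set_card S).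
have x1 : x r1 = 0 by have := cx ord0; rewrite /c unlift_none sum_indicator.
have tx : through x.
  move=> i; have := cx (lift ord0 i); rewrite /c liftK => <-.
  by apply: eq_bigr => w _; rewrite mulrC.
have [q [oq [w wA fw]]] := normalize_order xA; pose g w := tpow R q * x w.
have tg : through g by exact: throughZ.
have eg := edge_constant_quotient tg oq; pose psi w := g w (e w) / alpha w.
have psi1 : psi r1 = 0 by rewrite /psi /g x1 mulr0 pcoef0 mul0r.
have psi2 : psi r2 != 0.
  apply/eqP => psi2; move/eqP: fw; apply; apply: (mulIf (_ : (alpha w)^-1 != 0)).
    by rewrite invr_eq0 alpha_neq0.
  by rewrite mul0r; exact: (root_zero eg).
exists (fun w => cst (psi r2)^-1 * g w); split=> [|w' w'A||w' w'A].
- exact: throughZ.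
- by rewrite /g x0// !mulr0.
- by rewrite /g x1 !mulr0.
split; last by apply: vge_cstM; exact: oq.
have : (psi r2)^-1 * psi w' - toC (chi w') = 0.
  apply: (root_zero (psi := fun w => (psi r2)^-1 * psi w - toC (chi w))) => //.
  - by move=> i; rewrite cchi; congr (_ * _ - _); exact: eg.
  - by rewrite psi1 mulr0 chi1 rmorph0 subr0.
  - by rewrite mulVf// chi2 rmorph1 subrr.
move=> /eqP; rewrite subr_eq0 => /eqP <-; rewrite cstM_coef /psi.
by rewrite [RHS]mulrC -mulrA divfK// alpha_neq0.
Qed.

Variable f1 : 'rV[int]_3 -> K.
Hypothesis through_f1 : through f1.
Hypothesis f1_r1 : f1 r1 = 0.
Hypothesis lead_f1 : forall w, w \in A -> lead (f1 w) (alpha w * toC (chi w)) (e w).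

Definition pencil (theta : K) w := f0 w + theta * f1 w.

Lemma through_pencil theta : through (pencil theta).
Proof. by apply: throughD => //; exact: throughZ. Qed.

Lemma matching_pencil theta : lead theta 0 0 -> matching (pencil theta).
Proof.
move=> lt w wA; rewrite -[alpha w]addr0; apply: leadD (matching_f0 wA) _.
by rewrite -[X in lead _ X](mul0r (alpha w * toC (chi w))) -[X in lead _ _ X]add0r; apply: leadM lt (lead_f1 wA).
Qed.

(** The two roots serve as coordinates: [f1] vanishes at [r1], so [c] is read off there, and [c']
    from what remains at [r2]. As [f] and [f0] have equal leading terms, [c] has leading term 1 and
    [c'] is infinitesimal. *)
Lemma pencil_coordinates f : through f -> matching f ->
  exists l theta, [/\ l != 0, lead theta 0 0 & forall w, w \in A -> f w = l * pencil theta w].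
Proof.
move=> tf mf; pose c := f r1 / f0 r1.
have a1 := alpha_neq0 r1A; have a2 := alpha_neq0 r2A.
have f0r1 : f0 r1 != 0 := lead_neq0 (matching_f0 r1A) a1.
have lc : lead c 1 0.
  by have := leadM (mf _ r1A) (leadV (matching_f0 r1A) a1); rewrite divff// subrr.
have c0 : c != 0 := lead_neq0 lc (oner_neq0 _).
have lf12 : lead (f1 r2) (alpha r2) (e r2).
  by have := lead_f1 r2A; rewrite chi2 rmorph1 mulr1.
have f12 : f1 r2 != 0 := lead_neq0 lf12 a2.
pose c' := (f r2 - c * f0 r2) / f1 r2.
have lc' : lead c' 0 0.
  have l1 := leadM lc (matching_f0 r2A); rewrite mul1r add0r in l1.
  have := leadM (leadB (mf _ r2A) l1) (leadV lf12 a2).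
  by rewrite subrr mul0r subrr.
have lt : lead (c' / c) 0 0.
  by have := leadM lc' (leadV lc (oner_neq0 _)); rewrite mul0r oppr0 addr0.
pose th := c' / c; have thc : c * th = c' by rewrite /th mulrC divfK.
exists c, th; split=> // w wA.
have tg : through (fun w => f w + - c * pencil th w).
  by apply: throughD => //; apply: throughZ; exact: through_pencil.
have cE x : c * pencil th x = c * f0 x + c' * f1 x by rewrite /pencil mulrDr mulrA thc.
have g1 : f r1 + - c * pencil th r1 = 0.
  by rewrite mulNr cE f1_r1 mulr0 addr0 /c divfK// subrr.
have g2 : f r2 + - c * pencil th r2 = 0.
  by rewrite mulNr cE [c' * _]divfK//; ring.
by have /eqP := pencil_eq0 tg g1 g2 wA; rewrite mulNr subr_eq0 => /eqP.
Qed.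

Lemma singular_relation (F : fieldType) (B : {fset 'rV[int]_3}) (c : 'rV[int]_3 -> F) (z : 'rV[F]_3) :
  (B `<=` A)%fset -> (forall j, z 0 j != 0) ->
  singular_at B c z <-> relation A B (fun w => if w \in B then c w * monomial z w else 0).
Proof.
move=> BA z0; rewrite singular_atP//.
have sumE (g : 'rV[int]_3 -> F) : \sum_(w <- A) (if w \in B then g w else 0) = \sum_(w <- B) g w.
  rewrite -(big_fset_incl _ BA) => [|w _ /negbTE -> //].
  by apply: eq_big_seq => w ->.
have sumEj j : \sum_(w <- A) (if w \in B then c w * monomial z w else 0) * (w 0 j)%:~R =
    \sum_(w <- B) c w * monomial z w * (w 0 j)%:~R.
  by rewrite -sumE; apply: eq_bigr => w _; case: ifP => _ //; rewrite mul0r.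
split=> [[s0 sj]|[_ s0 sj]]; first split=> [w /negbTE -> //||j].
- by rewrite sumE.
- by rewrite sumEj.
- by split=> [|j]; [rewrite -sumE|rewrite -sumEj].
Qed.

Definition circuit_coef Z w := if w \in C then alpha w * monomial Z w else 0.

(** The equations of a singular point say that the terms of the circuit polynomial form a relation
    on [C], and such relations are the multiples of [lambda]. *)
Lemma circuit_coefP Z : singular_at C alpha Z ->
  exists2 t, t != 0 & forall w, w \in A -> circuit_coef Z w = t * toC (lambda w).
Proof.
move=> sZ; have [Z0 _ _] := sZ.
have [rel _] := singular_relation alpha (set_circuit_sub S) Z0.
have [t tE] := complex_cell_relation (set_circuit_sub S) (set_cell_eq S) (rel sZ).
exists t => //; apply/eqP => t0; have [w wC _] := circuit_neq0 S.
have := tE _ (CA wC); rewrite t0 mul0r wC => /eqP.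
by rewrite mulf_eq0 (negbTE (alpha_neq0 (CA wC))) (negbTE (monomial_neq0 w Z0)).
Qed.

(** On the terms of least order at [z] the exponents are affine and the leading coefficients form a
    relation. It is a multiple of [lambda] and has no zero on these terms, so they are exactly those
    of [C]; spanning then identifies the orders of [z]. *)
Lemma singular_point f z : matching f -> singular_at A f z ->
  exists Z, [/\ singular_at C alpha Z, forall j, Z 0 j != 0 & forall j, lead (z 0 j) (Z 0 j) (- y j)].
Proof.
move=> mf sz; have [z0 _ _] := sz.
have oz j : {q | z 0 j q != 0 /\ vge q (z 0 j)} by apply/cid; exact: exists_order.
pose o j := sval (oz j); pose Z : 'rV[R[i]]_3 := \row_j z 0 j (o j).
have Z0 j : Z 0 j != 0 by rewrite mxE /o; case: (oz j) => q [].
have lz j : lead (z 0 j) (Z 0 j) ((\row_j o j) 0 j).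
  by rewrite !mxE /o; case: (oz j) => q [/= _ vq]; split.
pose ord w := e w + \sum_(j < 3) (w 0 j)%:~R * o j.
have lfz w : w \in A -> lead (f w * monomial z w) (alpha w * monomial Z w) (ord w).
  move=> wA; have := leadM (mf _ wA) (lead_monomial w lz Z0).
  by rewrite /ord; under [X in lead _ _ (_ + X)]eq_bigr do rewrite mxE.
have [w0 w0A omin] : exists2 w0, w0 \in A & forall w, w \in A -> ord w0 <= ord w.
  case: (@arg_minP _ rat A [` r1A]%fset xpredT (fun w : A => ord (fsval w)) isT) => w0 _ wmin.
  by exists (val w0) => [|w wA]; [exact: valP|exact: (wmin [` wA]%fset)].
pose B := [fset w in A | ord w == ord w0]%fset.
have BA : (B `<=` A)%fset by apply/fsubsetP => w; rewrite !inE => /andP[].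
pose beta w := if w \in B then alpha w * monomial Z w else 0.
have lB w : w \in A -> lead (f w * monomial z w) (beta w) (ord w0).
  move=> wA; rewrite /beta !inE wA /=; case: eqP => [<-|ne]; first exact: lfz.
  by have [_ vw] := lfz _ wA; apply: lead_gt vw _; rewrite lt_neqAle omin// andbT eq_sym; exact/eqP.
have [s0 sj] : singular_at A f z <-> _ := singular_atP A f z0.
have {s0 sj} [e0 ej] := s0 sz.
have rB : relation A B beta.
  split=> [w /negbTE wB||j]; first by rewrite /beta wB.
    exact: lead_eq0 (lead_sum lB) e0.
  apply: lead_eq0 (ej j); have := @lead_sum R _ A (fun w => f w * monomial z w * (w 0 j)%:~R)
    (fun w => beta w * (w 0 j)%:~R) (ord w0); apply => w wA.
  by rewrite mulrC [X in lead _ X]mulrC; apply: lead_intM; exact: lB.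
have eB w : w \in B -> e w = affine_form (fun j => - o j) (ord w0) w.
  rewrite !inE => /andP[_ /eqP <-]; rewrite /affine_form /ord.
  have -> : \sum_(j < 3) - o j * (w 0 j)%:~R = - \sum_(j < 3) (w 0 j)%:~R * o j.
    by rewrite -sumrN; apply: eq_bigr => j _; rewrite mulNr mulrC.
  by rewrite addrCA addNr addr0.
have [t tE] := complex_cell_relation BA eB rB.
have w0B : w0 \in B by rewrite !inE w0A /=.
have bB w : w \in B -> beta w != 0.
  by move=> wB; rewrite /beta wB mulf_neq0 ?monomial_neq0// alpha_neq0// (fsubsetP BA).
have t0 : t != 0.
  by apply: contra_neq (bB _ w0B) => t0; rewrite tE// t0 mul0r.
have BC : B = C.
  apply/fsetP => w; apply/idP/idP => [wB|wC].
    apply: contraT => wC; have := bB _ wB; rewrite tE ?(fsubsetP BA)//.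
    by rewrite lambda_out// rmorph0 mulr0 eqxx.
  apply: contraT => wB; have := tE _ (CA wC); rewrite /beta (negbTE wB) => /esym/eqP.
  by rewrite mulf_eq0 (negbTE t0) fmorph_eq0 (negbTE (set_relation_neq0 S wC)).
rewrite BC in eB; have [oy _] : (forall j, y j - - o j = 0) /\ b - ord w0 = 0.
  apply: (set_spanning S rat) => w wC.
  have := eB _ wC; rewrite (set_cell_eq S wC) /affine_form => E.
  by under eq_bigr do rewrite mulrBl; rewrite sumrB; lra.
exists Z; split=> // [|j].
  apply/(singular_relation alpha (set_circuit_sub S) Z0).
  by move: rB; rewrite /beta BC.
have := lz j; rewrite [X in lead _ _ X]mxE; suff -> : o j = - y j by [].
by have := oy j; lra.
Qed.

Definition base_point Z : 'rV[K]_3 := \row_j (cst (Z 0 j) * tpow R (- y j)).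
Lemma base_pointM Z Z' :
  base_point (hadamard Z Z') = hadamard (base_point Z) (\row_j cst (Z' 0 j)).
Proof. by apply/rowP => j; rewrite !mxE cstM mulrAC. Qed.

(** The coefficients in coordinates centred at [base_point Z], divided by [t^b]: for a matching [f]
    the order at [w] is [gap w], which is zero exactly on the circuit. *)
Definition normal f Z w := f w * monomial (base_point Z) w * tpow R (- b).

Lemma normalM f Z Z' w : normal f (hadamard Z Z') w = normal f Z w * cst (monomial Z' w).
Proof.
rewrite /normal base_pointM monomialM -cst_monomial.
by rewrite [f w * (_ * _)]mulrA mulrAC.
Qed.

Lemma lead_normal f Z w c : (forall j, Z 0 j != 0) -> lead (f w) c (e w) ->
  lead (normal f Z w) (c * monomial Z w) (gap w).
Proof.
move=> Z0 lf; have lb j : lead (base_point Z 0 j) (Z 0 j) ((\row_j - y j) 0 j).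
  by have := leadM (lead_cst (Z 0 j)) (lead_tpow R (- y j)); rewrite mulr1 add0r !mxE.
have := leadM (leadM lf (lead_monomial w lb Z0)) (lead_tpow R (- b)); rewrite mulr1.
have -> // : e w + \sum_(j < 3) (w 0 j)%:~R * (\row_j0 - y j0) 0 j + - b = gap w.
rewrite /gap /affine_form opprD addrA; congr (_ + _ + _); rewrite -sumrN.
by apply: eq_bigr => j _; rewrite mxE mulrN mulrC.
Qed.

Lemma lead_normal0 f Z w c : w \in A -> (forall j, Z 0 j != 0) -> lead (f w) c (e w) ->
  lead (normal f Z w) (if w \in C then c * monomial Z w else 0) 0.
Proof.
move=> wA Z0 /(lead_normal Z0); case: ifPn => [|wC [_ vg]].
  by rewrite -gap_eq0// => /eqP ->.
by apply: lead_gt vg _; exact: gap_gt0.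
Qed.

Variable d : nat.
Hypothesis shift_ge0 : forall w, w \in A -> forall j, (0 <= w 0 j + d%:Z)%R.

Definition near_point Z (eta : 'I_3 -> K) : 'rV[K]_3 :=
  hadamard (base_point Z) (\row_j (1 + eta j)).

Lemma near_point_neq0 Z eta j : (forall j, Z 0 j != 0) -> (forall j, lead (eta j) 0 0) ->
  near_point Z eta 0 j != 0.
Proof.
move=> Z0 le; rewrite !mxE !mulf_neq0 ?tpow_neq0 ?cst_eq0//.
exact: lead_neq0 (lead_1D (le j)) (oner_neq0 _).
Qed.

Lemma singular_near_point f Z eta : (forall j, Z 0 j != 0) -> (forall j, lead (eta j) 0 0) ->
  singular_at A f (near_point Z eta) <-> singular_system A d (normal f Z) eta.
Proof.
move=> Z0 le; rewrite singular_atP; last by move=> j; exact: near_point_neq0.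
have e10 j : 1 + eta j != 0 := lead_neq0 (lead_1D (le j)) (oner_neq0 _).
pose s := tpow R b / \prod_(j < 3) (1 + eta j) ^+ d.
have P0 : \prod_(j < 3) (1 + eta j) ^+ d != 0.
  by apply/prodf_neq0 => j _; rewrite expf_neq0.
have tb : tpow R b * tpow R (- b) = 1 by rewrite -tpowD subrr tpow0.
have s0 : s != 0 by rewrite mulf_neq0 ?tpow_neq0// invr_eq0.
have fE w : w \in A -> f w * monomial (near_point Z eta) w =
    s * (normal f Z w * shifted_monomial d w eta).
  move=> wA; rewrite monomialM monomial_shift//; last exact: shift_ge0.
  rewrite /normal /s; set Q := \prod_(j < 3) _ in P0 *.
  set m := monomial _ w; set m' := monomial _ w.
  have QV : Q^-1 * Q = 1 by exact: mulVf.
  have -> : f w * (m * m') = tpow R b * tpow R (- b) * (Q^-1 * Q) * (f w * (m * m')).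
    by rewrite tb QV mulr1 mul1r.
  by ring.
have E0 : \sum_(w <- A) f w * monomial (near_point Z eta) w =
    s * \sum_(w <- A) normal f Z w * shifted_monomial d w eta.
  by rewrite mulr_sumr; apply: eq_big_seq => w /fE.
have Ej j : \sum_(w <- A) f w * monomial (near_point Z eta) w * (w 0 j)%:~R =
    s * \sum_(w <- A) normal f Z w * shifted_monomial d w eta * (w 0 j)%:~R.
  by rewrite mulr_sumr; apply: eq_big_seq => w /fE ->; rewrite !mulrA.
split=> [[h0 hj]|[h0 hj]]; split=> [|j].
- by apply: (mulfI s0); rewrite -E0 h0 mulr0.
- by apply: (mulfI s0); rewrite -Ej hj mulr0.
- by rewrite E0 h0 mulr0.
- by rewrite Ej hj mulr0.
Qed.

Lemma near_pointP Z (z : 'rV[K]_3) : (forall j, Z 0 j != 0) -> (forall j, lead (z 0 j) (Z 0 j) (- y j)) ->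
  exists2 eta, forall j, lead (eta j) 0 0 & z = near_point Z eta.
Proof.
move=> Z0 lz; have lb j : lead (base_point Z 0 j) (Z 0 j) (- y j).
  by rewrite mxE; have := leadM (lead_cst (Z 0 j)) (lead_tpow R (- y j)); rewrite mulr1 add0r.
have b0 j : base_point Z 0 j != 0 := lead_neq0 (lb j) (Z0 j).
exists (fun j => z 0 j / base_point Z 0 j - 1) => [j|].
  have := leadM (lz j) (leadV (lb j) (Z0 j)); rewrite subrr divff// => l1.
  by have := leadB l1 (lead_cst 1); rewrite subrr.
apply/rowP => j; rewrite [RHS]mxE [X in _ * X]mxE.
by rewrite [1 + _]addrC subrK mulrC divfK.
Qed.

Lemma circuit_coef_relation Z : singular_at C alpha Z -> relation A C (circuit_coef Z).
Proof.
move=> sZ; have [Z0 _ _] := sZ.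
by have [rel _] := singular_relation alpha (set_circuit_sub S) Z0; exact: rel.
Qed.

(** For a kernel vector [x], the circuit coefficients times the linear form of [x] are again a
    relation on [C], hence proportional to [lambda]; so the form is constant on [C], and spanning
    makes it zero. *)
Lemma circuit_nondegenerate Z : singular_at C alpha Z -> hessian_nondegenerate A (circuit_coef Z).
Proof.
move=> sZ x hx; have [t t0 tE] := circuit_coefP sZ.
have [b0 b1 bj] := circuit_coef_relation sZ.
pose xw w := \sum_(j < 3) x j * (w 0 j)%:~R.
have rg : relation A C (fun w => circuit_coef Z w * xw w).
  split=> [w /b0 ->||k]; first by rewrite mul0r.
    under eq_bigr do rewrite mulr_sumr.
    rewrite exchange_big big1// => j _; under eq_bigr do rewrite mulrCA.
    by rewrite -mulr_sumr bj mulr0.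
  by rewrite -[RHS](hx k); apply: eq_bigr => w _; rewrite mulrAC.
have [t' tE'] := complex_cell_relation (set_circuit_sub S) (set_cell_eq S) rg.
have [|//] := set_spanning S R[i] x (- (t' / t)).
move=> w wC; have := tE' _ (CA wC); rewrite tE ?CA// mulrAC => /mulIf.
rewrite fmorph_eq0 (set_relation_neq0 S wC) => /(_ isT) E.
apply: (mulfI t0); rewrite /affine_form mulr0 mulrDr -/(xw w) E.
by rewrite mulrN mulrC divfK// subrr.
Qed.

Lemma lead_normal_matching f Z w : matching f -> (forall j, Z 0 j != 0) -> w \in A ->
  lead (normal f Z w) (circuit_coef Z w) 0.
Proof. by move=> mf Z0 wA; apply: lead_normal0 => //; exact: mf. Qed.

Lemma sum_chi_circuit_coef Z : singular_at C alpha Z ->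
  \sum_(w <- A) toC (chi w) * circuit_coef Z w != 0.
Proof.
move=> sZ; have [t t0 tE] := circuit_coefP sZ.
have -> : \sum_(w <- A) toC (chi w) * circuit_coef Z w = t * toC (chi_sum A lambda chi).
  rewrite /chi_sum rmorph_sum mulr_sumr; apply: eq_big_seq => w wA.
  by rewrite tE// rmorphM/= mulrCA [toC (chi w) * _]mulrC.
by rewrite mulf_neq0// fmorph_eq0 (chi_sum_neq0 S cchi chi1 chi2 (root_zero (F := R))).
Qed.

(** If [theta' - theta] has order [q], the perturbation has at order [q] the value of its leading
    coefficient times the nonzero sum attached to [chi], whereas [perturbation_value] makes it
    vanish. *)
Lemma pencil_singular_unique Z theta theta' eta eta' : singular_at C alpha Z ->
  lead theta 0 0 -> lead theta' 0 0 ->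
  (forall j, lead (eta j) 0 0) -> (forall j, lead (eta' j) 0 0) ->
  singular_system A d (normal (pencil theta) Z) eta ->
  singular_system A d (normal (pencil theta') Z) eta' -> theta = theta'.
Proof.
move=> sZ lt lt' le le' s1 s2; have [Z0 _ _] := sZ.
apply: contrapT => tt'.
have [|q [tq vq]] := @exists_order R (theta' - theta).
  by rewrite subr_eq0 eq_sym; exact/eqP.
have [t0 vt] := leadB lt' lt; rewrite subr0 in t0.
have q0 : 0 < q.
  have [//|q0|q0] := ltgtP 0 q; first by move: tq; rewrite vt// eqxx.
  by move: tq; rewrite -q0 t0 eqxx.
have dE w : normal (pencil theta') Z w - normal (pencil theta) Z w =
    (theta' - theta) * normal f1 Z w by rewrite /normal /pencil; ring.
have l1 w : w \in A -> lead (normal f1 Z w) (toC (chi w) * circuit_coef Z w) 0.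
  move=> wA; have := lead_normal0 wA Z0 (lead_f1 wA); rewrite /circuit_coef.
  by case: ifP => _; rewrite ?mulr0// mulrAC mulrC.
have vd w : w \in A -> vge q (normal (pencil theta') Z w - normal (pencil theta) Z w).
  by move=> wA; rewrite dE -[q]addr0; apply: vgeM => //; case: (l1 w wA).
have := perturbation_value shift_ge0 (circuit_nondegenerate sZ) q0
  (fun w => lead_normal_matching (matching_pencil lt) Z0) vd le le' s1 s2.
have -> : \sum_(w <- A) (normal (pencil theta') Z w - normal (pencil theta) Z w) q =
    (theta' - theta) q * \sum_(w <- A) toC (chi w) * circuit_coef Z w.
  rewrite mulr_sumr; apply: eq_big_seq => w wA; have [c1 v1] := l1 w wA.
  by rewrite dE -[in LHS](addr0 q) (pcoefM_lead vq v1) c1.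
by move/eqP; rewrite mulf_eq0 (negbTE tq) (negbTE (sum_chi_circuit_coef sZ)).
Qed.

Hypothesis A_generates : differences_generate A.

Lemma character_trivial (z : 'rV[R[i]]_3) k : (forall j, z 0 j != 0) ->
  (forall w, w \in A -> monomial z w = k) -> forall j, z 0 j = 1.
Proof.
move=> z0 zk j; pose H := [set w : 'rV[int]_3 | monomial z w = 1].
have HT : H = setT.
  apply: A_generates => [|w w' /= hw hw'|w w' wA w'A]; rewrite /H/=.
  - exact: monomial0.
  - by rewrite monomialD// monomialN hw hw' invr1 mulr1.
  - rewrite monomialD// monomialN !zk// divff//.
    by rewrite -(zk _ wA) monomial_neq0.
by have : H (delta_mx 0 j) by [rewrite HT|]; rewrite /H/= monomial_delta.
Qed.

Lemma circuit_ratio Z Z' : singular_at C alpha Z -> singular_at C alpha Z' ->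
  exists (zeta : 'rV[R[i]]_3) k, [/\ forall j, zeta 0 j != 0, Z' = hadamard Z zeta, k != 0 &
    forall w, w \in C -> monomial zeta w = k].
Proof.
move=> sZ sZ'; have [Z0 _ _] := sZ; have [Z'0 _ _] := sZ'.
pose zeta : 'rV[R[i]]_3 := \row_j (Z' 0 j / Z 0 j).
have zeta0 j : zeta 0 j != 0 by rewrite mxE mulf_neq0// invr_eq0.
have ZE : Z' = hadamard Z zeta by apply/rowP => j; rewrite !mxE mulrC divfK.
have [t t0 tE] := circuit_coefP sZ; have [t' t'0 tE'] := circuit_coefP sZ'.
pose k := t' / t; have k0 : k != 0 by rewrite mulf_neq0// invr_eq0.
have zC w : w \in C -> monomial zeta w = k.
  move=> wC; have := tE _ (CA wC); have := tE' _ (CA wC).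
  rewrite /circuit_coef wC ZE monomialM => E' E.
  have tl : t * toC (lambda w) != 0.
    by rewrite mulf_neq0// fmorph_eq0 (set_relation_neq0 S wC).
  by apply: (mulfI tl); rewrite -{1}E -mulrA E' /k; field.
by exists zeta, k.
Qed.

(* For two singularities of the same surface the coefficients differ by a
   nontrivial character; the nearest monomial outside the circuit on which it is
   nontrivial contradicts the second order bound. *)
Lemma singular_residue_unique f Z Z' eta eta' : matching f ->
  singular_at C alpha Z -> singular_at C alpha Z' ->
  (forall j, lead (eta j) 0 0) -> (forall j, lead (eta' j) 0 0) ->
  singular_system A d (normal f Z) eta -> singular_system A d (normal f Z') eta' -> Z = Z'.
Proof.
move=> mf sZ sZ' le le' s1 s2; have [Z0 _ _] := sZ; have [Z'0 _ _] := sZ'.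
have [zeta [k [zeta0 ZE k0 zC]]] := circuit_ratio sZ sZ'.
suff zA w : w \in A -> monomial zeta w = k.
  by apply/rowP => j; rewrite ZE mxE (character_trivial zeta0 zA) mulr1.
move=> wA; apply: contrapT => zw.
pose B := [fset w in A | monomial zeta w != k]%fset.
have wB : w \in B by rewrite !inE wA; exact/eqP.
have [w0 w0B wmin] : exists2 w0, w0 \in B & forall x, x \in B -> gap w0 <= gap x.
  case: (@arg_minP _ rat B [` wB]%fset xpredT (fun x : B => gap (fsval x)) isT) => x _ xmin.
  by exists (val x) => [|x' x'B]; [exact: valP|exact: (xmin [` x'B]%fset)].
have BC x : x \in B -> x \in A /\ x \notin C.
  rewrite !inE => /andP[xA xk]; split=> //; apply: contra xk => /zC ->; exact: eqxx.
have [w0A w0C] := BC _ w0B; have q0 := gap_gt0 w0A w0C.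
have baseE x : normal f Z' x = normal f Z x * cst (monomial zeta x).
  by rewrite {1}ZE normalM.
(* Division by [k] makes the coefficients for [Z'] agree with those for [Z] outside [B], in
   particular on [C]. *)
pose a' x := cst k^-1 * normal f Z' x.
have aE x : a' x - normal f Z x = cst (monomial zeta x / k - 1) * normal f Z x.
  by rewrite /a' baseE cstD cstM cstN cst1; ring.
have s2' : singular_system A d a' eta' by exact: singular_systemZ.
have vd x : x \in A -> vge (gap w0) (a' x - normal f Z x).
  move=> xA; rewrite aE; have [xk|xk] := eqVneq (monomial zeta x) k.
    by rewrite xk divff// subrr cst0 mul0r; exact: vge_0.
  have xB : x \in B by rewrite !inE xA.
  by apply: vge_cstM; have [_] := lead_normal Z0 (mf _ xA); apply: vgeW; exact: wmin.
have := perturbation_value shift_ge0 (circuit_nondegenerate sZ) q0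
  (fun x => lead_normal_matching mf Z0) vd le le' s1 s2'.
(* Distances off the circuit are pairwise distinct, so no second monomial contributes at order
   [gap w0]. *)
have tail0 : \sum_(x <- (A `\ w0)%fset) (a' x - normal f Z x) (gap w0) = 0.
  rewrite big1_seq// => x /andP[_]; rewrite !inE => /andP[xw0 xA].
  rewrite aE; have [xk|xk] := eqVneq (monomial zeta x) k.
    by rewrite xk divff// subrr cst0 mul0r pcoef0.
  have xB : x \in B by rewrite !inE xA.
  have [_ xC] := BC _ xB; rewrite cstM_coef.
  have [_ ->] := lead_normal Z0 (mf _ xA); first by rewrite mulr0.
  rewrite lt_neqAle wmin// andbT eq_sym.
  exact: (cell_gap_inj S cchi chi1 chi2 (root_zero (F := R)) xA w0A xC w0C xw0).
have -> : \sum_(x <- A) (a' x - normal f Z x) (gap w0) = (a' w0 - normal f Z w0) (gap w0).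
  rewrite -[RHS]addr0 -[X in _ = _ + X]tail0; exact: (big_fsetD1 w0 w0A).
rewrite aE cstM_coef (lead_at (lead_normal Z0 (mf _ w0A))).
move=> /eqP; rewrite !mulf_eq0 (negbTE (alpha_neq0 w0A)) (negbTE (monomial_neq0 _ Z0)) !orbF.
rewrite subr_eq0 => /eqP E; move: w0B; rewrite !inE => /andP[_ /eqP]; apply.
by rewrite -[LHS](divfK k0) E mul1r.
Qed.

(** As a row, [ord0] is the value equation, and as a column the unknown [theta]; the other indices
    are the logarithmic derivatives and the [eta j]. The summand [d] in the columns comes from the
    shift of the exponents. *)
Let mono_index (w : 'rV[int]_3) (k : 'I_4) : int :=
  if unlift ord0 k is Some j then w 0 j else 1.
Let jacobian_factor (w : 'rV[int]_3) (l : 'I_4) : R[i] :=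
  if unlift ord0 l is Some j then (w 0 j)%:~R + d%:R else toC (chi w).
Let jacobian Z : 'M[R[i]]_4 := \matrix_(k < 4, l < 4)
  \sum_(w <- A) circuit_coef Z w * jacobian_factor w l * (mono_index w k)%:~R.

(** The circuit polynomial is critical at [Z], so the value row reduces to its [theta] entry, a
    nonzero multiple of [chi_sum]; with [theta] gone, the derivative rows reduce to the Hessian. *)
Let jacobian_unit Z : singular_at C alpha Z -> jacobian Z \in unitmx.
Proof.
move=> sZ; have [b0 b1 bj] := circuit_coef_relation sZ.
apply: injective_unitmx => x Jx.
pose G w := toC (chi w) * x ord0 0 + \sum_(j < 3) ((w 0 j)%:~R + d%:R) * x (lift ord0 j) 0.
have xE k : \sum_(w <- A) circuit_coef Z w * (mono_index w k)%:~R * G w = 0.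
  transitivity ((jacobian Z *m x) k 0); last by rewrite Jx mxE.
  rewrite mxE; under [RHS]eq_bigr do rewrite mxE mulr_suml.
  rewrite exchange_big/=; apply: eq_bigr => w _.
  rewrite big_ord_recl /jacobian_factor unlift_none /G mulrDr mulr_sumr; congr (_ + _).
    by ring.
  by apply: eq_bigr => j _; rewrite liftK; ring.
pose xw w := \sum_(j < 3) x (lift ord0 j) 0 * (w 0 j)%:~R.
pose xs := \sum_(j < 3) x (lift ord0 j) 0.
have GE w : G w = x ord0 0 * toC (chi w) + xw w + d%:R * xs.
  rewrite /G /xw /xs mulr_sumr -addrA -big_split/= mulrC; congr (_ + _).
  by apply: eq_bigr => j _; ring.
have x0 : x ord0 0 = 0.
  have := xE ord0; rewrite /mono_index unlift_none.
  have -> : \sum_(w <- A) circuit_coef Z w * 1%:~R * G w =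
      x ord0 0 * (\sum_(w <- A) toC (chi w) * circuit_coef Z w) +
      \sum_(j < 3) x (lift ord0 j) 0 * (\sum_(w <- A) circuit_coef Z w * (w 0 j)%:~R) +
      d%:R * xs * \sum_(w <- A) circuit_coef Z w.
    have -> : \sum_(j < 3) x (lift ord0 j) 0 * (\sum_(w <- A) circuit_coef Z w * (w 0 j)%:~R) =
        \sum_(w <- A) circuit_coef Z w * xw w.
      under eq_bigr do rewrite mulr_sumr; rewrite exchange_big/=; apply: eq_bigr => w _.
      by rewrite mulr_sumr; apply: eq_bigr => j _; ring.
    rewrite !mulr_sumr -!big_split/=; apply: eq_bigr => w _.
    by rewrite GE -mulr_sumr -/xs; ring.
  rewrite b1 mulr0 addr0 [X in _ + X]big1 ?addr0; last by move=> j _; rewrite bj mulr0.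
  by move=> /eqP; rewrite mulf_eq0 (negbTE (sum_chi_circuit_coef sZ)) orbF => /eqP.
have xj : forall j, x (lift ord0 j) 0 = 0.
  apply: (circuit_nondegenerate sZ) => k; rewrite -[RHS](xE (lift ord0 k)).
  rewrite /mono_index liftK; apply/eqP; rewrite -subr_eq0 -sumrB; apply/eqP.
  rewrite (eq_bigr (fun w => - (d%:R * xs) * (circuit_coef Z w * (w 0 k)%:~R))).
    by rewrite -mulr_sumr bj mulr0.
  by move=> w _; rewrite GE x0 -/(xw w); ring.
apply/colP => k; rewrite [RHS]mxE.
by case: (unliftP ord0 k) => [j ->|->]; [exact: xj|exact: x0].
Qed.

Lemma pencil_singular_exists Z : singular_at C alpha Z -> exists theta eta,
  [/\ lead theta 0 0, forall j, lead (eta j) 0 0 &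
      singular_system A d (normal (pencil theta) Z) eta].
Proof.
move=> sZ; have [Z0 _ _] := sZ; have [b0 b1 bj] := circuit_coef_relation sZ.
pose a w := normal f0 Z w; pose a1 w := normal f1 Z w.
have la w : w \in A -> lead (a w) (circuit_coef Z w) 0 := lead_normal_matching matching_f0 Z0.
have la1 w : w \in A -> lead (a1 w) (toC (chi w) * circuit_coef Z w) 0.
  move=> wA; have := lead_normal0 wA Z0 (lead_f1 wA); rewrite /circuit_coef.
  by case: ifP => _; rewrite ?mulr0// mulrAC mulrC.
have [m1 m10 sa] := common_denominator (fun w wA => lead_vge (la w wA)).
have [m2 m20 sa1] := common_denominator (fun w wA => lead_vge (la1 w wA)).
pose m := (m1 * m2)%N; have m0 : (0 < m)%N by rewrite muln_gt0 m10.
have {}sa w : w \in A -> integral_shape m (a w) by move=> /sa; exact: integral_shape_widen.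
have {}sa1 w : w \in A -> integral_shape m (a1 w).
  by move=> /sa1; rewrite /m mulnC; exact: integral_shape_widen.
pose etax (x : 'I_4 -> K) j := x (lift ord0 j).
pose term w k (x : 'I_4 -> K) : K :=
  (a w + x ord0 * a1 w) * shifted_monomial d w (etax x) * (mono_index w k)%:~R.
have apsm w : w \in A -> near_linear m 1 (fun l => if unlift ord0 l is Some j then (w 0 j)%:~R + d%:R else 0)
    (fun x => shifted_monomial d w (etax x)).
  move=> wA; have ap1 j : near_linear m 1 (fun l => (l == lift ord0 j)%:R) (fun x : 'I_4 -> K => 1 + x (lift ord0 j)).
    apply: approx_eq (approxD m0 (approx1 R 4 m0) (approx_coord R m0 (lift ord0 j))) => [|l]; by rewrite ?addr0 ?add0r.
  apply: approx_eq (approx_prod m0 (index_enum 'I_3)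
      (fun j => approxX m0 (absz (w 0 j + d%:Z)) (ap1 j))) => // l.
  case: (unliftP ord0 l) => [j ->|->].
    rewrite (bigD1 j)//= eqxx mulr1 big1 ?addr0 ?(shiftE shift_ge0)// => i ij.
    by rewrite (inj_eq lift_inj) eq_sym (negbTE ij) mulr0.
  by rewrite big1// => j _; rewrite mulr0.
have aterm w k : w \in A -> near_linear m (circuit_coef Z w * (mono_index w k)%:~R)
    (fun l => circuit_coef Z w * jacobian_factor w l * (mono_index w k)%:~R) (term w k).
  move=> wA; have ap0 := approxD m0 (approx_const 4 m0 (sa w wA))
    (approxM m0 (approx_coord R m0 ord0) (approx_const 4 m0 (sa1 w wA))).
  have si : integral_shape m ((mono_index w k)%:~R : K).
    by rewrite -cst_int; exact: shape_cst.
  apply: approx_eq (approxM m0 (approxM m0 ap0 (apsm w wA)) (approx_const 4 m0 si)) => [|l].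
    by rewrite -cst_int coef_cst eqxx (lead_at (la w wA)); ring.
  rewrite -cst_int coef_cst eqxx (lead_at (la w wA)) (lead_at (la1 w wA)) /jacobian_factor.
  case: (unliftP ord0 l) => [j ->|->]; last by rewrite eqxx /=; ring.
  by rewrite eq_sym (negbTE (neq_lift _ _)) /=; ring.
have [|x dx xG] := @hensel R m 4 m0 (jacobian Z) (fun k x => \sum_(w <- A) term w k x) (jacobian_unit sZ).
  move=> k; have at_ := approx_sum m0 (fun w wA => aterm w k wA).
  apply: approx_eq at_ => [|l]; last by rewrite mxE.
  rewrite /mono_index; case: (unliftP ord0 k) => [j _|_]; first exact: bj.
  by under eq_bigr do rewrite mulr1; exact: b1.
have lx l : lead (x l) 0 0 by have [sx x0] := dx l; split=> //; exact: shape_vge0 m0 _ sx.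
exists (x ord0), (etax x); split=> //; first by move=> j; exact: lx.
have nE w : normal (pencil (x ord0)) Z w = a w + x ord0 * a1 w by rewrite /normal /pencil /a /a1 /normal; ring.
split=> [|j].
  rewrite -[RHS](xG ord0); apply: eq_bigr => w _.
  by rewrite /term /mono_index unlift_none mulr1 nE.
by rewrite -[RHS](xG (lift ord0 j)); apply: eq_bigr => w _; rewrite /term /mono_index liftK nE.
Qed.

Lemma singular_at_scale f g l z : l != 0 -> (forall w, w \in A -> f w = l * g w) ->
  singular_at A f z -> singular_at A g z.
Proof.
move=> l0 fg sz; have [z0 _ _] := sz; have [h0 hj] := proj1 (singular_atP A f z0) sz.
apply/(singular_atP A g z0); split=> [|j]; apply: (mulfI l0); rewrite mulr0.
  by rewrite -[RHS]h0 mulr_sumr; apply: eq_big_seq => w /fg ->; rewrite mulrA.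
by rewrite -[RHS](hj j) mulr_sumr; apply: eq_big_seq => w /fg ->; rewrite !mulrA.
Qed.

(** [sigma] picks the lift of each residue [Z]. Surjectivity onto the singular members rests on the
    uniqueness of lifts, injectivity on the uniqueness of the residue of a singular surface. *)
Theorem pencil_singularities : exists sigma : 'rV[R[i]]_3 -> K,
  [/\ forall Z, singular_at C alpha Z ->
         lead (sigma Z) 0 0 /\ exists z, singular_at A (pencil (sigma Z)) z,
      forall f, through f -> matching f -> (exists z, singular_at A f z) ->
        exists Z l, [/\ singular_at C alpha Z, l != 0 & forall w, w \in A -> f w = l * pencil (sigma Z) w] &
      forall Z Z', singular_at C alpha Z -> singular_at C alpha Z' -> sigma Z = sigma Z' -> Z = Z'].
Proof.
pose P Z th := singular_at C alpha Z -> lead th 0 0 /\ exists eta, (forall j, lead (eta j) 0 0) /\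
  singular_system A d (normal (pencil th) Z) eta.
have [|sigma sigmaP] := @choice _ _ P.
  move=> Z; have [sZ|nZ] := pselect (singular_at C alpha Z); last by exists 0.
  by have [th [eta [lt le s]]] := pencil_singular_exists sZ; exists th => _; split=> //; exists eta.
exists sigma; split=> [Z sZ|f tf mf [z sz]|Z Z' sZ sZ' sig].
- have [Z0 _ _] := sZ; have [lt [eta [le s]]] := sigmaP _ sZ; split=> //.
  by exists (near_point Z eta); apply/singular_near_point.
- have [l [th [l0 lt fE]]] := pencil_coordinates tf mf.
  have sz' := singular_at_scale l0 fE sz; have mp := matching_pencil lt.
  have [Z [sZ Z0 lz]] := singular_point mp sz'; exists Z, l; split=> // w wA.
  have [eta le zE] := near_pointP Z0 lz; rewrite zE in sz'.
  have [lt' [eta' [le' s']]] := sigmaP _ sZ.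
  have s := proj1 (singular_near_point (pencil th) Z0 le) sz'.
  by rewrite fE// (pencil_singular_unique sZ lt lt' le le' s s').
- have [lt [eta [le s]]] := sigmaP _ sZ; have [lt' [eta' [le' s']]] := sigmaP _ sZ'.
  rewrite -sig in s'; exact: singular_residue_unique (matching_pencil lt) sZ sZ' le le' s s'.
Qed.

End Core.

(** * Circuits of types A and B *)

Section Models.
Implicit Types (w m : 'rV[int]_3) (C D : {fset 'rV[int]_3}).

Definition i30 : 'I_3 := @Ordinal 3 0 isT.
Definition i31 : 'I_3 := @Ordinal 3 1 isT.
Definition i32 : 'I_3 := @Ordinal 3 2 isT.

Lemma sum3 (V : nmodType) (f : 'I_3 -> V) : \sum_(j < 3) f j = f i30 + f i31 + f i32.
Proof.
rewrite !big_ord_recl big_ord0 addr0 addrA.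
by congr (f _ + f _ + f _); exact: val_inj.
Qed.

Lemma prod3 (F : comPzRingType) (f : 'I_3 -> F) : \prod_(j < 3) f j = f i30 * f i31 * f i32.
Proof.
rewrite !big_ord_recl big_ord0 mulr1 mulrA.
by congr (f _ * f _ * f _); exact: val_inj.
Qed.

Lemma forall3 (P : 'I_3 -> Prop) : P i30 -> P i31 -> P i32 -> forall j, P j.
Proof.
move=> P0 P1 P2 [[|[|[|//]]] j3].
- by rewrite (_ : Ordinal j3 = i30)//; exact: val_inj.
- by rewrite (_ : Ordinal j3 = i31)//; exact: val_inj.
- by rewrite (_ : Ordinal j3 = i32)//; exact: val_inj.
Qed.

(** What the models of both types share: enough for spanning, and for reducing a character constant
    on the model to its third coordinate. *)
Definition framed D := [/\ point3 0 0 0 \in D, point3 1 0 0 \in D, point3 0 1 0 \in D &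
  exists2 a, a \in D & a 0 i32 != 0].

Lemma affine_form_change (F : fieldType) (U : 'M[int]_3) (t : 'rV[int]_3) (y : 'I_3 -> F) c :
  U \in unitmx -> exists y' c', [/\ forall w, affine_form y' c' (w *m U + t) = affine_form y c w,
    forall j, y j = \sum_(k < 3) (U j k)%:~R * y' k &
    c = \sum_(k < 3) (t 0 k)%:~R * y' k + c'].
Proof.
move=> Uu; pose iU := invmx U.
have UV : U *m iU = 1%:M by exact: mulmxV.
pose y' k := \sum_(j < 3) (iU k j)%:~R * y j.
pose c' := c - \sum_(k < 3) (t 0 k)%:~R * y' k.
have yE j : y j = \sum_(k < 3) (U j k)%:~R * y' k.
  rewrite /y'; under eq_bigr do rewrite mulr_sumr.
  rewrite exchange_big/=; under eq_bigr do under eq_bigr do rewrite mulrA -intrM.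
  have iE l : \sum_(k < 3) U j k * iU k l = (j == l)%:R.
    by have := congr1 (fun B : 'M[int]_3 => B j l) UV; rewrite !mxE.
  under eq_bigr do rewrite -mulr_suml -rmorph_sum iE.
  rewrite (bigD1 j)//= eqxx mul1r big1 ?addr0// => k /negbTE kj.
  by rewrite eq_sym kj mul0r.
exists y', c'; split=> // [w|]; last by rewrite /c' addrC subrK.
rewrite /affine_form /c'.
have -> : \sum_(j < 3) y' j * ((w *m U + t) 0 j)%:~R =
    \sum_(j < 3) y j * (w 0 j)%:~R + \sum_(k < 3) (t 0 k)%:~R * y' k.
  under eq_bigr do rewrite !mxE intrD mulrDr [X in _ + X]mulrC.
  rewrite big_split/=; congr (_ + _).
  under [RHS]eq_bigr do rewrite yE mulr_suml.
  rewrite exchange_big/=; apply: eq_bigr => k _.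
  by rewrite rmorph_sum mulr_sumr; apply: eq_bigr => j _; rewrite rmorphM/=; ring.
by rewrite addrACA addrA [X in X + _]addrAC; ring.
Qed.

Lemma framed_values (F : fieldType) (y : 'I_3 -> F) c (x1 x2 x3 : int) :
  affine_form y c (point3 x1 x2 x3) = y i30 * x1%:~R + y i31 * x2%:~R + y i32 * x3%:~R + c.
Proof. by rewrite /affine_form sum3 !mxE. Qed.

Lemma framed_spanning (F : numFieldType) C D : framed D -> Zaffine_equivalent C D -> spanning F C.
Proof.
move=> [D0 D1 D2 [a aD a3]] [U [t [Uu DE]]] y c yc.
have [y' [c' [formE yE cE]]] := affine_form_change t y c Uu.
have {}yc m : m \in D -> affine_form y' c' m = 0.
  by rewrite DE => /imfsetP[w /= wC ->]; rewrite formE yc.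
have := yc _ D0; rewrite framed_values !mulr0 !add0r => c'0.
have := yc _ D1; rewrite framed_values !mulr0 mulr1 c'0 !addr0 => y0.
have := yc _ D2; rewrite framed_values !mulr0 mulr1 c'0 !addr0 add0r => y1.
have := yc _ aD; rewrite /affine_form sum3 y0 y1 c'0 !mul0r !add0r addr0 => /eqP.
rewrite mulf_eq0 intr_eq0 (negbTE a3) orbF => /eqP y2.
have y'0 : forall j, y' j = 0 by exact: forall3.
split=> [j|]; first by rewrite yE big1// => k _; rewrite y'0 mulr0.
by rewrite cE c'0 addr0 big1// => k _; rewrite y'0 mulr0.
Qed.

(** The linear function of the cell interpolates rational values at affinely spanning lattice
    points. Its coefficients become exponents of [t], so they have to be rational. *)
Lemma framed_rational (R : realType) C D (e : 'rV[int]_3 -> rat) (y : 'I_3 -> R) c :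
  framed D -> Zaffine_equivalent C D ->
  (forall w, w \in C -> ratr (e w) = affine_form y c w) ->
  exists q r, (forall j, y j = ratr (q j)) /\ c = ratr r.
Proof.
move=> [D0 D1 D2 [a aD a3]] [U [t [Uu DE]]] yc.
have [y' [c' [formE yE cE]]] := affine_form_change t y c Uu.
have {}yc m : m \in D -> exists x, affine_form y' c' m = ratr x.
  by rewrite DE => /imfsetP[w /= wC ->]; exists (e w); rewrite formE yc.
have [r0] := yc _ D0; rewrite framed_values !mulr0 !add0r => c'0.
have [r1] := yc _ D1; rewrite framed_values !mulr0 mulr1 !addr0 => y0.
have [r2] := yc _ D2; rewrite framed_values !mulr0 mulr1 addr0 add0r => y1.
have {}y0 : y' i30 = ratr (r1 - r0) by rewrite rmorphB/= -y0 -c'0 addrK.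
have {}y1 : y' i31 = ratr (r2 - r0) by rewrite rmorphB/= -y1 -c'0 addrK.
have [r3] := yc _ aD; rewrite /affine_form sum3 => y2.
have a3R : (a 0 i32)%:~R != 0 :> R by rewrite intr_eq0.
have {}y2 : y' i32 = ratr ((r3 - r0 - (r1 - r0) * (a 0 i30)%:~R - (r2 - r0) * (a 0 i31)%:~R) / (a 0 i32)%:~R).
  rewrite rmorphM/= fmorphV/= !rmorphB/= !rmorphM/= !rmorphB/= !ratr_int -y2 c'0 y0 y1 !rmorphB/=.
  by field.
have [q' q'E] : exists q', forall j, y' j = ratr (q' j).
  pose s := [:: r1 - r0; r2 - r0;
    (r3 - r0 - (r1 - r0) * (a 0 i30)%:~R - (r2 - r0) * (a 0 i31)%:~R) / (a 0 i32)%:~R].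
  by exists (fun j : 'I_3 => nth 0 s j); exact: forall3.
exists (fun j => \sum_(k < 3) (U j k)%:~R * q' k), (\sum_(k < 3) (t 0 k)%:~R * q' k + r0).
split=> [j|].
  by rewrite yE rmorph_sum; apply: eq_bigr => k _; rewrite rmorphM/= ratr_int q'E.
rewrite cE c'0 rmorphD rmorph_sum; congr (_ + _); apply: eq_bigr => k _.
by rewrite rmorphM/= ratr_int q'E.
Qed.

Definition power_map (F : fieldType) (z : 'rV[F]_3) (V : 'M[int]_3) : 'rV[F]_3 :=
  \row_k monomial z (row k V).

Lemma monomial_sum (F : fieldType) (z : 'rV[F]_3) (I : Type) (l : seq I) (f : I -> 'rV[int]_3) :
  (forall j, z 0 j != 0) -> monomial z (\sum_(i <- l) f i) = \prod_(i <- l) monomial z (f i).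
Proof.
move=> z0; apply: (big_morph (monomial z)) => [w w'|]; first exact: monomialD.
exact: monomial0.
Qed.

Lemma monomialZ (F : fieldType) (z : 'rV[F]_3) (n : int) w :
  monomial z (n *: w) = monomial z w ^ n.
Proof.
rewrite /monomial [RHS](big_morph (fun x : F => x ^ n) (fun x y => expfzMl x y n) (exp1rz F n)).
by apply: eq_bigr => j _; rewrite mxE mulrC exprz_exp.
Qed.

Lemma monomial_power_map (F : fieldType) (z : 'rV[F]_3) (V : 'M[int]_3) w :
  (forall j, z 0 j != 0) -> monomial (power_map z V) w = monomial z (w *m V).
Proof.
move=> z0; rewrite mulmx_sum_row monomial_sum//.
by apply: eq_bigr => k _; rewrite mxE monomialZ.
Qed.

Lemma power_map_neq0 (F : fieldType) (z : 'rV[F]_3) V : (forall j, z 0 j != 0) ->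
  forall j, power_map z V 0 j != 0.
Proof. by move=> z0 j; rewrite mxE monomial_neq0. Qed.

Lemma power_mapM (F : fieldType) (z : 'rV[F]_3) V W : (forall j, z 0 j != 0) ->
  power_map (power_map z V) W = power_map z (W *m V).
Proof.
by move=> z0; apply/rowP => k; rewrite !mxE monomial_power_map// row_mul.
Qed.

Lemma power_map1 (F : fieldType) (z : 'rV[F]_3) : power_map z 1%:M = z.
Proof. by apply/rowP => k; rewrite mxE row1 monomial_delta. Qed.

Definition character_on (F : fieldType) C (z : 'rV[F]_3) :=
  (forall j, z 0 j != 0) /\ exists k, forall w, w \in C -> monomial z w = k.

Lemma character_change (F : fieldType) C D U t (z : 'rV[F]_3) :
  U \in unitmx -> D = [fset (w *m U + t)%R | w in C]%fset ->
  character_on C z -> character_on D (power_map z (invmx U)).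
Proof.
move=> Uu DE [z0 [k zk]]; split; first exact: power_map_neq0.
exists (k * monomial (power_map z (invmx U)) t) => m.
rewrite DE => /imfsetP[w /= wC ->]; rewrite monomialD; last exact: power_map_neq0.
by rewrite [X in X * _]monomial_power_map// mulmxK// zk.
Qed.

Lemma character_change_inv (F : fieldType) C D U t (z : 'rV[F]_3) :
  U \in unitmx -> D = [fset (w *m U + t)%R | w in C]%fset ->
  character_on D z -> character_on C (power_map z U).
Proof.
move=> Uu DE [z0 [k zk]]; split; first exact: power_map_neq0.
exists (k / monomial z t) => w wC; rewrite monomial_power_map//.
have wD : (w *m U + t)%R \in D by rewrite DE; apply/imfsetP; exists w.
by rewrite -(zk _ wD) monomialD// mulfK// monomial_neq0.
Qed.

Lemma power_mapK (F : fieldType) U (z : 'rV[F]_3) : U \in unitmx -> (forall j, z 0 j != 0) ->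
  power_map (power_map z (invmx U)) U = z.
Proof. by move=> Uu z0; rewrite power_mapM// mulmxV// power_map1. Qed.

Lemma power_mapKV (F : fieldType) U (z : 'rV[F]_3) : U \in unitmx -> (forall j, z 0 j != 0) ->
  power_map (power_map z U) (invmx U) = z.
Proof. by move=> Uu z0; rewrite power_mapM// mulVmx// power_map1. Qed.

Lemma monomial_point3 (F : fieldType) (z : 'rV[F]_3) (x1 x2 x3 : int) :
  monomial z (point3 x1 x2 x3) = z 0 i30 ^ x1 * z 0 i31 ^ x2 * z 0 i32 ^ x3.
Proof. by rewrite /monomial prod3 !mxE. Qed.

Lemma framed_character (F : fieldType) D (z : 'rV[F]_3) : framed D -> character_on D z ->
  [/\ z 0 i30 = 1, z 0 i31 = 1 & forall w, w \in D -> z 0 i32 ^ w 0 i32 = 1].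
Proof.
move=> [D0 D1 D2 _] [z0 [k zk]].
have k1 : k = 1 by rewrite -(zk _ D0) monomial_point3 !expr0z !mulr1.
have z1 : z 0 i30 = 1.
  by have := zk _ D1; rewrite monomial_point3 !expr0z !mulr1 expr1z k1.
have z2 : z 0 i31 = 1.
  by have := zk _ D2; rewrite monomial_point3 !expr0z mulr1 mul1r expr1z k1.
by split=> // w /zk; rewrite /monomial prod3 z1 z2 !exp1rz !mul1r k1.
Qed.

Lemma coprime_roots1 (F : fieldType) (x : F) (a b : nat) : (0 < a)%N -> coprime a b ->
  x ^+ a = 1 -> x ^+ b = 1 -> x = 1.
Proof.
move=> a0; rewrite /coprime => /eqP gab xa xb; case: (egcdnP b a0) => km kn E _.
have : x ^+ (km * a) = x ^+ (kn * b) * x by rewrite E gab addn1 exprSr.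
by rewrite mulnC exprM xa expr1n mulnC exprM xb expr1n mul1r.
Qed.

Lemma typeB_framed D : D \in typeB_models -> framed D.
Proof.
have key (a b : 'rV[int]_3) : a 0 i32 != 0 -> framed (typeB_model a b).
  by move=> a0; split; [by rewrite !inE eqxx ?orbT..|exists a; rewrite // !inE eqxx ?orbT].
by rewrite !inE => /orP[|/orP[|/orP[|/orP[|/orP[|/orP[|/orP[]]]]]]] /eqP ->;
  apply: key; rewrite mxE.
Qed.

Lemma typeA_framed p q : framed [fset point3 0 0 0; point3 1 0 0; point3 0 1 0; point3 0 0 1;
  point3 1 p%:Z q%:Z]%fset.
Proof.
split; [by rewrite !inE eqxx ?orbT..|].
by exists (point3 0 0 1); rewrite ?mxE// !inE eqxx ?orbT.
Qed.

Lemma circuit_framed (R : realType) C : circuit_typeA R C \/ circuit_typeB R C ->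
  exists2 D, framed D & Zaffine_equivalent C D.
Proof.
case=> [[_ _ [p [q [_ _ _ CD]]]]|[_ _ [D DB CD]]].
  by eexists; [exact: (typeA_framed p q)|].
by exists D => //; exact: typeB_framed.
Qed.

Definition rigid (F : fieldType) D := forall z : 'rV[F]_3, character_on D z -> z 0 i32 = 1.

(** In every model but the last, the third coordinates of the two further points are coprime, and
    both powers of the remaining coordinate of the character are 1. *)
Lemma typeB_rigid (F : fieldType) D : D \in typeB_models ->
  D != typeB_model (point3 1 2 5) (point3 3 7 20) -> rigid F D.
Proof.
move=> DB Dn z cz; have [_ _ zD] := framed_character (typeB_framed DB) cz.
have key (a b : 'rV[int]_3) (k l : nat) : a 0 i32 = k%:Z -> b 0 i32 = l%:Z -> (0 < k)%N ->
    coprime k l -> D = typeB_model a b -> z 0 i32 = 1.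
  move=> ak bl k0 kl DE; apply: (coprime_roots1 k0 kl).
    by have := zD a; rewrite ak DE; apply; rewrite !inE eqxx ?orbT.
  by have := zD b; rewrite bl DE; apply; rewrite !inE eqxx ?orbT.
move: DB Dn; rewrite !inE => /orP[|/orP[|/orP[|/orP[|/orP[|/orP[|/orP[]]]]]]] /eqP DE Dn.
- by apply: (key _ _ 1%N 4%N _ _ _ _ DE); rewrite ?mxE.
- by apply: (key _ _ 2%N 5%N _ _ _ _ DE); rewrite ?mxE.
- by apply: (key _ _ 3%N 7%N _ _ _ _ DE); rewrite ?mxE.
- by apply: (key _ _ 5%N 11%N _ _ _ _ DE); rewrite ?mxE.
- by apply: (key _ _ 5%N 13%N _ _ _ _ DE); rewrite ?mxE.
- by apply: (key _ _ 7%N 17%N _ _ _ _ DE); rewrite ?mxE.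
- by apply: (key _ _ 7%N 19%N _ _ _ _ DE); rewrite ?mxE.
- by rewrite DE eqxx in Dn.
Qed.

Lemma typeA_rigid (F : fieldType) p q : rigid F [fset point3 0 0 0; point3 1 0 0; point3 0 1 0;
  point3 0 0 1; point3 1 p%:Z q%:Z]%fset.
Proof.
move=> z cz; have [_ _ zD] := framed_character (typeA_framed p q) cz.
by have := zD (point3 0 0 1); rewrite mxE; apply; rewrite !inE eqxx ?orbT.
Qed.

Lemma rigid_character (F : fieldType) C D (z : 'rV[F]_3) : framed D -> rigid F D ->
  Zaffine_equivalent C D -> character_on C z -> forall j, z 0 j = 1.
Proof.
move=> fD rD [U [t [Uu DE]]] cz; have cz' := character_change Uu DE cz.
have [z1 z2 _] := framed_character fD cz'; have z3 := rD _ cz'.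
have z'1 : forall j, power_map z (invmx U) 0 j = 1 by exact: forall3.
have [z0 _] := cz; move=> j; rewrite -(power_mapK Uu z0) mxE /monomial big1// => k _.
by rewrite z'1 exp1rz.
Qed.

Lemma circuit_rigid (R : realType) (F : fieldType) C (z : 'rV[F]_3) :
  circuit_typeA R C \/ circuit_typeB R C ->
  ~ Zaffine_equivalent C (typeB_model (point3 1 2 5) (point3 3 7 20)) ->
  character_on C z -> forall j, z 0 j = 1.
Proof.
case=> [[_ _ [p [q [_ _ _ CD]]]]|[_ _ [D DB CD]]] C5.
  exact: rigid_character (typeA_framed p q) (@typeA_rigid F p q) CD.
have nD : D != typeB_model (point3 1 2 5) (point3 3 7 20).
  by apply/eqP => DE; apply: C5; rewrite -DE.
exact: rigid_character (typeB_framed DB) (typeB_rigid DB nD) CD.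
Qed.

Definition root_vector (F : fieldType) (x : F) : 'rV[F]_3 := \row_j nth 0 [:: 1; 1; x] j.

(** The third coordinates that occur are 0, 5 and 20, with greatest common divisor 5. *)
Lemma quintic_character (F : fieldType) (z : 'rV[F]_3) :
  character_on (typeB_model (point3 1 2 5) (point3 3 7 20)) z <->
  exists2 x, x ^+ 5 = 1 & z = root_vector x.
Proof.
set D := typeB_model _ _; have DB : D \in typeB_models by rewrite !inE eqxx ?orbT.
split=> [cz|[x x5 ->]].
  have [z1 z2 zD] := framed_character (typeB_framed DB) cz.
  exists (z 0 i32).
    by have := zD (point3 1 2 5); rewrite mxE; apply; rewrite !inE eqxx ?orbT.
  by apply/rowP; apply: forall3; rewrite mxE.
have x0 : x != 0 by apply: contra_eq_neq x5 => ->; rewrite expr0n eq_sym oner_neq0.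
split; first by apply: forall3; rewrite mxE ?oner_neq0.
exists 1 => w; rewrite !inE => /orP[/orP[/orP[/orP[]|]|]|] /eqP ->;
  rewrite monomial_point3 !mxE /= ?exp1rz ?mul1r ?expr0z//.
by rewrite -[x ^ _]/(x ^+ (5 * 4)) exprM x5 expr1n.
Qed.

Lemma root_vector_inj (F : fieldType) : injective (@root_vector F).
Proof. by move=> x x' /(congr1 (fun z : 'rV[F]_3 => z 0 i32)); rewrite !mxE. Qed.

Lemma quintic_circuit_character (F : fieldType) C :
  Zaffine_equivalent C (typeB_model (point3 1 2 5) (point3 3 7 20)) ->
  exists g : F -> 'rV[F]_3, [/\ forall x, x ^+ 5 = 1 -> character_on C (g x),
    forall z, character_on C z -> exists2 x, x ^+ 5 = 1 & z = g x &
    forall x x', x ^+ 5 = 1 -> x' ^+ 5 = 1 -> g x = g x' -> x = x'].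
Proof.
move=> [U [t [Uu DE]]].
have rc (x : F) (x5 : x ^+ 5 = 1) := proj2 (quintic_character (root_vector x)) (ex_intro2 _ _ x x5 erefl).
exists (fun x => power_map (root_vector x) U); split=> [x x5|z cz|x x' x5 x'5 E].
- exact: character_change_inv Uu DE (rc x x5).
- have [x x5 zE] := proj1 (quintic_character _) (character_change Uu DE cz).
  by exists x; rewrite // -zE power_mapK//; case: cz.
- have [r0 _] := rc x x5; have [r0' _] := rc x' x'5.
  by apply: root_vector_inj; rewrite -(power_mapKV Uu r0) E power_mapKV.
Qed.

End Models.

Lemma card_roots_of_unity (F : closedFieldType) n : (n%:R != 0 :> F) ->
  ([set x : F | x ^+ n = 1] #= `I_n)%card.
Proof.
move=> n0; have n_gt0 : (0 < n)%N by case: n n0; rewrite ?eqxx.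
have [rs rsE] := closed_field_poly_normal ('X^n - 1 : {poly F}).
rewrite lead_coefXnsubC// scale1r in rsE.
have rsu : uniq rs.
  rewrite -separable_prod_XsubC -rsE; apply: separable_Xn_sub_1.
  exact: n0.
have rss : size rs = n.
  by have := size_prod_XsubC rs id; rewrite -rsE size_XnsubC// => -[].
have -> : [set x : F | x ^+ n = 1] = [set` [fset x in rs]%fset].
  apply/seteqP; split=> x /=; rewrite !inE -root_prod_XsubC -rsE rootE !hornerE subr_eq0.
    by move=> ->.
  by move/eqP.
apply/card_eq_fsetP; rewrite -rss.
by rewrite card_fseq undup_id.
Qed.

(** * Tropical surfaces through the marked points *)

Section LatticeData.
Variable R : realType.
Implicit Types (A B C : {fset 'rV[int]_3}) (w : 'rV[int]_3) (X : 'rV[R]_3).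

Lemma dotE w X : dot (real_point R w) X = \sum_(j < 3) (w 0 j)%:~R * X 0 j.
Proof. by apply: eq_bigr => j _; rewrite mxE. Qed.

Lemma dot_marked w (m : rat) (v : 'rV[rat]_3) :
  dot (real_point R w) (map_mx ratr (m *: v)) = ratr (m * height v w).
Proof.
rewrite dotE /height mulr_sumr rmorph_sum; apply: eq_bigr => j _.
by rewrite !mxE !rmorphM/= ratr_int mulrCA.
Qed.

Lemma affine_form_dot X c w : affine_form (X 0) c w = dot X (real_point R w) + c.
Proof. by rewrite /affine_form /dot; congr (_ + _); apply: eq_bigr => j _; rewrite mxE. Qed.

Lemma exists_shift A : exists d : nat, forall w, w \in A -> forall j, (0 <= w 0 j + d%:Z)%R.
Proof.
pose f (w : 'rV[int]_3) (j : 'I_3) : nat := absz (w 0 j).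
exists (\sum_(w <- A) \sum_(j < 3) f w j)%N => w wA j.
by rewrite (big_fsetD1 w)//= (bigD1 j)//= !PoszD /f; lia.
Qed.

Lemma general_height_inj (Delta : set 'rV[R]_3) v : general_direction Delta v ->
  {in lattice_points Delta &, injective (height v)}.
Proof.
move=> gv w w' wA w'A hww'; apply: contrapT => /eqP ww'.
have sB : {subset [:: w; w'] <= lattice_points Delta}.
  by move=> x; rewrite !inE => /orP[] /eqP ->.
have := gv [:: w; w'] sB; cbv zeta; set L := <<_>>%VS.
pose x := real_point R (w - w').
have LE : L = <[x]>%VS.
  apply/eqP; rewrite eqEsubv; apply/andP; split.
    apply/span_subvP => z; rewrite /= !inE !subrr.
    have r0 : real_point R 0 = 0 by apply/rowP => j; rewrite !mxE.
    have rN : real_point R (w' - w) = - x.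
      by apply/rowP => j; rewrite !mxE !intrD !rmorphN/= opprD opprK addrC.
    rewrite r0 rN => /or4P[] /eqP ->; rewrite ?mem0v ?memv_line//.
    by rewrite memvN memv_line.
  by rewrite -memvE; apply: memv_span; rewrite /= !inE eqxx orbT.
have x0 : x != 0.
  apply: contraNneq ww' => /rowP x0; apply/eqP/rowP => j; have := x0 j.
  rewrite !mxE => /eqP; rewrite intr_eq0 subr_eq0 => /eqP; exact.
rewrite LE dim_vline x0 => /(_ isT)[_ [l /vlineP[k ->]]]; apply/negP; rewrite negbK.
have -> : dot (map_mx ratr v) (k *: x) = k * ratr (height v w - height v w').
  rewrite /dot /height rmorphB !rmorph_sum/= -sumrB mulr_sumr; apply: eq_bigr => j _.
  by rewrite !mxE intrD rmorphN !rmorphM/= !ratr_int; ring.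
by rewrite hww' subrr rmorph0 mulr0.
Qed.

Lemma circuit_relation A C : (C `<=` A)%fset -> circuit R C -> exists lambda : 'rV[int]_3 -> R,
  relation A C lambda /\ forall w, w \in C -> lambda w != 0.
Proof.
move=> CA [[l [[w0 w0C lw0] l0 lj]] Cmin].
have sumC (f : 'rV[int]_3 -> R) : \sum_(w <- A) (if w \in C then f w else 0) = \sum_(w <- C) f w.
  rewrite -(big_fset_incl _ CA) => [|w _ /negbTE -> //].
  by apply: eq_big_seq => w ->.
exists (fun w => if w \in C then l w else 0); split; first split=> [w /negbTE -> //||j].
- by rewrite sumC.
- rewrite (eq_bigr (fun w => if w \in C then l w * (w 0 j)%:~R else 0)); last first.
    by move=> w _; case: ifP => // _; rewrite mul0r.
  have := congr1 (fun X : 'rV[R]_3 => X 0 j) lj; rewrite summxE mxE sumC => E.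
  by rewrite -[RHS]E; apply: eq_bigr => w _; rewrite !mxE.
- move=> w wC; rewrite wC; apply/eqP => lw; apply: (Cmin (C `\ w)%fset).
    by rewrite fproperD1.
  exists l; split.
  + by exists w0 => //; rewrite !inE w0C andbT; apply: contra_neq lw0 => ->.
  + by move: l0; rewrite (big_fsetD1 w)//= lw add0r.
  + by move: lj; rewrite (big_fsetD1 w)//= lw scale0r add0r.
Qed.

(** Among the monomials tied for the maximum, those of least and greatest height become the ends of
    the edge; injectivity of the height keeps them distinct. *)
Lemma extreme_pair A (h g : 'rV[int]_3 -> rat) : {in A &, injective h} ->
  (exists w w', [/\ w \in A, w' \in A, w != w', g w = g w' & forall x, x \in A -> g x <= g w]) ->
  exists u u', [/\ u \in A, u' \in A, h u < h u', g u' = g u &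
    (forall x, x \in A -> g x <= g u) /\
    forall x, x \in A -> g x = g u -> h u <= h x <= h u'].
Proof.
move=> hinj [w [w' [wA w'A ww' gww' gmax]]].
pose P (x : A) := g (val x) == g w.
have Pw : P [` wA]%fset by rewrite /P.
case: (@arg_minP _ rat A [` wA]%fset P (fun x : A => h (fsval x)) Pw) => u Pu umin.
case: (@arg_maxP _ rat A [` wA]%fset P (fun x : A => h (fsval x)) Pw) => u' Pu' umax.
have gu : g (val u) = g w by exact/eqP.
have gu' : g (val u') = g w by exact/eqP.
have between x : x \in A -> g x = g w -> h (val u) <= h x <= h (val u').
  move=> xA gx; have Px : P [` xA]%fset by rewrite /P /= gx.
  by apply/andP; split; [exact: (umin _ Px)|exact: (umax _ Px)].
exists (val u), (val u'); split; rewrite ?gu ?gu' //; try exact: valP.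
have /andP[a1 a2] := between _ wA erefl; have /andP[a3 a4] := between _ w'A (esym gww').
rewrite lt_neqAle (le_trans a1 a2) andbT; apply: contra_neq ww' => uu'.
by apply: hinj => //; apply/eqP; rewrite eq_le; apply/andP; split; lra.
Qed.

End LatticeData.

Section TropicalData.
Variables (R : realType) (Delta : set 'rV[R]_3).
Local Notation A := (lattice_points Delta).
Local Open Scope ereal_scope.

Lemma bigmaxe_attained (T : eqType) (s : seq T) (f : T -> R) : s != [::] ->
  exists2 w, w \in s & \big[maxe/-oo]_(w <- s) (f w)%:E = (f w)%:E /\
    forall x, x \in s -> (f x <= f w)%R.
Proof.
elim: s => // w s ih _; rewrite big_cons; have [->|s0] := eqVneq s [::].
  exists w; rewrite ?mem_head// big_nil maxeNy; split=> // x.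
  by rewrite inE => /eqP ->.
have [w' w's [-> wmax]] := ih s0; have [ww'|w'w] := leP (f w) (f w').
  exists w'; first by rewrite inE w's orbT.
  rewrite -EFin_max max_r//; split=> // x; rewrite inE => /predU1P[->//|/wmax//].
exists w; rewrite ?mem_head// -EFin_max max_l ?ltW//; split=> // x.
by rewrite inE => /predU1P[->//|/wmax xw']; exact: le_trans xw' (ltW w'w).
Qed.

Hypothesis A_neq0 : A != fset0.
Variable S : 'rV[int]_3 -> R.

Let A_nil : (A : seq 'rV[int]_3) != [::].
Proof. by rewrite -size_eq0 -[size _]/(#|` A|) cardfs_eq0. Qed.

Lemma tropF_attained X : exists2 w, w \in A & tropF Delta S X = (S w + dot (real_point R w) X)%:E /\
  forall x, x \in A -> (S x + dot (real_point R x) X <= S w + dot (real_point R w) X)%R.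
Proof. exact: bigmaxe_attained (fun w => S w + dot (real_point R w) X)%R A_nil. Qed.

Lemma nu_ge X y : (dot y X)%:E - tropF Delta S X <= nu Delta S y.
Proof. by apply: ereal_sup_ubound; exists X. Qed.

(** At every lattice point of [A] the dual is at most [- S]; a point [X] where [w] attains the
    maximum gives the reverse inequality. *)
Lemma nu_visible X w : w \in A -> tropF Delta S X = (S w + dot (real_point R w) X)%:E ->
  nu Delta S (real_point R w) = (- S w)%:E.
Proof.
move=> wA FX; apply/eqP; rewrite eq_le; apply/andP; split.
  apply: ge_ereal_sup => _ [Y _ <-]; have [w' _ [-> /(_ w wA) le]] := tropF_attained Y.
  by rewrite -EFinB lee_fin; lra.
by have := nu_ge X (real_point R w); rewrite FX -EFinB opprD addrCA subrr addr0.
Qed.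

Variable e : 'rV[int]_3 -> rat.
Hypothesis nu_e : forall w, w \in A -> nu Delta S (real_point R w) = (ratr (e w))%:E.

Lemma visible_e X w : w \in A -> tropF Delta S X = (S w + dot (real_point R w) X)%:E ->
  S w = (- ratr (e w))%R.
Proof.
by move=> wA /(nu_visible wA); rewrite nu_e// => -[->]; rewrite opprK.
Qed.

Lemma tropF_e X w : w \in A -> (dot (real_point R w) X - ratr (e w))%:E <= tropF Delta S X.
Proof.
move=> wA; have := nu_ge X (real_point R w); rewrite nu_e//.
have [w' _ [-> _]] := tropF_attained X; rewrite -EFinB !lee_fin; lra.
Qed.

(** Replacing [S] by [- e] leaves the coefficients of the attaining monomials unchanged and keeps
    all others below [tropF], so a corner of [S] is a corner for the exponents. *)
Lemma corner_e X : corner_locus Delta S X -> exists w w', [/\ w \in A, w' \in A, w != w',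
  (dot (real_point R w) X - ratr (e w) = dot (real_point R w') X - ratr (e w'))%R &
  forall x, x \in A -> (dot (real_point R x) X - ratr (e x) <= dot (real_point R w) X - ratr (e w))%R].
Proof.
move=> [w [w' [wA w'A ww' Fw Fw']]]; exists w, w'; split=> //.
  have := Fw; rewrite Fw' (visible_e wA Fw) (visible_e w'A Fw') => -[]; lra.
by move=> x xA; have := tropF_e X xA; rewrite Fw (visible_e wA Fw) lee_fin; lra.
Qed.

Lemma tropF_valuation (f : 'rV[int]_3 -> puiseux R) (c : 'rV[int]_3 -> R[i]) X :
  (forall w, w \in A -> lead (f w) (c w) (e w)) -> (forall w, w \in A -> c w != 0%R) ->
  trop_poly Delta (fun w => puiseux_val (f w)) X = tropF Delta S X.
Proof.
move=> lf c0; have -> : trop_poly Delta (fun w => puiseux_val (f w)) X =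
    \big[maxe/-oo]_(w <- A) (- ratr (e w) + dot (real_point R w) X)%:E.
  apply: eq_big_seq => w wA; rewrite (puiseux_val_lead (lf w wA) (c0 w wA)).
  by rewrite EFinD.
have [w wA [-> wmax]] := bigmaxe_attained (fun w => - ratr (e w) + dot (real_point R w) X)%R A_nil.
apply/eqP; rewrite eq_le; apply/andP; split.
  by have := tropF_e X wA; rewrite addrC.
have [w' w'A [Fw' _]] := tropF_attained X; rewrite Fw' (visible_e w'A Fw') lee_fin.
exact: wmax.
Qed.

End TropicalData.

Lemma surface_scale (R : realType) (f g : 'rV[int]_3 -> puiseux R) l : l != 0 ->
  (forall w, f w = l * g w) -> surface f = surface g.
Proof.
move=> l0 fg; apply/seteqP; split=> x [k k0 ->].
  by exists (k * l); [rewrite mulf_neq0|apply/funext => w; rewrite fg mulrA].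
exists (k / l); first by rewrite mulf_neq0// invr_eq0.
by apply/funext => w; rewrite fg -(mulrA k) mulKf.
Qed.

Lemma surface_refl (R : realType) (f : 'rV[int]_3 -> puiseux R) : surface f f.
Proof. by exists 1; [exact: oner_neq0|apply/funext => w; rewrite mul1r]. Qed.

Lemma singular_twist (R : realType) (C : {fset 'rV[int]_3}) (alpha : 'rV[int]_3 -> R[i])
    (Z zeta : 'rV[R[i]]_3) : singular_at C alpha Z -> character_on C zeta ->
  singular_at C alpha (hadamard Z zeta).
Proof.
move=> sZ [z0 [k zk]]; have [Z0 _ _] := sZ.
have Zz0 j : hadamard Z zeta 0 j != 0 by rewrite mxE mulf_neq0.
have [h0 hj] := proj1 (singular_atP C alpha Z0) sZ; apply/(singular_atP C alpha Zz0); split=> [|j].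
  transitivity ((\sum_(w <- C) alpha w * monomial Z w) * k); last by rewrite h0 mul0r.
  by rewrite mulr_suml; apply: eq_big_seq => w /zk wk; rewrite monomialM wk mulrA.
transitivity ((\sum_(w <- C) alpha w * monomial Z w * (w 0 j)%:~R) * k).
  by rewrite mulr_suml; apply: eq_big_seq => w /zk wk; rewrite monomialM wk; ring.
by rewrite hj mul0r.
Qed.

(** On an infinite set [fset_set] returns the empty set, so nonemptiness certifies that the lattice
    points are finite in number. *)
Lemma lattice_pointsP (R : realType) (Delta : set 'rV[R]_3) w :
  lattice_points Delta != fset0 -> (w \in lattice_points Delta) <-> Delta (real_point R w).
Proof.
move=> A0; have fin : finite_set [set w | Delta (real_point R w)].
  apply: contrapT => nfin; move/eqP: A0; apply.
  by rewrite /lattice_points /fset_set; case: pselect.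
by rewrite /lattice_points in_fset_set// inE.
Qed.

(** * Surfaces matching an enhancement *)

Section Classification.
Variables (R : realType) (Delta : set 'rV[R]_3).
Local Notation A := (lattice_points Delta).
Local Notation N := (num_points Delta).
Local Notation K := (puiseux R).
Hypothesis Delta_generates : differences_generate A.
Hypothesis N_gt0 : (0 < N)%N.
Variable v : 'rV[rat]_3.
Hypothesis v_general : general_direction Delta v.
Variable M : 'I_N -> rat.
Hypothesis M_incr : forall i j : 'I_N, (i < j)%N -> M i < M j.
Hypothesis M_generic : forall u u' e, (forall i, u i \in A) -> (forall i, u' i \in A) ->
  (forall i, height v (u i) != height v (u' i)) ->
  (forall i, e (u' i) - e (u i) = M i * (height v (u' i) - height v (u i))) ->
  @no_cell_relation R A N v u u' e /\ @no_tie_relation R A N u u' e.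
Variable p : 'M[K]_(N, 3).
Hypothesis p_val : forall i j, puiseux_val (p i j) = (ratr (M i * v 0 j))%:E.
Variable S : 'rV[int]_3 -> R.
Hypothesis S_marked : forall i, corner_locus Delta S (map_mx ratr (M i *: v)).
Variable C : {fset 'rV[int]_3}.
Hypothesis C_dual : dual_circuit Delta S C.
Hypothesis C_type : circuit_typeA R C \/ circuit_typeB R C.
Variable alpha : 'rV[int]_3 -> R[i].
Hypothesis alpha_enhancement : enhancement Delta p S C alpha.

Let cardA : #|` A| = N.+2.
Proof. by move: N_gt0; rewrite /num_points; case: #|` A| => [|[|n]]//; rewrite !subSS subn0. Qed.

Let A_neq0 : A != fset0.
Proof. by rewrite -cardfs_eq0 cardA. Qed.

Let alpha_neq0 w : w \in A -> alpha w != 0.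
Proof. by case: alpha_enhancement => a0 _ _; exact: a0. Qed.

Let CA : (C `<=` A)%fset.
Proof.
case: C_dual => _ [D [X [b [_ ->]]] CD]; apply/fsubsetP => w /CD[Dw _].
exact/lattice_pointsP.
Qed.

(** The polynomial that an enhancement provides has its leading exponents equal to [nu], and
    exponents of Puiseux series are rational. *)
Lemma enhancement_exponents : exists e : 'rV[int]_3 -> rat,
  forall w, w \in A -> nu Delta S (real_point R w) = (ratr (e w))%:E.
Proof.
have [_ [f [mf _]] _] := alpha_enhancement.
have [|e eP] := @choice _ _ (fun w r => w \in A -> nu Delta S (real_point R w) = (ratr r)%:E).
  move=> w; have [wA|] := boolP (w \in A); last by exists 0.
  by have [r [-> _ _]] := mf w wA; exists r.
by exists e.
Qed.

Lemma matches_polyP e f : (forall w, w \in A -> nu Delta S (real_point R w) = (ratr (e w))%:E) ->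
  matches_poly Delta S alpha f <-> forall w, w \in A -> lead (f w) (alpha w) (e w).
Proof.
move=> nu_e; split=> mf w wA.
  by have [r [re fr vr]] := mf w wA; move: re; rewrite nu_e// => -[/fmorph_inj ->].
by have [fe ve] := mf w wA; exists (e w); rewrite nu_e.
Qed.

Lemma exists_setting e : (forall w, w \in A -> nu Delta S (real_point R w) = (ratr (e w))%:E) ->
  exists (lambda : 'rV[int]_3 -> R) y b u u', setting A v M e C lambda y b u u'.
Proof.
move=> nu_e; have hinj := general_height_inj v_general.
have [lambda [rl l0]] := circuit_relation CA (proj1 C_dual).
have [D fD CD] := circuit_framed C_type.
have [X [c [cell_le cell_eq]]] : exists (X : 'rV[R]_3) c,
    (forall w, w \in A -> affine_form (X 0) c w <= ratr (e w)) /\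
    forall w, w \in C -> ratr (e w) = affine_form (X 0) c w.
  case: C_dual => _ [D' [X [c [Dle ->]]] CD']; exists X, c; split=> w wA.
    have := Dle (real_point R w) (proj1 (lattice_pointsP _ A_neq0) wA).
    by rewrite nu_e// lee_fin affine_form_dot.
  have [_] := CD' w wA; rewrite nu_e ?(fsubsetP CA)// => -[->].
  by rewrite affine_form_dot.
have [y [b [yE bE]]] := framed_rational fD CD cell_eq.
have formE w : affine_form (X 0) c w = ratr (affine_form y b w).
  by rewrite ratr_affine bE; congr (_ + _); apply: eq_bigr => j _; rewrite yE.
have pairs i : exists uu : 'rV[int]_3 * 'rV[int]_3, [/\ uu.1 \in A, uu.2 \in A,
    height v uu.1 < height v uu.2,
    M i * height v uu.2 - e uu.2 = M i * height v uu.1 - e uu.1 &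
    (forall x, x \in A -> M i * height v x - e x <= M i * height v uu.1 - e uu.1) /\
    forall x, x \in A -> M i * height v x - e x = M i * height v uu.1 - e uu.1 ->
      height v uu.1 <= height v x <= height v uu.2].
  have [|u [u' H]] := @extreme_pair A (height v) (fun x => M i * height v x - e x) hinj; last first.
    by exists (u, u').
  have [w [w' [wA w'A ww' gw gmax]]] := corner_e A_neq0 nu_e (S_marked i).
  exists w, w'; split=> // [|x xA].
    by apply: (fmorph_inj (ratr : rat -> R)); rewrite !rmorphB/= -!dot_marked.
  by rewrite -(ler_rat R) !rmorphB/= -!dot_marked gmax.
have [uu uuP] := choice pairs.
pose u i := (uu i).1; pose u' i := (uu i).2.
have uA i : u i \in A by case: (uuP i).
have u'A i : u' i \in A by case: (uuP i).
have hlt i : height v (u i) < height v (u' i) by case: (uuP i).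
have heq i : M i * height v (u' i) - e (u' i) = M i * height v (u i) - e (u i) by case: (uuP i).
have hne i : height v (u i) != height v (u' i) by rewrite lt_eqF.
have ce i : e (u' i) - e (u i) = M i * (height v (u' i) - height v (u i)).
  by have := heq i; lra.
have [g1 g2] := M_generic uA u'A hne ce.
exists lambda, y, b, u, u'; split=> //.
- by move=> i; case: (uuP i) => _ _ _ _ [].
- by move=> i; case: (uuP i) => _ _ _ _ [].
- by move=> F; exact: framed_spanning fD CD.
- by move=> w wA; rewrite -(ler_rat R) -formE cell_le.
- by move=> w wC; apply: (fmorph_inj (ratr : rat -> R)); rewrite [LHS](cell_eq w wC) formE.
Qed.

Theorem matching_singular_surfaces : exists s_ : 'rV[R[i]]_3 -> set ('rV[int]_3 -> K),
  [/\ exists Z, singular_at C alpha Z,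
      forall s, (Sing_through Delta p S s /\ matches Delta S alpha s) <->
        exists2 Z, singular_at C alpha Z & s = s_ Z,
      forall Z Z', singular_at C alpha Z -> singular_at C alpha Z' -> s_ Z = s_ Z' -> Z = Z' &
      forall Z Z', singular_at C alpha Z -> singular_at C alpha Z' ->
        exists2 zeta, character_on C zeta & Z' = hadamard Z zeta].
Proof.
have [_ [f [mf tf]] exZ] := alpha_enhancement.
have [e nu_e] := enhancement_exponents.
have [lambda [y [b [u [u' st]]]]] := exists_setting nu_e.
have [r1 [r2 [chi [[r1A r2A _] cchi chi1 chi2 rz]]]] := exists_edge_function st.
pose xi : 'M[R[i]]_(N, 3) := \matrix_(i < N, j < 3) p i j (- (M i * v 0 j)).
have lead_p i j : lead (p i j) (xi i j) (- (M i * v 0 j)).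
  by rewrite mxE; have [] := puiseux_val_fin (p_val i j).
have xi0 i j : xi i j != 0 by rewrite mxE; have [] := puiseux_val_fin (p_val i j).
have {}mf := proj1 (matches_polyP f nu_e) mf.
(* Cut off outside [A], because surfaces compare all coefficients and [supported] demands zeros
   there. *)
pose f0 w := if w \in A then f w else 0.
have f0A w : w \in A -> f0 w = f w by rewrite /f0 => ->.
have tf0 : through A p f0.
  by move=> i; rewrite -[RHS](tf i); apply: eq_big_seq => w /f0A ->.
have mf0 : matching A e alpha f0 by move=> w wA; rewrite f0A//; exact: mf.
have [f1 [tf1 f1out f1r1 lf1]] := exists_pencil_direction st r1A cchi chi1 chi2 rz
  lead_p xi0 alpha_neq0 tf0 mf0.
have [d dA] := exists_shift A.
have [sigma [sig1 sig2 sig3]] := pencil_singularities st r1A r2A cchi chi1 chi2 rz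
  lead_p xi0 alpha_neq0 tf0 mf0 tf1 f1r1 lf1 dA Delta_generates.
pose P Z := pencil f0 f1 (sigma Z).
have Pout Z w : w \notin A -> P Z w = 0.
  by move=> wA; rewrite /P /pencil /f0 (negbTE wA) f1out// mulr0 addr0.
have f0r1 : f0 r1 != 0 := lead_neq0 (mf0 _ r1A) (alpha_neq0 r1A).
have mP Z : singular_at C alpha Z -> matching A e alpha (P Z).
  by move=> /sig1[lZ _]; exact: (matching_pencil mf0 lf1 lZ).
exists (fun Z => surface (P Z)); split=> // [s|Z Z' sZ sZ'|Z Z' sZ sZ'].
- split=> [[[[g [gout [w0 gw0] [z sz]] <-] _ thr] [k [l l0 kE] mk]]|[Z sZ ->]].
    have {}mk := proj1 (matches_polyP k nu_e) mk.
    have tk : through A p k by move=> i; apply: thr; exists l.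
    have gk w : g w = l^-1 * k w by rewrite kE mulKf.
    have sk : exists z, singular_at A k z.
      exists z; apply: (singular_at_scale (l := l^-1)) sz; first by rewrite invr_eq0.
      by move=> w _; exact: gk.
    have [Z [l' [sZ l'0 kP]]] := sig2 k tk mk sk; exists Z => //.
    apply: (surface_scale (l := l^-1 * l')); first by rewrite mulf_neq0// invr_eq0.
    move=> w; have [wA|wA] := boolP (w \in A); first by rewrite gk kP// mulrA.
    by rewrite gout// Pout// mulr0.
  have [lZ [z sz]] := sig1 Z sZ; have mZ := mP Z sZ.
  split; last by exists (P Z); [exact: surface_refl|exact/(matches_polyP _ nu_e)].
  split.
  + exists (P Z) => //; split; [exact: Pout| |by exists z].
    by exists r1; exact: lead_neq0 (mZ _ r1A) (alpha_neq0 r1A).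
  + exists (P Z) => [|X]; first exact: surface_refl.
    exact: (tropF_valuation A_neq0 nu_e X mZ alpha_neq0).
  + move=> i g [l _ ->].
    exact: (throughZ l (through_pencil tf0 tf1 (sigma Z)) i).
(* Equal surfaces have proportional polynomials; the factor is 1 because all members of the pencil
   agree at [r1], and the coefficient at [r2] then recovers [theta]. *)
- move=> E; apply: sig3 => //.
  have [l l0 PE] : surface (P Z) (P Z') by rewrite E; exact: surface_refl.
  have P1 : P Z' r1 = l * P Z r1 by rewrite PE.
  have l1 : l = 1.
    move: P1; rewrite /P /pencil f1r1 !mulr0 !addr0 => /esym/eqP.
    by rewrite -[X in _ == X]mul1r (inj_eq (mulIf f0r1)) => /eqP.
  have P2 : P Z' r2 = P Z r2 by rewrite PE l1 mul1r.
  have f1r2 : f1 r2 != 0.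
    by apply: (lead_neq0 (lf1 _ r2A)); rewrite chi2 rmorph1 mulr1 alpha_neq0.
  by move: P2; rewrite /P /pencil => /addrI/(mulIf f1r2) ->.
- have [zeta [k [z0 ZE _ zk]]] := circuit_ratio st cchi chi1 chi2 rz alpha_neq0 sZ sZ'.
  by exists zeta => //; split=> //; exists k.
Qed.

End Classification.

Theorem lemma4p6 (R : realType) (Delta : set 'rV[R]_3)
    (Delta_polytope : lattice_polytope Delta)
    (Delta_generates : differences_generate (lattice_points Delta))
    (N_gt0 : (0 < num_points Delta)%N)
    (Delta_nondefective : nondefective Delta)
    (v : 'rV[rat]_3) (v_general : general_direction Delta v) :
  exists2 kappa : rat, 0 < kappa &
  forall M : 'I_(num_points Delta) -> rat, growth kappa M ->
  generically (fun p : 'M[puiseux R]_(num_points Delta, 3) =>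
    (forall i j, puiseux_val (p i j) = (ratr (M i * v 0 j))%:E) ->
    forall S : 'rV[int]_3 -> R, Sing_trop Delta S ->
    (forall i, corner_locus Delta S (map_mx ratr (M i *: v))) ->
    forall C : {fset 'rV[int]_3}, dual_circuit Delta S C ->
    circuit_typeA R C \/ circuit_typeB R C ->
    let C5 := typeB_model (point3 1 2 5) (point3 3 7 20) in
    (~ Zaffine_equivalent C C5 ->
      forall alpha, enhancement Delta p S C alpha ->
      exists! s, Sing_through Delta p S s /\ matches Delta S alpha s) /\
    (Zaffine_equivalent C C5 ->
      forall alpha, enhancement Delta p S C alpha ->
      ([set s | Sing_through Delta p S s /\ matches Delta S alpha s] #= `I_5)%card)).
Proof.
have [kappa k1 kappaP] := generic_kappa R (lattice_points Delta) (num_points Delta) v.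
exists kappa => [|M gM]; first by rewrite (lt_le_trans ltr01).
have [M0 Mlt] := growth_lt k1 gM.
have Mincr (i j : 'I_(num_points Delta)) : (i < j)%N -> M i < M j.
  by move=> /Mlt; apply: le_lt_trans; rewrite ler_peMl// ltW.
exists (mpoly.mpolyC _ 1) => [|p _ p_val S _ S_marked C C_dual C_type C5].
  by rewrite mpoly.mpolyC_eq0 oner_neq0.
have class alpha enh := @matching_singular_surfaces R Delta Delta_generates N_gt0 v v_general M
  Mincr (kappaP M gM) p p_val S S_marked C C_dual C_type alpha enh.
split=> CC5 alpha enh; have [s_ [[Z0 sZ0] sP s_inj ratio]] := class alpha enh.
- exists (s_ Z0); split=> [|s /sP[Z sZ ->]]; first by apply/sP; exists Z0.
  have [zeta cz ->] := ratio _ _ sZ0 sZ; congr s_; apply/rowP => j.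
  by rewrite mxE (circuit_rigid C_type CC5 cz) mulr1.
- have [g [gC gP ginj]] := quintic_circuit_character R[i] CC5.
  (* Twisting [Z0] by the characters of the fifth roots of unity reaches every singular point of the
     circuit polynomial, each once. *)
  pose h x := s_ (hadamard Z0 (g x)).
  have sg x : x ^+ 5 = 1 -> singular_at C alpha (hadamard Z0 (g x)).
    by move=> x5; apply: singular_twist => //; exact: gC.
  have [Z00 _ _] := sZ0.
  have -> : [set s | Sing_through Delta p S s /\ matches Delta S alpha s] =
      h @` [set x : R[i] | x ^+ 5 = 1].
    apply/seteqP; split=> s /= [].
      move=> s1 s2; have /sP[Z sZ ->] := conj s1 s2.
      have [zeta cz ->] := ratio _ _ sZ0 sZ; have [x x5 ->] := gP _ cz.
      by exists x.
    by move=> x x5 <-; apply/sP; exists (hadamard Z0 (g x)) => //; exact: sg.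
  have hinj : {in [set x : R[i] | x ^+ 5 = 1] &, injective h}.
    move=> x x' /set_mem /= x5 /set_mem /= x'5 /(s_inj _ _ (sg _ x5) (sg _ x'5)) E.
    apply: ginj => //; apply/rowP => j; have := congr1 (fun Z : 'rV[R[i]]_3 => Z 0 j) E.
    by rewrite !mxE => /(mulfI (Z00 j)).
  apply: card_eq_trans (inj_card_eq hinj) _; apply: card_roots_of_unity.
  by rewrite pnatr_eq0.
Qed.
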